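(* Let $\mathcal{H}$ be a Krein space with fundamental symmetry $J$, let $\mathcal{Q}$ be the set of $J$-normal projections and $\mathcal{E}$ the set of $J$-selfadjoint projections. The following assertions hold: (i) $\mathcal{Q}$ is an analytic submanifold of $L(\mathcal{H})$. (ii) $\mathcal{E}$ is an analytic submanifold of $L(\mathcal{H})$. (iii) The map $F:\mathcal{Q}\to\mathcal{E}$, $F(Q)=QQ^{\#}$, is a real analytic submersion.
   Context: $(\mathcal{H},\langle\cdot,\cdot\rangle)$ is a complex separable Hilbert space and $L(\mathcal{H})$ is the algebra of bounded operators on it. $J\in L(\mathcal{H})$ is a fixed symmetry ($J=J^*=J^{-1}$), and the Krein space structure is given by the indefinite inner product $[f,g]=\langle Jf,g\rangle$. For $T\in L(\mathcal{H})$ the $J$-adjoint is $T^{\#}=JT^*J$. $\mathcal{Q}=\{Q\in L(\mathcal{H}): Q^2=Q,\ QQ^{\#}=Q^{\#}Q\}$ and $\mathcal{E}=\{E\in L(\mathcal{H}):E^2=E,\ E^{\#}=E\}$. Here $L(\mathcal{H})$ is viewed as a real Banach space with the operator norm, and manifolds and submanifolds are real analytic Banach (sub)manifolds: a submanifold carries the topology inherited from $L(\mathcal{H})$ and its tangent spaces are closed complemented real subspaces of $L(\mathcal{H})$. In (iii), $\mathcal{Q}$ and $\mathcal{E}$ carry their submanifold structures; a submersion is an analytic map whose differential at every point is surjective with complemented kernel. *)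

(* Defs.v *)
From HB Require Import structures.
From mathcomp Require Import all_boot all_order all_algebra.
From mathcomp Require Import all_classical all_reals all_analysis.
From mathcomp Require Import complex.

Set Implicit Arguments.
Unset Strict Implicit.
Unset Printing Implicit Defensive.

Import Order.TTheory GRing.Theory Num.Theory.
Import numFieldNormedType.Exports.

Local Open Scope classical_set_scope.
Local Open Scope ring_scope.
Local Open Scope complex_scope.

Section BoundedOperators.
Context {R : realType} {H : completeNormedModType R[i]}.

Definition bounded_linear (f : H -> H) : Prop :=
  linear f /\ exists M : R, forall x, `|f x| <= M%:C * `|x|.

Record bounded_op : Type := BoundedOp {
  op_fun :> H -> H;
  op_funP : `[< bounded_linear op_fun >] }.

HB.instance Definition _ := [isSub for op_fun].
HB.instance Definition _ := [Choice of bounded_op by <:].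

Implicit Types (S T : bounded_op) (x y : H).

(** Norms of vectors live in [R[i]]; [rnorm] is the same number in [R]. *)
Definition rnorm x : R := complex.Re `|x|.

Lemma rnormE x : (rnorm x)%:C = `|x|.
Proof. by rewrite /rnorm RRe_real// ger0_real. Qed.

Lemma rnorm_ge0 x : 0 <= rnorm x.
Proof. by rewrite -lecR rnormE normr_ge0. Qed.

Lemma ler_rnormD x y : rnorm (x + y) <= rnorm x + rnorm y.
Proof. by rewrite -lecR rmorphD/= !rnormE ler_normD. Qed.

Lemma rnormZ (c : R) x : rnorm (c%:C *: x) = `|c| * rnorm x.
Proof.
by rewrite /rnorm normrZ normc_def/= expr0n/= addr0 sqrtr_sqr -rnormE -rmorphM.
Qed.

Lemma rnorm0 : rnorm 0 = 0.
Proof. by rewrite /rnorm normr0. Qed.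

Lemma op_ext S T : S =1 T -> S = T.
Proof. by move=> ST; apply/val_inj/funext. Qed.

Lemma op_linear T : linear T.
Proof. by have /asboolP[] := op_funP T. Qed.

Lemma opZD T (a : R[i]) x y : T (a *: x + y) = a *: T x + T y.
Proof. exact: op_linear. Qed.

Lemma op_0 T : T 0 = 0.
Proof. by have := opZD T (-1) 0 0; rewrite scaler0 addr0 scaleN1r addNr. Qed.

Lemma op_D T x y : T (x + y) = T x + T y.
Proof. by have := opZD T 1 x y; rewrite !scale1r. Qed.

Lemma op_Z T (a : R[i]) x : T (a *: x) = a *: T x.
Proof. by have := opZD T a x 0; rewrite op_0 !addr0. Qed.

Lemma op_bounded T : exists2 M : R, 0 <= M & forall x, rnorm (T x) <= M * rnorm x.
Proof.
have /asboolP[_ [M TM]] := op_funP T; exists `|M| => // x.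
apply: (@le_trans _ _ (M * rnorm x)).
  by rewrite -lecR rmorphM/= !rnormE.
by rewrite ler_wpM2r ?rnorm_ge0// ler_norm.
Qed.

Lemma bounded_linearP (f : H -> H) (M : R) :
  (forall (a : R[i]) x y, f (a *: x + y) = a *: f x + f y) ->
  (forall x, rnorm (f x) <= M * rnorm x) -> `[< bounded_linear f >].
Proof.
move=> fl fM; apply/asboolP; split; first exact: fl.
by exists M => x; rewrite -!rnormE -rmorphM lecR.
Qed.

Fact op0_subproof : `[< bounded_linear (fun=> 0) >].
Proof.
apply: (@bounded_linearP _ 0) => [a x y|x]; first by rewrite scaler0 addr0.
by rewrite rnorm0 mul0r.
Qed.
Definition op0 := BoundedOp op0_subproof.

Fact opD_subproof S T : `[< bounded_linear (fun x => S x + T x) >].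
Proof.
have [M M0 SM] := op_bounded S; have [N N0 TN] := op_bounded T.
apply: (@bounded_linearP _ (M + N)) => [a x y|x].
  by rewrite !opZD scalerDr addrACA.
by rewrite (le_trans (ler_rnormD _ _))// mulrDl lerD.
Qed.
Definition opD S T := BoundedOp (opD_subproof S T).

Fact opZ_subproof (c : R) T : `[< bounded_linear (fun x => c%:C *: T x) >].
Proof.
have [M M0 TM] := op_bounded T.
apply: (@bounded_linearP _ (`|c| * M)) => [a x y|x].
  by rewrite !opZD scalerDr !scalerA mulrC.
by rewrite rnormZ -mulrA ler_wpM2l.
Qed.
Definition opZ (c : R) T := BoundedOp (opZ_subproof c T).

Fact opN_subproof T : `[< bounded_linear (fun x => - T x) >].
Proof.
have [M M0 TM] := op_bounded T.
apply: (@bounded_linearP _ M) => [a x y|x]; first by rewrite opZD opprD scalerN.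
by rewrite /rnorm normrN TM.
Qed.
Definition opN T := BoundedOp (opN_subproof T).

Fact op1_subproof : `[< bounded_linear id >].
Proof. by apply: (@bounded_linearP _ 1) => // x; rewrite mul1r. Qed.
Definition op1 := BoundedOp op1_subproof.

Fact opM_subproof S T : `[< bounded_linear (S \o T) >].
Proof.
have [M M0 SM] := op_bounded S; have [N N0 TN] := op_bounded T.
apply: (@bounded_linearP _ (M * N)) => [a x y|x] /=; first by rewrite !opZD.
by rewrite (le_trans (SM _))// -mulrA ler_wpM2l.
Qed.
Definition opM S T := BoundedOp (opM_subproof S T).

Fact opDA : associative opD.
Proof. by move=> A B C; apply: op_ext => x /=; rewrite addrA. Qed.
Fact opDC : commutative opD.
Proof. by move=> A B; apply: op_ext => x /=; rewrite addrC. Qed.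
Fact op0D : left_id op0 opD.
Proof. by move=> A; apply: op_ext => x /=; rewrite add0r. Qed.
Fact opND : left_inverse op0 opN opD.
Proof.
by move=> A; apply: op_ext => x /=; rewrite addNr.
Qed.
HB.instance Definition _ := GRing.isZmodule.Build bounded_op opDA opDC op0D opND.

Fact opMA : associative opM.
Proof. by move=> A B C; apply: op_ext. Qed.
Fact op1M : left_id op1 opM.
Proof. by move=> A; apply: op_ext. Qed.
Fact opM1 : right_id op1 opM.
Proof. by move=> A; apply: op_ext. Qed.
Fact opMDl : left_distributive opM +%R.
Proof. by move=> A B C; apply: op_ext. Qed.
Fact opMDr : right_distributive opM +%R.
Proof. by move=> A B C; apply: op_ext => x /=; rewrite op_D. Qed.
HB.instance Definition _ :=
  GRing.Zmodule_isPzRing.Build bounded_op opMA op1M opM1 opMDl opMDr.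

Fact opZA (a b : R) T : opZ a (opZ b T) = opZ (a * b) T.
Proof. by apply: op_ext => x /=; rewrite scalerA rmorphM. Qed.
Fact op1Z : left_id 1 opZ.
Proof. by move=> A; apply: op_ext => x /=; rewrite rmorph1 scale1r. Qed.
Fact opZDr : right_distributive opZ +%R.
Proof. by move=> a A B; apply: op_ext => x /=; rewrite scalerDr. Qed.
Fact opZDl T : {morph opZ^~ T : a b / a + b}.
Proof. by move=> a b; apply: op_ext => x /=; rewrite rmorphD scalerDl. Qed.
(** Only real scalars act, making [bounded_op H] a real Banach space. *)
HB.instance Definition _ :=
  GRing.Zmodule_isLmodule.Build R bounded_op opZA op1Z opZDr opZDl.

Definition opnorm T : R := sup [set rnorm (T x) | x in [set x | rnorm x <= 1]].

Fact opnorm_has_sup T :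
  has_sup [set rnorm (T x) | x in [set x | rnorm x <= 1]].
Proof.
split; first by exists (rnorm (T 0)); exists 0 => //=; rewrite rnorm0.
have [M M0 TM] := op_bounded T; exists M => _ [x /= x1 <-].
by rewrite (le_trans (TM _))// ler_piMr.
Qed.

Lemma opnorm_ge0 T : 0 <= opnorm T.
Proof.
rewrite -(rnorm0) -(op_0 T); apply: ub_le_sup; first exact: (opnorm_has_sup T).2.
by exists 0 => //=; rewrite rnorm0.
Qed.

Lemma rnorm_eq0 x : rnorm x = 0 -> x = 0.
Proof. by move=> x0; apply/normr0_eq0; rewrite -rnormE x0. Qed.

Lemma ler_opnorm T x : rnorm (T x) <= opnorm T * rnorm x.
Proof.
have [/rnorm_eq0->|x0] := eqVneq (rnorm x) 0; first by rewrite op_0 rnorm0 mulr0.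
have xp : 0 < rnorm x by rewrite lt_def x0 rnorm_ge0.
rewrite -ler_pdivrMr// mulrC -[X in X * _]gtr0_norm ?invr_gt0// -rnormZ -op_Z.
apply: ub_le_sup; first exact: (opnorm_has_sup T).2.
by exists ((rnorm x)^-1%:C *: x) => //=; rewrite rnormZ gtr0_norm ?invr_gt0// mulVf.
Qed.

Lemma opnorm_le T (M : R) :
  (forall x, rnorm x <= 1 -> rnorm (T x) <= M) -> opnorm T <= M.
Proof.
move=> TM; apply: ge_sup; first exact: (opnorm_has_sup T).1.
by move=> _ [x /= /TM ? <-].
Qed.

Fact opnormD S T : opnorm (S + T) <= opnorm S + opnorm T.
Proof.
apply: opnorm_le => x x1; apply: le_trans (ler_rnormD _ _) _.
by apply: lerD; apply: le_trans (ler_opnorm _ _) _; rewrite ler_piMr ?opnorm_ge0.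
Qed.

Fact opnormZ (c : R) T : opnorm (c *: T) = `|c| * opnorm T.
Proof.
have le a U : opnorm (a *: U) <= `|a| * opnorm U.
  apply: opnorm_le => x x1; rewrite [(a *: U) x]/= rnormZ ler_wpM2l//.
  by apply: le_trans (ler_opnorm _ _) _; rewrite ler_piMr ?opnorm_ge0.
apply/eqP; rewrite eq_le le/=.
have [->|c0] := eqVneq c 0; first by rewrite normr0 mul0r opnorm_ge0.
rewrite -[in X in X <= _](scale1r T) -(mulVf c0) -scalerA.
rewrite (le_trans (ler_wpM2l _ (le _ _)))//.
by rewrite mulrA -normrM divff// normr1 mul1r.
Qed.

Fact opnorm_eq0 T : opnorm T = 0 -> T = 0.
Proof.
move=> T0; apply: op_ext => x; apply: rnorm_eq0; apply/eqP.
by rewrite eq_le rnorm_ge0 (le_trans (ler_opnorm _ _))// T0 mul0r.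
Qed.

HB.instance Definition _ :=
  Lmodule_isNormed.Build R bounded_op opnormD opnormZ opnorm_eq0.

Fact op_complete (F : set_system bounded_op) :
  ProperFilter F -> cauchy F -> cvg F.
Proof.
move=> FF Fc.
have unif (e : R) : 0 < e -> exists2 S : bounded_op, F (ball S e) &
    F [set T | forall x, rnorm (S x - (T : bounded_op) x) <= e * rnorm x].
  move=> e0; have /cauchyP/(_ e e0)[S SF] := Fc; exists S => //.
  apply: (@filterS _ F _ _ _ _ SF) => T; rewrite -ball_normE /ball_/= => /ltW STe x.
  by apply: le_trans (ler_opnorm (S - T) x) _; rewrite ler_wpM2r ?rnorm_ge0.
have ptcvg x : cvg ((fun T : bounded_op => T x) @ F).
  apply: cauchy_cvg; apply/cauchyP => e e0.
  have eE : e = (complex.Re e)%:C by rewrite RRe_real// gtr0_real.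
  have re0 : 0 < complex.Re e by rewrite -ltcR -eE.
  have x1 : 0 < rnorm x + 1 by rewrite ltr_pwDr// rnorm_ge0.
  have [S _ SF] := unif (complex.Re e / (rnorm x + 1)) (divr_gt0 re0 x1).
  exists (S x); apply: (@filterS _ F _ _ _ _ SF) => T ST /=; have Tx := ST x.
  rewrite -ball_normE /ball_/= -rnormE eE ltcR; apply: (le_lt_trans Tx).
  by rewrite mulrAC ltr_pdivrMr// ltr_pM2l// ltrDl.
pose L x := lim ((fun T : bounded_op => T x) @ F).
have LF x : (fun T : bounded_op => T x) @ F --> L x by exact: ptcvg.
have Lle (S : bounded_op) (e : R) :
    F [set T | forall x, rnorm (S x - (T : bounded_op) x) <= e * rnorm x] ->
    forall x, rnorm (S x - L x) <= e * rnorm x.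
  move=> SF x; apply/ler_addgt0Pr => d d0.
  have dC : 0 < d%:C :> R[i] by rewrite ltcR.
  have TLF := cvgr_dist_lt _ _ (LF x) _ dC.
  have [T [TL /(_ x) ST]] := @filter_ex _ F _ _ (@filterI _ F _ _ _ (TLF _) SF).
  have {}TL : rnorm (L x - T x) < d by rewrite -ltcR rnormE.
  have -> : S x - L x = (S x - T x) + (T x - L x) by rewrite addrA subrK.
  apply: le_trans (ler_rnormD _ _) _; apply: lerD => //.
  by rewrite /rnorm distrC ltW.
have Llin (a : R[i]) x y : L (a *: x + y) = a *: L x + L y.
  apply: (@cvg_unique _ (@norm_hausdorff _ H) _ _ _ _ (LF (a *: x + y))).
  have -> : (fun T : bounded_op => T (a *: x + y)) =
      (fun T : bounded_op => a *: T x) + (fun T : bounded_op => T y).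
    by apply/funext => T; exact: opZD.
  by apply: cvgD; [apply: cvgZr|]; exact: LF.
have [S0 _ /Lle S0L] := unif 1 ltr01.
have [M M0 SM] := op_bounded S0.
have Lb : `[< bounded_linear L >].
  apply: (@bounded_linearP _ (M + 1)) => // x.
  have -> : L x = S0 x + (- 1)%:C *: (S0 x - L x).
    by rewrite rmorphN1 scaleN1r opprB addrC subrK.
  rewrite mulrDl (le_trans (ler_rnormD _ _))// lerD//.
  by rewrite rnormZ normrN1 mul1r.
apply/cvg_ex; exists (BoundedOp Lb); apply/cvgrPdist_le => /= e e0.
have [S SF /Lle SL] := unif _ (divr_gt0 e0 (ltr0n R 2)).
apply: (@filterS _ F _ _ _ _ SF) => T; rewrite -ball_normE /ball_/= => /ltW ST.
rewrite [e]splitr -(subrK S (BoundedOp Lb)) -addrA.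
apply: le_trans (ler_normD _ _) (lerD _ ST).
rewrite distrC; apply: opnorm_le => x x1.
by apply: le_trans (SL x) _; rewrite ler_piMr// ltW// divr_gt0.
Qed.
HB.instance Definition _ := Uniform_isComplete.Build bounded_op op_complete.


End BoundedOperators.
Arguments bounded_op {R} H.

Section Krein.
Context {R : realType} {H : completeNormedModType R[i]}.
Implicit Types (ip : {dot H for @Num.conj R[i]}) (J T Q E : bounded_op H).

(** The form is linear in its first argument and conjugate-linear in the
    second; together with the completeness of [H] this is a Hilbert space. *)
Definition induces_norm ip : Prop := forall x : H, ip x x = `|x| ^+ 2.

Definition separable_space (T : topologicalType) : Prop :=
  exists D : set T, countable D /\ dense D.

(** The default value [0] is never reached when [ip] induces the norm of [H]:
    the adjoint exists by the Riesz representation theorem, and it is unique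
    since [ip] is definite. *)
Definition adjoint ip T : bounded_op H :=
  xget 0 [set S : bounded_op H | forall x y, ip (T x) y = ip x (S y)].

Definition is_symmetry ip J : Prop := adjoint ip J = J /\ J * J = 1.

(** The adjoint for the indefinite inner product [f, g |-> ip (J f) g]. *)
Definition J_adjoint ip J T : bounded_op H := J * adjoint ip T * J.

Definition J_normal_projections ip J : set (bounded_op H) :=
  [set Q | Q * Q = Q /\ Q * J_adjoint ip J Q = J_adjoint ip J Q * Q].

Definition J_selfadjoint_projections ip J : set (bounded_op H) :=
  [set E | E * E = E /\ J_adjoint ip J E = E].

End Krein.

Section Analytic.
Context {R : realType} {V W : normedModType R}.

Definition multilinear (k : nat) (a : ('I_k -> V) -> W) : Prop :=
  forall (v : 'I_k -> V) (i : 'I_k),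
    linear (fun u : V => a (@dfwith _ (fun=> V) v i u)).

(** On the points of [D] near [x], [f] is the sum of a power series centred at
    [x], whose terms are the homogeneous polynomials [h |-> a k (h, .., h)]
    given by bounded [k]-linear maps with [|a k| = O(r^-k)]. The maps [a k] need
    not be symmetric: symmetrizing them changes neither the polynomials nor the
    bound. *)
Definition has_power_series (D : set V) (f : V -> W) (x : V) : Prop :=
  exists (r C : R) (a : forall k : nat, ('I_k -> V) -> W),
  [/\ 0 < r,
      forall k, multilinear (a k),
      forall k (v : 'I_k -> V), `|a k v| * r ^+ k <= C * \prod_(i < k) `|v i| &
      forall h : V, `|h| < r -> D (x + h) ->
        [series a k (fun=> h)]_k @ \oo --> f (x + h)].

(** For [D] open this is the usual notion. It is also used for [D] relatively
    open in a closed complemented subspace [M]; composing the [a k] with a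
    bounded projection onto [M] shows that it is then analyticity on the open
    subset [D] of the Banach space [M]. *)
Definition analytic_on (D : set V) (f : V -> W) : Prop :=
  forall x, D x -> has_power_series D f x.

End Analytic.

Section Subspaces.
Context {R : realType} {V : completeNormedModType R}.
Implicit Types M N E : set V.

Definition closed_subspace M : Prop :=
  [/\ M 0, forall (c : R) u v, M u -> M v -> M (c *: u + v) & closed M].

(** [M] is a closed subspace of [E] with a closed complement in [E]. *)
Definition complemented_in E M : Prop :=
  [/\ closed_subspace M, M `<=` E &
      exists N, [/\ closed_subspace N, N `<=` E, M `&` N `<=` [set 0] &
        forall u, E u -> exists m n, [/\ M m, N n & u = m + n]]].

End Subspaces.

(** A bianalytic change of coordinates from the open set [chart_dom] onto an
    open set of the same space, in which a submanifold becomes the linear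
    subspace [chart_model]. *)
Record chart (V : Type) := Chart {
  chart_dom : set V;
  chart_map : V -> V;
  chart_inv : V -> V;
  chart_model : set V }.

Definition chart_codom (V : Type) (c : chart V) : set V :=
  chart_map c @` chart_dom c.

Section Submanifolds.
Context {R : realType} {V : completeNormedModType R}.
Implicit Types (S : set V) (c : chart V) (x : V).

Definition submanifold_chart S c x : Prop :=
  [/\ open (chart_dom c) /\ chart_dom c x,
      open (chart_codom c),
      {in chart_dom c, cancel (chart_map c) (chart_inv c)},
      analytic_on (chart_dom c) (chart_map c) /\
        analytic_on (chart_codom c) (chart_inv c) &
      complemented_in setT (chart_model c) /\
        chart_map c @` (chart_dom c `&` S) = chart_codom c `&` chart_model c].

Definition analytic_submanifold S : Prop :=
  forall x, S x -> exists c, submanifold_chart S c x.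

Definition analytic_curve S x (g : R^o -> V) : Prop :=
  g 0 = x /\ exists2 e : R, 0 < e &
    analytic_on [set t : R^o | `|t| < e] g /\
    forall t : R^o, `|t| < e -> S (g t).

Definition tangent_space S x : set V :=
  [set u | exists g : R^o -> V,
    analytic_curve S x g /\ is_derive (0 : R^o) (1 : R^o) g u].

End Submanifolds.

Section Submersions.
Context {R : realType} {V W : completeNormedModType R}.
Implicit Types (S : set V) (T : set W) (f : V -> W).

(** [f] matters only through its restriction [S -> T]; it is analytic if it is
    so in submanifold charts. *)
Definition analytic_map S T f : Prop :=
  (forall x, S x -> T (f x)) /\
  forall x, S x -> exists (c : chart V) (d : chart W),
    [/\ submanifold_chart S c x, submanifold_chart T d (f x),
        forall y, chart_dom c y -> S y -> chart_dom d (f y) &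
        analytic_on (chart_codom c `&` chart_model c)
          (chart_map d \o f \o chart_inv c)].

(** The graph of the differential of [f : S -> T] at [x]: it sends the velocity
    of a curve in [S] through [x] to the velocity of its image by [f]. *)
Definition differential S f x (u : V) (w : W) : Prop :=
  exists g : R^o -> V, [/\ analytic_curve S x g,
    is_derive (0 : R^o) (1 : R^o) g u &
    is_derive (0 : R^o) (1 : R^o) (f \o g) w].

Definition analytic_submersion S T f : Prop :=
  analytic_map S T f /\
  forall x, S x ->
    (forall w, tangent_space T (f x) w ->
       exists u, differential S f x u w) /\
    complemented_in (tangent_space S x) [set u | differential S f x u 0].

End Submersions.

(* Main.v *)
Require Import Defs.
From HB Require Import structures.
From mathcomp Require Import all_boot all_order all_algebra.
From mathcomp Require Import all_classical all_reals all_analysis.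
From mathcomp Require Import complex.
From mathcomp Require Import ring lra zify.

(**
The J-adjoint is a bounded involution # on the real Banach algebra L(H), so both
sets are defined by polynomial equations in X and X#. If S is, near each of its
points x, the image of an analytic retraction r, then S is a submanifold: with
P = r'(x), an idempotent, the map y |-> P (r y - x) + (1 - P) (y - r y) has
differential 1 at x, hence by the analytic inverse function theorem it is a chart,
and it maps S onto the range of P, which is also the tangent space.

Such retractions come from functional calculus, for which analytic inverse square
roots near 1 suffice. For selfadjoint projections, take the spectral projection near
1 of the hermitian part of X. A normal projection Q is encoded by the commuting
pair D = Q - Q# (skew-adjoint with D^3 = D) and E = QQ#, since Q = E + (D^2 + D) / 2
and ED = 0; for X near Q, first replace X - X# by its sign function D, then compress
the hermitian part of X to 1 - D^2 and take its spectral projection.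

For the submersion, a tangent vector w of the selfadjoint projections at E = QQ#
satisfies w = [z, E] with z = [w, E] skew-adjoint. Conjugating Q by the Cayley
transforms of t z / 2 gives a curve of normal projections with velocity [z, Q],
whose image under F has velocity w. So w |-> [[w, E], Q] is a bounded right inverse
of the differential of F, and splits its kernel.
*)

Set Implicit Arguments.
Unset Strict Implicit.
Unset Printing Implicit Defensive.

Import Order.TTheory GRing.Theory Num.Theory.
Import numFieldNormedType.Exports.

Local Open Scope classical_set_scope.
Local Open Scope ring_scope.

(** * Power series *)

(** The involution # need not satisfy the C*-identity and a J-selfadjoint operator need not have
    real spectrum, so no calculus based on positivity is available. The retractions only apply
    functions to operators close to 1. For a projection X, 2X - 1 squares to 1, so for X nearby an
    inverse square root of (2X - 1)^2 turns 2X - 1 into an exact reflection. The skew part D = Q -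
    Q# has spectrum in {-1, 0, 1}, so D^2 may fail to be invertible; its spectral projection near 1
    is split off first, and the identity is put on the complementary part before the inverse square
    root is taken.

    A square root obtained from the inverse function theorem is known only through its defining
    equation. That its inverse commutes with whatever commutes with the argument, and is fixed by #
    when the argument is, comes from uniqueness near 1, that is, from the injectivity of a Sylvester
    operator. This is why the retractions land exactly in the two sets.

    The inverse function theorem yields analyticity at one point, while charts need it on open sets;
    recentering power series closes this gap. *)

Section Multilinear.
Context {R : realType} {V : normedModType R}.
Implicit Types (s p : seq V) (h u v : V).

Definition normprod s : R := \prod_(u <- s) `|u|.

Lemma normprod_ge0 s : 0 <= normprod s.
Proof. by apply: prodr_ge0. Qed.

Lemma normprod_nil : normprod [::] = 1.
Proof. by rewrite /normprod big_nil. Qed.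

Lemma normprod_cons u s : normprod (u :: s) = `|u| * normprod s.
Proof. by rewrite /normprod big_cons. Qed.

Lemma normprod_cat s p : normprod (s ++ p) = normprod s * normprod p.
Proof. by rewrite /normprod big_cat. Qed.

Lemma normprod_nseq n h : normprod (nseq n h) = `|h| ^+ n.
Proof. by elim: n => [|n IH]; rewrite ?normprod_nil// normprod_cons IH exprS. Qed.

Lemma normprod_split j s : normprod (take j s) * normprod (drop j s) = normprod s.
Proof. by rewrite -normprod_cat cat_take_drop. Qed.

Section Conv.
Context {W : normedModType R}.
Implicit Types (a : seq V -> W) (G : seq V -> seq V -> W).

(** One function on lists carries the coefficients of all degrees, so that degrees add under
    concatenation and no index types have to be matched. *)
Definition multilin a := forall s p (c : R) u v,
  a (s ++ (c *: u + v) :: p) = c *: a (s ++ u :: p) + a (s ++ v :: p).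

Lemma multilin_cons a u : multilin a -> multilin (fun s => a (u :: s)).
Proof. by move=> al s p c v w; rewrite -!cat_cons al. Qed.

Lemma multilin_hd a s c u v : multilin a ->
  a ((c *: u + v) :: s) = c *: a (u :: s) + a (v :: s).
Proof. by move=> /(_ [::] s c u v). Qed.

Lemma multilin_0 a s : multilin a -> a (0 :: s) = 0.
Proof.
move=> al; have := multilin_hd s (-1) 0 0 al.
by rewrite scaler0 addr0 scaleN1r addNr.
Qed.

Lemma multilinD a b : multilin a -> multilin b -> multilin (a \+ b).
Proof. by move=> al bl s p c u v; rewrite /= al bl scalerDr addrACA. Qed.

Lemma multilinN a : multilin a -> multilin (fun s => - a s).
Proof. by move=> al s p c u v; rewrite al opprD scalerN. Qed.

Lemma multilin_sum (m : nat) (a : nat -> seq V -> W) (N : seq V -> nat) :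
  (forall k, multilin (a k)) -> (forall s p, size s = size p -> N s = N p) ->
  multilin (fun s => \sum_(m <= k < N s) a k s).
Proof.
move=> al Ns s p c u v.
have E w : N (s ++ w :: p) = N (s ++ u :: p) by apply: Ns; rewrite !size_cat.
rewrite (E (c *: u + v)) (E v).
by rewrite scaler_sumr -big_split; apply: eq_bigr => k _; exact: al.
Qed.

(** Cauchy product. Cutting the list at one point is enough, since coefficients need not be
    symmetric. *)
Definition conv G s : W := \sum_(j < (size s).+1) G (take j s) (drop j s).

(** The side of the cut on which an argument falls does not depend on its value, so linearity of
    [conv] can be checked summand by summand. *)
Lemma take_drop_cat j s u p : (j < (size (s ++ u :: p)).+1)%N ->
  (exists s1 s2, forall v, take j (s ++ v :: p) = s1 /\ drop j (s ++ v :: p) = s2 ++ v :: p) \/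
  (exists p1 p2, forall v, take j (s ++ v :: p) = s ++ v :: p1 /\ drop j (s ++ v :: p) = p2).
Proof.
move=> _; have [js|sj] := leqP j (size s).
  left; exists (take j s), (drop j s) => v; split.
    by rewrite take_cat; case: ltngtP js => // ->; rewrite subnn take0 cats0 take_size.
  by rewrite drop_cat; case: ltngtP js => // ->; rewrite subnn drop0 drop_size.
right; exists (take (j - size s).-1 p), (drop (j - size s).-1 p) => v.
have js : (j - size s = (j - size s).-1.+1)%N by rewrite prednK// subn_gt0.
by rewrite take_cat drop_cat ltnNge (ltnW sj)/= js.
Qed.

Lemma multilin_conv G : (forall s, multilin (G^~ s)) -> (forall s, multilin (G s)) ->
  multilin (conv G).
Proof.
move=> Gl Gr s p c u v; rewrite /conv scaler_sumr.
have E w : size (s ++ w :: p) = size (s ++ u :: p) by rewrite !size_cat.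
rewrite (E (c *: u + v)) (E v).
rewrite -big_split; apply: eq_bigr => -[j /= ji] _.
have [[s1 [s2 e]]|[p1 [p2 e]]] := take_drop_cat ji.
  by rewrite !(e _).1 !(e _).2 Gr.
by rewrite !(e _).1 !(e _).2 Gl.
Qed.

(** The weights are arbitrary sequences, to serve both geometric bounds and the weights [1 / n ^ 2]
    of the inverse series. *)
Lemma conv_bound G (be mu : nat -> R) s :
  (forall p q, `|G p q| <= be (size p) * mu (size q) * (normprod p * normprod q)) ->
  `|conv G s| <= (\sum_(j < (size s).+1) be j * mu (size s - j)%N) * normprod s.
Proof.
move=> GM; rewrite mulr_suml; apply: le_trans (ler_norm_sum _ _ _) (ler_sum _ _).
move=> -[j /= jn] _; rewrite -(normprod_split j s); apply: le_trans (GM _ _) _.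
by rewrite size_drop size_takel.
Qed.

Lemma conv_nseq G n h :
  conv G (nseq n h) = \sum_(j < n.+1) G (nseq j h) (nseq (n - j) h).
Proof.
rewrite /conv size_nseq; apply: eq_bigr => -[j /= jn] _.
by rewrite take_nseq // drop_nseq.
Qed.

(** Rewrites a partial sum of a Cauchy product so that the inner sums are partial sums of the second
    factor. *)
Lemma sum_triangle (F : nat -> nat -> W) N :
  \sum_(n < N) \sum_(j < n.+1) F j (n - j)%N =
  \sum_(j < N) \sum_(l < N - j) F j l.
Proof.
elim: N => [|N IH]; first by rewrite !big_ord0.
rewrite big_ord_recr/= IH [RHS]big_ord_recr/= subSnn big_ord1.
rewrite [in LHS]big_ord_recr/= subnn addrA; congr (_ + _).
rewrite -big_split; apply: eq_bigr => -[j /= jN] _.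
by rewrite subSn ?(ltnW jN)// big_ord_recr.
Qed.

End Conv.
End Multilinear.

(** * Analytic maps: expansions with remainder bounds, derivatives, sums and products *)

Section Expansion.
Context {R : realType}.
Implicit Types V W : normedModType R.

Lemma eq_ler (c d : R) : c = d -> c <= d.
Proof. by move->. Qed.

(** The [k]-linear coefficient is [a] on lists of length [k]. Bounding the
    remainder at every order, instead of asking for convergence, turns products
    and composites into finite identities between partial sums. The radius is
    [q^-1]. *)
Definition has_expansion V W (f : V -> W) (x : V) (a : seq V -> W) (C q : R) :=
  [/\ 0 <= C, 0 < q, multilin a,
      forall s, `|a s| <= C * q ^+ size s * normprod s &
      forall n h, q * `|h| < 1 ->
        `|f (x + h) - \sum_(k < n) a (nseq k h)| <= C * (q * `|h|) ^+ n].

Definition analytic_at V W (f : V -> W) (x : V) :=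
  exists a C q, has_expansion f x a C q.

Lemma expansion_weaken V W (f : V -> W) x a C q C' q' : C <= C' -> q <= q' ->
  has_expansion f x a C q -> has_expansion f x a C' q'.
Proof.
move=> CC qq [C0 q0 al aM aR].
have q0' : 0 < q' by apply: lt_le_trans qq.
have C0' : 0 <= C' by apply: le_trans CC.
split=> // [s|n h hq].
  apply: le_trans (aM s) _; rewrite ler_wpM2r ?normprod_ge0//.
  by rewrite ler_pM ?exprn_ge0 ?lerXn2r ?nnegrE ?(ltW q0) ?(ltW q0').
have qh : q * `|h| <= q' * `|h| by rewrite ler_wpM2r.
apply: le_trans (aR n h (le_lt_trans qh hq)) _.
by rewrite ler_pM ?exprn_ge0 ?lerXn2r ?nnegrE ?mulr_ge0 ?(ltW q0) ?(ltW q0').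
Qed.

Lemma expansion_nil V W (f : V -> W) x a C q :
  has_expansion f x a C q -> a [::] = f x.
Proof.
move=> [C0 q0 al aM aR]; have := aR 1%N 0.
rewrite normr0 mulr0 addr0 expr1 mulr0 big_ord1/= => /(_ ltr01).
by rewrite normr_le0 subr_eq0 => /eqP.
Qed.

(** Neighbourhoods in terms of an inverse radius, the form in which [has_expansion] states its
    domain. *)
Lemma near_ball V (x : V) (P : set V) : (\forall y \near x, P y) <->
  exists2 q : R, 0 < q & forall h, q * `|h| < 1 -> P (x + h).
Proof.
split=> [/nbhs_ballP[e /= e0 eP]|[q q0 qP]].
  exists e^-1; first by rewrite invr_gt0.
  move=> h; rewrite ltr_pdivrMl// mulr1 => he; apply: eP.
  by rewrite -ball_normE /ball_/= opprD addNKr normrN.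
apply/nbhs_ballP; exists q^-1 => /=; first by rewrite invr_gt0.
move=> y; rewrite -ball_normE /ball_/= distrC => yq.
by rewrite -(subrK x y) addrC; apply: qP; rewrite -ltr_pdivlMl// mulr1.
Qed.

Lemma analytic_at_near V W (f g : V -> W) x :
  (\forall y \near x, f y = g y) -> analytic_at f x -> analytic_at g x.
Proof.
move=> /near_ball[q q0 fg] [a [C [p fa]]]; exists a, C, (p + q).
have pq : p <= p + q by rewrite lerDl ltW.
have [C0 p0 al aM aR] := expansion_weaken (lexx C) pq fa.
split=> // n h hq; rewrite -fg ?aR//; apply: le_lt_trans hq.
by rewrite ler_wpM2r// lerDr; have [_ /ltW] := fa.
Qed.

Lemma expansion_deg1_linear V W (f : V -> W) x a C q :
  has_expansion f x a C q -> linear (fun h => a [:: h]).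
Proof. by move=> [_ _ al _ _] c u v; apply: multilin_hd. Qed.

Lemma linear_le_continuous V W (L : {linear V -> W}) (K : R) :
  (forall h, `|L h| <= K * `|h|) -> continuous L.
Proof.
move=> LK; apply/linear_bounded_continuous/linear_boundedP; near=> r => h.
apply: le_trans (LK h) _; rewrite ler_wpM2r//; near: r; exact: nbhs_pinfty_ge.
Unshelve. all: by end_near. Qed.

Lemma continuous_linear_le V W (L : {linear V -> W}) : continuous L ->
  exists2 K : R, 0 <= K & forall h, `|L h| <= K * `|h|.
Proof.
move=> /linear_bounded_continuous/linear_boundedP/pinfty_ex_gt0[K K0 LK].
by exists K; first exact: ltW.
Qed.

Lemma expansion_differentiable V W (f : V -> W) x a C q :
  has_expansion f x a C q -> differentiable f x /\ forall h, 'd f x h = a [:: h].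
Proof.
move=> fa; have [C0 q0 al aM aR] := fa.
pose L : {linear V -> W} := HB.pack (fun h => a [:: h])
  (GRing.isLinear.Build R V W _ _ (expansion_deg1_linear fa)).
have Lc : continuous L.
  apply: (@linear_le_continuous _ _ _ (C * q)) => h.
  by apply: le_trans (aM _) _; rewrite normprod_cons normprod_nil mulr1 expr1.
have fL : f \o shift x = cst (f x) + L +o_ (0 : V) id.
  apply/eqaddoP => e e0; apply/near_ball.
  (* The first summand keeps [h] in the disc of the expansion; the second makes the order two
     remainder [C * (q * |h|) ^ 2] at most [e * |h|]. *)
  exists (q + C * q ^+ 2 / e); first by rewrite ltr_wpDr// divr_ge0 ?mulr_ge0// ltW.
  move=> h; rewrite add0r mulrDl => hq.
  have p1 : 0 <= C * q ^+ 2 / e * `|h|.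
    by rewrite !mulr_ge0// ?invr_ge0 ?exprn_ge0// ltW.
  have qh : q * `|h| < 1 by lra.
  have := aR 2%N h qh; rewrite big_ord_recr big_ord1/= (expansion_nil fa).
  rewrite opprD addrA => /le_trans H.
  rewrite [X in `|X|](_ : _ = f (x + h) - f x - a [:: h]); first apply: H.
    2: by rewrite -addrA -opprD [x + h]addrC.
  rewrite exprMn mulrA (expr2 `|h|) mulrA ler_wpM2r//.
  have : C * q ^+ 2 / e * `|h| <= 1 by have := mulr_ge0 (ltW q0) (normr_ge0 h); lra.
  by rewrite mulrAC ler_pdivrMr// mul1r.
have dfL := diff_unique Lc fL; split; last by move=> h; rewrite dfL.
by apply/diff_locallyP; rewrite dfL.
Qed.

Lemma analytic_at_differentiable V W (f : V -> W) x :
  analytic_at f x -> differentiable f x.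
Proof. by move=> [a [C [q /expansion_differentiable[]]]]. Qed.

Lemma analytic_at_continuous V W (f : V -> W) x : analytic_at f x -> {for x, continuous f}.
Proof. by move=> /analytic_at_differentiable/differentiable_continuous. Qed.

Lemma analytic_at_nbhs V W (f : V -> W) x (P : set W) : analytic_at f x ->
  (\forall y \near f x, P y) -> \forall y \near x, P (f y).
Proof. by move=> /analytic_at_continuous fc /fc. Qed.

Lemma analytic_at_linear V W (L : {linear V -> W}) x : continuous L -> analytic_at L x.
Proof.
move=> /continuous_linear_le[K K0 LK].
exists (fun s => match s with [::] => L x | [:: h] => L h | _ => 0 end).
exists (`|L x| + K), 1; split=> //.
- by rewrite addr_ge0.
- by move=> [|w [|w' s]] [|w2 p] c u v /=; rewrite ?linearP ?scaler0 ?addr0.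
- case=> [|h [|h' s]].
  + by rewrite expr0 normprod_nil !mulr1 lerDl.
  + rewrite expr1 normprod_cons normprod_nil !mulr1; apply: le_trans (LK h) _.
    by rewrite ler_wpM2r// lerDr.
  + by rewrite normr0 expr1n mulr1 mulr_ge0 ?addr_ge0 ?normprod_ge0.
move=> [|[|n]] h; rewrite mul1r => h1.
- rewrite big_ord0 subr0 expr0 mulr1 linearD; apply: le_trans (ler_normD _ _) _.
  by rewrite lerD2l (le_trans (LK h))// ler_piMr// ltW.
- rewrite big_ord1/= linearD addrAC subrr add0r expr1; apply: le_trans (LK h) _.
  by rewrite ler_wpM2r// lerDr.
- rewrite big_ord_recl big_ord_recl/= big1 => [|i _]; last by [].
  by rewrite addr0 linearD subrr normr0 mulr_ge0 ?exprn_ge0 ?addr_ge0.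
Qed.

Lemma analytic_at_id V (x : V) : analytic_at id x.
Proof. by apply: (@analytic_at_linear _ _ idfun) => y; apply: cvg_id. Qed.

Lemma expansion_cst V W (w : W) (x : V) :
  has_expansion (fun=> w) x (fun s => if s is [::] then w else 0) `|w| 1.
Proof.
split=> //.
- by case=> [|w' s] [|u' p] c u v; rewrite /= scaler0 addr0.
- case=> [|h s]; first by rewrite expr0 normprod_nil !mulr1.
  by rewrite normr0 expr1n mulr1 mulr_ge0 ?normprod_ge0.
move=> [|n] h _; first by rewrite big_ord0 subr0 expr0 mulr1.
rewrite big_ord_recl/= big1 => [|i _]; last by [].
by rewrite addr0 subrr normr0 !mulr_ge0 ?exprn_ge0 ?mulr_ge0.
Qed.

Lemma analytic_at_cst V W (w : W) (x : V) : analytic_at (fun=> w) x.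
Proof. by do 3 eexists; exact: expansion_cst. Qed.

Lemma expansionD V W (f g : V -> W) x a b C D q p :
  has_expansion f x a C q -> has_expansion g x b D p ->
  has_expansion (fun y => f y + g y) x (a \+ b) (C + D) (q + p).
Proof.
move=> fa gb.
have [[_ q0 _ _ _] [_ p0 _ _ _]] := (fa, gb).
have qp : q <= q + p by rewrite lerDl ltW.
have pq : p <= q + p by rewrite lerDr ltW.
have [C0 qp0 al aM aR] := expansion_weaken (lexx _) qp fa.
have [D0 _ bl bM bR] := expansion_weaken (lexx _) pq gb.
split=> //; first by rewrite addr_ge0.
- exact: multilinD.
- by move=> s; rewrite !mulrDl; apply: le_trans (ler_normD _ _) (lerD _ _).
move=> n h hq; rewrite big_split/= opprD addrACA mulrDl.
by apply: le_trans (ler_normD _ _) (lerD (aR _ _ hq) (bR _ _ hq)).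
Qed.

Lemma analytic_atD V W (f g : V -> W) x :
  analytic_at f x -> analytic_at g x -> analytic_at (fun y => f y + g y) x.
Proof.
move=> [a [C [q fa]]] [b [D [p gb]]].
by do 3 eexists; exact: expansionD fa gb.
Qed.

(** The number of summands of a Cauchy product is absorbed by doubling [q]. *)
Lemma expr2n_ge n : (n.+1%:R : R) <= 2 ^+ n.
Proof. by rewrite -natrX ler_nat ltn_expl. Qed.

Lemma expansion_bilinear V W1 W2 W (B : W1 -> W2 -> W) (K : R)
    (f : V -> W1) (g : V -> W2) x a b (C D q p : R) :
  (forall v, linear (B^~ v)) -> (forall u, linear (B u)) ->
  (forall u v, `|B u v| <= K * (`|u| * `|v|)) ->
  has_expansion f x a C q -> has_expansion g x b D p ->
  exists C' q', has_expansion (fun y => B (f y) (g y)) x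
    (conv (fun s t => B (a s) (b t))) C' q'.
Proof.
move=> Bl Br BK' fa gb.
wlog K0 : K BK' / 0 <= K.
  move=> /(_ `|K|); apply=> // u v; apply: le_trans (BK' u v) _.
  by rewrite ler_wpM2r ?mulr_ge0// ler_norm.
have BK u v c d : `|u| <= c -> `|v| <= d -> `|B u v| <= K * (c * d).
  by move=> uc vd; apply: le_trans (BK' _ _) _; rewrite ler_wpM2l// ler_pM.
have [[_ q0 _ _ _] [_ p0 _ _ _]] := (fa, gb).
have qp : q <= q + p by rewrite lerDl ltW.
have pq : p <= q + p by rewrite lerDr ltW.
have [C0 qp0 al aM aR] := expansion_weaken (lexx _) qp fa.
have [D0 _ bl bM bR] := expansion_weaken (lexx _) pq gb.
move: (q + p) qp0 aM aR bM bR => r r0 aM aR bM bR {p q fa gb q0 p0 qp pq}.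
have BDr u v v' : B u (v - v') = B u v - B u v'.
  by rewrite addrC -scaleN1r Br scaleN1r addrC.
have B_sumr u n (F : 'I_n -> W2) : B u (\sum_(i < n) F i) = \sum_(i < n) B u (F i).
  have B0 : B u 0 = 0 by have := BDr u 0 0; rewrite !subrr.
  by apply: (big_morph _ _ B0) => v v'; have := Br u 1 v v'; rewrite !scale1r.
have BDl u u' v : B (u - u') v = B u v - B u' v.
  by rewrite addrC -scaleN1r Bl scaleN1r addrC.
have B_suml v n (F : 'I_n -> W1) : B (\sum_(i < n) F i) v = \sum_(i < n) B (F i) v.
  have B0 : B 0 v = 0 by have := BDl 0 0 v; rewrite !subrr.
  by apply: (big_morph (B^~ v) _ B0) => u u'; have := Bl v 1 u u'; rewrite !scale1r.
exists (K * (C * D)), (2 * r); split=> //.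
- by rewrite !mulr_ge0.
- by rewrite mulr_gt0.
- apply: multilin_conv => [t s1 s2 c u v|s s1 s2 c u v]; rewrite /= ?al ?bl.
    exact: Bl.
  exact: Br.
- move=> s; apply: le_trans (@conv_bound _ _ _ _
    (fun n => K * C * r ^+ n) (fun n => D * r ^+ n) _ _) _.
    move=> t u; apply: le_trans (BK _ _ _ _ (aM _) (bM _)) _.
    by apply: eq_ler; ring.
  rewrite ler_wpM2r ?normprod_ge0//.
  rewrite (eq_bigr (fun=> K * (C * D) * r ^+ size s)) => [|j _].
    rewrite sumr_const card_ord -(mulr_natr _ (size s).+1) -[leLHS]mulrA ler_wpM2l ?mulr_ge0//.
    by rewrite exprMn mulrC ler_wpM2r ?exprn_ge0 ?(ltW r0)// expr2n_ge.
  have -> : r ^+ size s = r ^+ j * r ^+ (size s - j) by rewrite -exprD subnKC// leq_ord.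
  by ring.
move=> n h hr2; have rh0 : 0 <= r * `|h| by rewrite mulr_ge0// ltW.
have hr : r * `|h| < 1 by rewrite -mulrA in hr2; lra.
under eq_bigr => k _ do rewrite conv_nseq.
rewrite (sum_triangle (fun j l => B (a (nseq j h)) (b (nseq l h)))).
under eq_bigr => j _ do rewrite -B_sumr.
(* Replacing the first factor by its partial sum, and then the second factor in each term, leaves
   [n + 1] errors, each at most [K * C * D * (r * |h|) ^ n]. *)
have -> : B (f (x + h)) (g (x + h)) -
   \sum_(j < n) B (a (nseq j h)) (\sum_(l < n - j) b (nseq l h)) =
   B (f (x + h) - \sum_(j < n) a (nseq j h)) (g (x + h)) +
   \sum_(j < n) B (a (nseq j h)) (g (x + h) - \sum_(l < n - j) b (nseq l h)).
  rewrite BDl B_suml; under [X in _ = _ + X]eq_bigr => j _ do rewrite BDr.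
  by rewrite sumrB addrA subrK.
have gb : `|g (x + h)| <= D by have := bR 0%N h hr; rewrite big_ord0 subr0 expr0 mulr1.
have -> : K * (C * D) * (2 * r * `|h|) ^+ n = K * (C * D) * (r * `|h|) ^+ n * 2 ^+ n.
  by rewrite -(mulrA 2) [(2 * _) ^+ n]exprMn; ring.
apply: le_trans (ler_wpM2l _ (expr2n_ge n)); last by rewrite !mulr_ge0 ?exprn_ge0.
rewrite -natr1 mulrDr mulr1 [leRHS]addrC; apply: le_trans (ler_normD _ _) (lerD _ _).
  apply: le_trans (BK _ _ _ _ (aR n h hr) gb) _.
  by apply: eq_ler; ring.
apply: le_trans (ler_norm_sum _ _ _) _.
rewrite mulr_natr -[X in _ *+ X](card_ord n) -sumr_const; apply: ler_sum => j _.
apply: le_trans (BK _ _ _ _ (aM _) (bR (n - j)%N h hr)) _.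
rewrite size_nseq normprod_nseq; apply: eq_ler.
have -> : (r * `|h|) ^+ n = (r * `|h|) ^+ j * (r * `|h|) ^+ (n - j).
  by rewrite -exprD subnKC// ltnW.
by rewrite !exprMn; ring.
Qed.

Lemma analytic_at_bilinear V W1 W2 W (B : W1 -> W2 -> W) (K : R)
    (f : V -> W1) (g : V -> W2) x :
  (forall v, linear (B^~ v)) -> (forall u, linear (B u)) ->
  (forall u v, `|B u v| <= K * (`|u| * `|v|)) ->
  analytic_at f x -> analytic_at g x -> analytic_at (fun y => B (f y) (g y)) x.
Proof.
move=> Bl Br BK [a [C [q fa]]] [b [D [p gb]]].
have [C' [q' fg]] := expansion_bilinear Bl Br BK fa gb.
by do 3 eexists; exact: fg.
Qed.

(** The Leibniz rule, read off the degree one coefficient of the Cauchy product. *)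
Lemma differential_bilinear V W1 W2 W (B : W1 -> W2 -> W) (K : R)
    (f : V -> W1) (g : V -> W2) x h :
  (forall v, linear (B^~ v)) -> (forall u, linear (B u)) ->
  (forall u v, `|B u v| <= K * (`|u| * `|v|)) ->
  analytic_at f x -> analytic_at g x ->
  'd (fun y => B (f y) (g y)) x h = B (f x) ('d g x h) + B ('d f x h) (g x).
Proof.
move=> Bl Br BK [a [C [q fa]]] [b [D [p gb]]].
have [C' [q' fg]] := expansion_bilinear Bl Br BK fa gb.
rewrite (expansion_differentiable fg).2 /conv big_ord_recl big_ord1 /=.
by rewrite (expansion_nil fa) (expansion_nil gb) (expansion_differentiable fa).2 (expansion_differentiable gb).2.
Qed.

End Expansion.

(** * Geometric bounds and sums of power series *)

Section GeometricSums.
Context {R : realType}.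

Lemma sum_geometric_le (t : R) n : 0 <= t -> t <= 1 / 2 -> \sum_(k < n) t ^+ k <= 2.
Proof.
move=> t0 t2; suff : \sum_(k < n) t ^+ k <= 2 - 2 * t ^+ n.
  by move=> /le_trans; apply; rewrite lerBlDr lerDl mulr_ge0 ?exprn_ge0.
elim: n => [|n IH]; first by rewrite big_ord0 expr0 mulr1 subrr.
rewrite big_ord_recr/=; apply: le_trans (lerD IH (lexx _)) _.
have := ler_wpM2l (exprn_ge0 n t0) t2; rewrite exprSr; lra.
Qed.

Lemma geometric_series_limit (W : completeNormedModType R) (d : nat -> W) (K t : R) :
  0 <= t -> t <= 1 / 2 -> 0 <= K -> (forall k, `|d k| <= K * t ^+ k) ->
  forall n, `|lim (series d @ \oo) - \sum_(k < n) d k| <= 2 * K * t ^+ n.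
Proof.
move=> t0 t2 K0 dK n.
have tail m : (n <= m)%N ->
    `|\sum_(k < m) d k - \sum_(k < n) d k| <= 2 * K * t ^+ n.
  move=> nm; rewrite -!(big_mkord xpredT d) (@big_cat_nat _ _ _ n 0 m)//= addrAC subrr add0r.
  rewrite -{1}(add0n n) big_addn; apply: le_trans (ler_norm_sum _ _ _) _.
  apply: (@le_trans _ _ (\sum_(0 <= k < m - n) K * t ^+ n * t ^+ k)).
    apply: ler_sum => k _; apply: le_trans (dK _) _.
    by rewrite -mulrA -exprD addnC.
  rewrite -mulr_sumr big_mkord mulrC -mulrA ler_wpM2r ?mulr_ge0 ?exprn_ge0//.
  exact: sum_geometric_le.
have cvgd : cvgn (series d).
  apply: normed_cvg; apply: series_le_cvg (is_cvg_geometric_series (a := K) (z := t) _).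
  - by move=> k; exact: normr_ge0.
  - by move=> k; rewrite /geometric/= mulr_ge0 ?exprn_ge0.
  - by move=> k; exact: dK.
  by rewrite ger0_norm//; lra.
apply: (@cvgr_to_le _ \oo _ _ (fun m => `|series d m - \sum_(k < n) d k|)).
  by apply: cvg_norm; apply: cvgB => //; exact: cvg_cst.
by exists n => // m /= nm; rewrite /series/= big_mkord tail.
Qed.

(** With [y = 0] and [x] a norm, this turns identities that hold up to a geometric error into exact
    ones. *)
Lemma le_geometric_limit (x y K : R) N :
  (forall n, (N <= n)%N -> x <= y + K * (1 / 2) ^+ n) -> x <= y.
Proof.
move=> xy.
have h : (fun n => y + K * (1 / 2) ^+ n) @ \oo --> y + K * 0.
  apply: cvgD; first exact: cvg_cst.
  apply: cvgM; first exact: cvg_cst.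
  by apply: cvg_expr; rewrite ger0_norm; lra.
rewrite mulr0 addr0 in h; apply: (cvgr_to_ge h).
by exists N => // n /= /xy.
Qed.

End GeometricSums.

Section SeriesSum.
Context {R : realType} {V : normedModType R} {W : completeNormedModType R}.

Definition series_sum (a : seq V -> W) (h : V) : W :=
  lim (series (fun k => a (nseq k h)) @ \oo).

(** Doubling [q] makes the ratio at most [1 / 2] on the disc; doubling [C] then pays for the
    tails. *)
Lemma series_sum_expansion (a : seq V -> W) (C q : R) x : 0 <= C -> 0 < q ->
  multilin a -> (forall s, `|a s| <= C * q ^+ size s * normprod s) ->
  has_expansion (fun y => series_sum a (y - x)) x a (2 * C) (2 * q).
Proof.
move=> C0 q0 al aM; split=> //; first by rewrite mulr_ge0.
- by rewrite mulr_gt0.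
- move=> s; apply: le_trans (aM s) _; rewrite ler_wpM2r ?normprod_ge0// ler_pM//.
  + by rewrite exprn_ge0 ?ltW.
  + by rewrite ler_peMl// ler1n.
  + by rewrite lerXn2r ?nnegrE ?mulr_ge0 ?(ltW q0)// ler_peMl ?(ltW q0)// ler1n.
move=> n h hq; have t0 : 0 <= q * `|h| by rewrite mulr_ge0 ?(ltW q0).
rewrite [x + h]addrC addrK.
apply: le_trans (@geometric_series_limit _ _ _ C (q * `|h|) _ _ _ _ n) _ => //.
- by lra.
- by move=> k; apply: le_trans (aM _) _; rewrite size_nseq normprod_nseq exprMn mulrA.
rewrite ler_wpM2l ?mulr_ge0// lerXn2r ?nnegrE// -mulrA.
  by rewrite mulr_ge0.
by rewrite ler_peMl// ler1n.
Qed.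

End SeriesSum.

(** * Composition of power series *)

Section Composition.
Context {R : realType}.

Section Comp.
Context {U V W : normedModType R}.
Implicit Types (a : seq V -> W) (b : seq U -> V) (s : seq U).

(** The part of degree [size s] of [a (b, .., b)] with [k] arguments. *)
Fixpoint comp b k a s : W :=
  if k is k'.+1 then conv (fun p => comp b k' (fun w => a (b p :: w))) s
  else if s is [::] then a [::] else 0.

Lemma comp_linear b k a1 a2 (c : R) s :
  comp b k (fun w => c *: a1 w + a2 w) s = c *: comp b k a1 s + comp b k a2 s.
Proof.
elim: k a1 a2 s => [|k IH] a1 a2 s /=; first by case: s => //; rewrite scaler0 addr0.
by rewrite /conv scaler_sumr -big_split; apply: eq_bigr => j _; exact: IH.
Qed.

Lemma comp0 b k s : comp b k (fun=> 0) s = 0.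
Proof.
have := comp_linear b k (fun=> 0) (fun=> 0) (-1) s.
by rewrite scaler0 addr0 scaleN1r addNr.
Qed.

Lemma multilin_comp b k a : multilin b -> multilin a -> multilin (comp b k a).
Proof.
move=> bl; elim: k a => [|k IH] a al /=.
  by move=> [|w s] [|u p] c v z /=; rewrite scaler0 addr0.
apply: multilin_conv => s.
  move=> p r c u v; rewrite -comp_linear bl; congr comp; apply/funext => w.
  by rewrite multilin_hd.
by apply: IH; apply: multilin_cons.
Qed.

(** Without a constant term, each of the [k] inner series uses up at least one entry of [s]. *)
Lemma comp_small b k a s : multilin a -> b [::] = 0 -> (size s < k)%N ->
  comp b k a s = 0.
Proof.
move=> al b0; elim: k a s al => [//|k IH] a s al sk /=.
rewrite /conv big1// => -[[|j] /= js] _.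
  rewrite take0 b0 drop0 -[RHS](comp0 b k s); congr comp; apply/funext => w.
  exact: multilin_0.
rewrite IH//; first exact: multilin_cons.
by rewrite size_drop; lia.
Qed.

(** The weight [mu] is almost stable under convolution with [be], so each of the [k] arguments costs
    one factor [M]. *)
Lemma comp_bound b k a (A M : R) (be mu : nat -> R) s :
  (forall p, `|b p| <= be (size p) * normprod p) -> (forall n, 0 <= be n) ->
  (forall n, 0 <= mu n) -> 1 <= mu 0%N -> 0 <= M ->
  (forall n, \sum_(j < n.+1) be j * mu (n - j)%N <= M * mu n) ->
  0 <= A -> (forall w, size w = k -> `|a w| <= A * normprod w) ->
  `|comp b k a s| <= A * M ^+ k * mu (size s) * normprod s.
Proof.
move=> bM be0 mu0 mu1 M0 bemu; elim: k A a s => [|k IH] A a s A0 aM /=.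
  case: s => [|u s] /=; last by rewrite normr0 !mulr_ge0 ?normprod_ge0.
  rewrite expr0 normprod_nil !mulr1; apply: le_trans (aM _ _) _ => //.
  by rewrite normprod_nil mulr1 ler_peMr.
apply: le_trans (@conv_bound _ _ _ _ (fun n => A * M ^+ k * be n) mu _ _) _.
  move=> p r; apply: le_trans (IH (A * `|b p|) _ _ _ _) _; first by rewrite mulr_ge0.
    by move=> w wk; apply: le_trans (aM _ _) _; rewrite ?normprod_cons ?mulrA//= wk.
  rewrite [leRHS](_ : _ = A * (be (size p) * normprod p) * M ^+ k * mu (size r) * normprod r).
    by rewrite !ler_wpM2r ?normprod_ge0 ?exprn_ge0// ler_wpM2l.
  by ring.
rewrite ler_wpM2r ?normprod_ge0//.
under eq_bigr => j _ do rewrite -mulrA.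
rewrite -mulr_sumr exprSr mulrA -[leRHS]mulrA ler_wpM2l ?mulr_ge0 ?exprn_ge0//.
Qed.

(** Induction on the number of arguments, replacing the first one by its partial sum. This costs
    [D], and the remaining terms cost [2 * D]: doubling [t] leaves a factor [(1 / 2) ^ j] in the
    [j]-th of them. Hence [3 * D] per argument. *)
Lemma comp_remainder b k a (A D t : R) (u : V) (h : U) N :
  0 <= A -> 0 <= D -> 0 <= t -> multilin a ->
  (forall w, size w = k -> `|a w| <= A * normprod w) ->
  (forall n, `|b (nseq n h)| <= D * t ^+ n) ->
  (forall n, `|u - \sum_(j < n) b (nseq j h)| <= D * t ^+ n) ->
  `|a (nseq k u) - \sum_(n < N) comp b k a (nseq n h)|
    <= A * (3 * D) ^+ k * (2 * t) ^+ N.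
Proof.
move=> A0 D0 t0 al aM bD uR.
have u0 : `|u| <= D by have := uR 0%N; rewrite big_ord0 subr0 expr0 mulr1.
elim: k N A a A0 al aM => [|k IH] N A a A0 al aM.
  case: N => [|N].
    by rewrite big_ord0 subr0 !expr0 !mulr1; have := aM [::] erefl; rewrite normprod_nil mulr1.
  by rewrite big_ord_recl/= big1// addr0 subrr normr0 !mulr_ge0 ?exprn_ge0 ?mulr_ge0.
rewrite /=; under eq_bigr => n _ do rewrite conv_nseq.
rewrite (sum_triangle (fun j l => comp b k (fun w => a (b (nseq j h) :: w)) (nseq l h))).
have a_sum n (F : 'I_n -> V) w : a (\sum_(i < n) F i :: w) = \sum_(i < n) a (F i :: w).
  apply: (big_morph (fun v => a (v :: w))); last exact: multilin_0.
  by move=> v v'; have := multilin_hd w 1 v v' al; rewrite !scale1r.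
have aB v v' w : a ((v - v') :: w) = a (v :: w) - a (v' :: w).
  by rewrite addrC -scaleN1r multilin_hd// scaleN1r addrC.
have -> : a (u :: nseq k u) -
  \sum_(j < N) \sum_(l < N - j) comp b k (fun w => a (b (nseq j h) :: w)) (nseq l h) =
  a ((u - \sum_(j < N) b (nseq j h)) :: nseq k u) +
  \sum_(j < N) (a (b (nseq j h) :: nseq k u) -
    \sum_(l < N - j) comp b k (fun w => a (b (nseq j h) :: w)) (nseq l h)).
  by rewrite aB a_sum sumrB addrA subrK.
have T0 : 0 <= (2 * t) ^+ N by rewrite exprn_ge0 ?mulr_ge0.
rewrite [leRHS](_ : _ = A * D * (3 * D) ^+ k * (2 * t) ^+ N +
  A * D * (3 * D) ^+ k * (2 * t) ^+ N * 2); last by rewrite exprS; ring.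
apply: le_trans (ler_normD _ _) (lerD _ _).
  apply: le_trans (aM _ _) _; first by rewrite /= size_nseq.
  rewrite normprod_cons normprod_nseq -!mulrA ler_wpM2l//.
  apply: le_trans (ler_wpM2r _ (uR N)) _; first by rewrite exprn_ge0.
  rewrite -mulrA ler_wpM2l// mulrC ler_pM ?exprn_ge0//.
    by rewrite lerXn2r ?nnegrE ?mulr_ge0// (le_trans u0)// ler_peMl// ler1n.
  by rewrite lerXn2r ?nnegrE ?mulr_ge0// ler_peMl// ler1n.
apply: le_trans (ler_norm_sum _ _ _) _.
apply: le_trans (_ : \sum_(j < N) A * D * (3 * D) ^+ k * (2 * t) ^+ N * (1 / 2) ^+ j <= _).
  apply: ler_sum => -[j /= jN] _.
  apply: le_trans (IH (N - j)%N (A * `|b (nseq j h)|) _ _ _ _) _.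
  - by rewrite mulr_ge0.
  - exact: multilin_cons.
  - by move=> w wk; apply: le_trans (aM _ _) _; rewrite ?normprod_cons ?mulrA//= wk.
  rewrite -[leRHS]mulrA.
  have -> : (2 * t) ^+ N * (1 / 2) ^+ j = t ^+ j * (2 * t) ^+ (N - j).
    rewrite -(subnKC (ltnW jN)) exprD addKn -mulrA mulrC -mulrA -exprMn.
    by rewrite mulrC; congr (_ ^+ _ * _); field.
  pose X := A * (3 * D) ^+ k * (2 * t) ^+ (N - j).
  rewrite [leLHS](_ : _ = X * `|b (nseq j h)|); last by rewrite /X; ring.
  rewrite [leRHS](_ : _ = X * (D * t ^+ j)); last by rewrite /X; ring.
  by rewrite ler_wpM2l// /X !mulr_ge0 ?exprn_ge0 ?mulr_ge0.
by rewrite -mulr_sumr ler_wpM2l ?mulr_ge0 ?exprn_ge0 ?mulr_ge0// sum_geometric_le//; lra.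
Qed.

End Comp.

Lemma analytic_at_comp_expansion (U V W : normedModType R) (f : V -> W) (g : U -> V) y
    (a : seq V -> W) (b : seq U -> V) (C D p q : R) :
  has_expansion f (g y) a C p -> has_expansion g y b D q ->
  exists C' q', has_expansion (f \o g) y
    (fun s => \sum_(k < (size s).+1) comp (fun r => if r is [::] then 0 else b r) k a s) C' q'.
Proof.
move=> fa gb; have [C0 p0 al aM aR] := fa; have [D0 q0 bl bM bR] := gb.
pose b' (r : seq U) : V := if r is [::] then 0 else b r.
have b'l : multilin b' by move=> [|w s] r c u v; exact: bl.
(* Once its constant term is removed, the inner series has all its terms in degree at least one, so
   [D * q ^ n] may be replaced by [(D / L) * (L * q) ^ n]. This [L] gives [p * D' <= 1 / 6], which
   brings the ratios [2 * (p * D')] and [3 * (p * D')] below [1 / 2]. *)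
pose L := 1 + 6 * p * D.
have L1 : 1 <= L by rewrite lerDl !mulr_ge0 ?(ltW p0).
have L0 : 0 < L by apply: lt_le_trans L1.
pose D' := D / L; pose q' := L * q.
have D'0 : 0 <= D' by rewrite divr_ge0// ltW.
have q'0 : 0 < q' by rewrite mulr_gt0.
have pD' : p * D' <= 1 / 6.
  rewrite /D' mulrA ler_pdivrMr// /L; lra.
have pD'0 : 0 <= p * D' by rewrite mulr_ge0// ltW.
have DL n r : 0 <= r -> D * (q * r) ^+ n.+1 <= D' * (q' * r) ^+ n.+1.
  move=> r0; rewrite /D' /q' -(mulrA L) (exprMn _ L) mulrA ler_wpM2r ?exprn_ge0 ?mulr_ge0 ?(ltW q0)//.
  by rewrite exprS mulrA divfK ?gt_eqF// ler_peMr// exprn_ege1.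
have b'M s : `|b' s| <= D' * q' ^+ size s * normprod s.
  case: s => [|w s]; first by rewrite normr0 normprod_nil !mulr1.
  apply: le_trans (bM _) _; rewrite ler_wpM2r ?normprod_ge0//.
  by have := DL (size s) 1 ler01; rewrite !mulr1.
exists (3 * C), (2 * q'); split; first by rewrite mulr_ge0.
- by rewrite mulr_gt0.
- move=> s1 s2 c u v.
  under eq_bigr => k _ do rewrite (multilin_comp k b'l al).
  by rewrite big_split/= -scaler_sumr !size_cat.
- move=> s.
  apply: le_trans (_ : \sum_(k < (size s).+1) C * (2 * q') ^+ size s * normprod s * (2 * (p * D')) ^+ k <= _).
    apply: le_trans (ler_norm_sum _ _ _) (ler_sum _ _) => k _.
    apply: le_trans (@comp_bound _ _ _ _ _ _ (C * p ^+ k) (2 * D')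
      (fun n => D' * q' ^+ n) (fun n => (2 * q') ^+ n) _ _ _ _ _ _ _ _ _) _ => //.
    + by move=> n; rewrite mulr_ge0 ?exprn_ge0 ?(ltW q'0).
    + by move=> n; apply: exprn_ge0; rewrite mulr_ge0 ?(ltW q'0).
    + by rewrite mulr_ge0.
    + move=> n.
      rewrite (eq_bigr (fun j : 'I_n.+1 => D' * (2 * q') ^+ n * (1 / 2) ^+ j)) => [|j _].
        rewrite -mulr_sumr.
        rewrite [leRHS](_ : _ = D' * (2 * q') ^+ n * 2); last by ring.
        apply: ler_wpM2l; last by apply: sum_geometric_le; lra.
        by apply: mulr_ge0 => //; apply: exprn_ge0; rewrite mulr_ge0 ?(ltW q'0).
      have -> : (2 * q') ^+ n = 2 ^+ j * q' ^+ j * (2 * q') ^+ (n - j).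
        by rewrite -exprMn -exprD subnKC// leq_ord.
      have h : (2 ^+ j * (1 / 2) ^+ j : R) = 1 by rewrite -exprMn mulrCA divff// mulr1 expr1n.
      rewrite -[LHS]mul1r -[X in X * _ = _]h.
      by move: (2 ^+ j) ((1 / 2) ^+ j) ((2 * q') ^+ (n - j)) => r1 r2 r3; ring.
    + by rewrite mulr_ge0 ?exprn_ge0 ?(ltW p0).
    + by move=> w <-; exact: aM.
    by apply: eq_ler; rewrite !exprMn; ring.
  rewrite -mulr_sumr [leRHS](_ : _ = C * (2 * q') ^+ size s * normprod s * 3); last by ring.
  apply: ler_wpM2l.
    by rewrite mulr_ge0 ?normprod_ge0// mulr_ge0// exprn_ge0// mulr_ge0 ?(ltW q'0).
  by apply: (@le_trans _ _ 2); [apply: sum_geometric_le; lra|lra].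
move=> N h; rewrite -mulrA => hq; have t0 : 0 <= q' * `|h| by rewrite mulr_ge0 ?(ltW q'0).
have t1 : q' * `|h| < 1 by lra.
have qt : q * `|h| <= q' * `|h| by rewrite ler_wpM2r// /q' ler_peMl// ltW.
pose u := g (y + h) - g y.
have uR n : `|u - \sum_(j < n) b' (nseq j h)| <= D' * (q' * `|h|) ^+ n.
  have uR1 m : `|u - \sum_(j < m.+1) b' (nseq j h)| <= D' * (q' * `|h|) ^+ m.+1.
    apply: le_trans _ (DL m _ (normr_ge0 h)).
    have := bR m.+1 h (le_lt_trans qt t1).
    rewrite !(big_ord_recl m) /= (expansion_nil gb) /u add0r.
    by rewrite opprD addrA; under eq_bigr => i _ do rewrite -/(nseq i.+1 h).
  case: n => [|n//]; rewrite big_ord0 subr0 expr0 mulr1.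
  have := uR1 0%N; rewrite big_ord1 subr0 expr1 => /le_trans; apply.
  by rewrite ler_piMr// ltW.
have u1 : `|u| <= D' * (q' * `|h|).
  by have := uR 1%N; rewrite big_ord1 subr0 expr1.
have pu : p * `|u| <= q' * `|h|.
  apply: le_trans (ler_wpM2l (ltW p0) u1) _; rewrite (mulrA p) ler_piMl//; lra.
have -> : (f \o g) (y + h) = f (g y + u) by rewrite /u /= (addrC (g y)) subrK.
move: u uR u1 pu => u uR u1 pu.
(* The terms added with [k > n] vanish by [comp_small], so both indices can range over all of [N]
   and be exchanged. *)
have -> : \sum_(n < N) \sum_(k < (size (nseq n h)).+1) comp b' k a (nseq n h) =
    \sum_(k < N) \sum_(n < N) comp b' k a (nseq n h).
  rewrite exchange_big/=; apply: eq_bigr => -[n /= nN] _; rewrite size_nseq.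
  rewrite -!(big_mkord xpredT (fun k => comp b' k a (nseq n h))).
  rewrite [RHS](@big_cat_nat _ _ _ n.+1)//= [X in _ + X]big1_seq ?addr0// => k.
  rewrite mem_index_iota => /andP[_ /andP[nk _]].
  by rewrite comp_small// size_nseq.
rewrite [X in `|X|](_ : _ = (f (g y + u) - \sum_(k < N) a (nseq k u)) +
  \sum_(k < N) (a (nseq k u) - \sum_(n < N) comp b' k a (nseq n h))); last first.
  by rewrite sumrB addrA subrK.
have T0 : 0 <= (2 * (q' * `|h|)) ^+ N by rewrite exprn_ge0// mulr_ge0.
have -> : 3 * C * (2 * (q' * `|h|)) ^+ N =
  C * (2 * (q' * `|h|)) ^+ N + C * (2 * (q' * `|h|)) ^+ N * 2.
  by ring.
apply: le_trans (ler_normD _ _) (lerD _ _).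
  apply: le_trans (aR N u (le_lt_trans pu t1)) _.
  apply: ler_wpM2l => //; apply: lerXn2r; rewrite ?nnegrE.
  - by rewrite mulr_ge0 ?(ltW p0).
  - by rewrite mulr_ge0.
  by apply: le_trans pu _; rewrite ler_peMl// ler1n.
apply: le_trans (_ : \sum_(k < N) C * (2 * (q' * `|h|)) ^+ N * (3 * (p * D')) ^+ k <= _).
  apply: le_trans (ler_norm_sum _ _ _) (ler_sum _ _) => k _.
  apply: le_trans (@comp_remainder _ _ _ b' k a (C * p ^+ k) D' (q' * `|h|) u h N _ D'0 t0 al _ _ uR) _.
  - by rewrite mulr_ge0 ?exprn_ge0 ?(ltW p0).
  - by move=> w <-; exact: aM.
  - by move=> n; apply: le_trans (b'M _) _; rewrite size_nseq normprod_nseq -mulrA -exprMn.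
  by apply: eq_ler; rewrite !exprMn; ring.
by rewrite -mulr_sumr ler_wpM2l ?mulr_ge0// sum_geometric_le//; lra.
Qed.

Lemma analytic_at_comp (U V W : normedModType R) (f : V -> W) (g : U -> V) y :
  analytic_at f (g y) -> analytic_at g y -> analytic_at (f \o g) y.
Proof.
move=> [a [C [p fa]]] [b [D [q gb]]].
by have [C' [q' fg]] := analytic_at_comp_expansion fa gb; do 3 eexists; exact: fg.
Qed.

End Composition.

(** * The analytic inverse function theorem *)

Section InverseSeries.
Context {R : realType}.

Section CompAgree.
Context {U V W : normedModType R}.
Implicit Types (a : seq V -> W) (b : seq U -> V) (s : seq U).

Lemma compS b k a s :
  comp b k.+1 a s = conv (fun p => comp b k (fun w => a (b p :: w))) s.
Proof. by []. Qed.

Lemma comp1 b a s : comp b 1 a s = a [:: b s].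
Proof.
rewrite /= /conv big_ord_recr/= take_size drop_size big1 ?add0r// => -[j /= js] _.
by case E: (drop j s) => //; have := size_drop j s; rewrite E/=; lia.
Qed.

Lemma eq_comp b1 b2 k a s :
  (forall r, (size r <= size s)%N -> b1 r = b2 r) -> comp b1 k a s = comp b2 k a s.
Proof.
elim: k a s => [//|k IH] a s bb /=; apply: eq_bigr => -[j /= js] _.
rewrite bb ?size_take_min ?geq_minr//; apply: IH => r rs; apply: bb.
by apply: leq_trans rs _; rewrite size_drop leq_subr.
Qed.

(** Since the inner series has no constant term, a term of degree [k >= 2] of
    the outer series only involves inner coefficients of degree [< size s]. *)
Lemma eq_comp_lt b1 b2 k a s : multilin a -> b1 [::] = 0 -> b2 [::] = 0 ->
  (forall r, (size r < size s)%N -> b1 r = b2 r) ->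
  comp b1 k.+2 a s = comp b2 k.+2 a s.
Proof.
move=> al b10 b20 bb; rewrite !(compS _ k.+1 a s); apply: eq_bigr => -[j js] _.
cbv beta; rewrite [nat_of_ord _]/=.
have [->|j0] := eqVneq j 0%N.
  rewrite take0 drop0 b10 b20; have -> : (fun w => a (0 :: w)) = fun=> 0.
    by apply/funext => w; exact: multilin_0.
  by rewrite !comp0.
have [->|jn] := eqVneq j (size s).
  by rewrite drop_size !comp_small//; exact: multilin_cons.
rewrite bb; last by rewrite size_takel; lia.
by apply: (@eq_comp _ _ k.+1) => r; rewrite size_drop => rs; apply: bb; lia.
Qed.

End CompAgree.

Section Weights.

(** Since [0^-1 = 0], this weight vanishes in degree [0], in accordance with the missing constant
    term of the inverse series. *)
Definition invsq (n : nat) : R := (n%:R ^+ 2)^-1.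

Lemma invsq_ge0 n : 0 <= invsq n.
Proof. by rewrite invr_ge0 exprn_ge0. Qed.

Lemma sum_invsq n : \sum_(j < n) invsq j <= 2.
Proof.
suff : \sum_(j < n.+2) invsq j <= 2 - (n.+1%:R)^-1.
  move=> h; apply: (@le_trans _ _ (\sum_(j < n.+2) invsq j)); last first.
    by apply: le_trans h _; rewrite lerBlDr lerDl invr_ge0.
  by rewrite !big_ord_recr/= -addrA lerDl addr_ge0 ?invsq_ge0.
elim: n => [|n IH].
  by rewrite !big_ord_recr big_ord0/= /invsq expr0n/= invr0 expr1n invr1; lra.
rewrite big_ord_recr/=; apply: le_trans (lerD IH (lexx _)) _.
rewrite /invsq -[n.+2]addn1 natrD.
have : (0 : R) < n.+1%:R by rewrite ltr0n.
move: (n.+1%:R) => c c0.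
rewrite -subr_ge0 (_ : _ - _ = (c * (c + 1) ^+ 2)^-1); last by field; lra.
by rewrite invr_ge0 mulr_ge0 ?exprn_ge0 ?addr_ge0 ?(ltW c0).
Qed.

(** For positive [j] and [l] this amounts to [(j + l) ^ 2 <= 2 * (j ^ 2 + l ^ 2)]. *)
Lemma invsq_mul j l : invsq j * invsq l <= 2 * invsq (j + l) * (invsq j + invsq l).
Proof.
have [->|j0] := posnP j; first by rewrite {1}/invsq expr0n/= invr0 mul0r !mulr_ge0 ?addr_ge0 ?invsq_ge0.
have [->|l0] := posnP l; first by rewrite {2}/invsq expr0n/= invr0 mulr0 !mulr_ge0 ?addr_ge0 ?invsq_ge0.
rewrite /invsq natrD.
have : (0 : R) < j%:R by rewrite ltr0n.
have : (0 : R) < l%:R by rewrite ltr0n.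
move: (j%:R) (l%:R) => c d d0 c0.
rewrite -subr_ge0 (_ : _ - _ = (c - d) ^+ 2 / (c * d * (c + d)) ^+ 2).
  by rewrite divr_ge0 ?sqr_ge0.
by field; lra.
Qed.

(** The value [1] in degree [0] provides the condition [1 <= mu 0] of [comp_bound]. *)
Definition invsq1 n : R := (n == 0%N)%:R + invsq n.

(** In positive degree, [1] comes from the extra unit in degree [0], and [8 = 2 * (2 + 2)] from
    [invsq_mul] and two sums of inverse squares. *)
Lemma conv_invsq n : \sum_(j < n.+1) invsq j * invsq1 (n - j)%N <= 9 * invsq1 n.
Proof.
case: n => [|n]; first by rewrite big_ord1 /invsq1 /invsq expr0n/= invr0 mul0r; lra.
rewrite /invsq1 add0r; under eq_bigr => j _ do rewrite mulrDr.
rewrite big_split/= big_ord_recr/= subnn mulr1 big1 => [|[j /= jn] _]; last first.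
  by rewrite subSn// mulr0.
rewrite add0r (_ : 9 = 1 + 8) ?mulrDl ?mul1r; last by lra.
rewrite lerD2l; apply: (@le_trans _ _ (\sum_(j < n.+2) 2 * invsq n.+1 * (invsq j + invsq (n.+1 - j)))).
  apply: ler_sum => -[j /= jn] _; apply: le_trans (invsq_mul _ _) _.
  by rewrite subnKC.
rewrite -mulr_sumr big_split/= (reindex_inj rev_ord_inj)/=.
have -> : \sum_(j < n.+2) invsq (n.+2 - j.+1) = \sum_(j < n.+2) invsq (n.+1 - j).
  by apply: eq_bigr => j _; rewrite subSS.
have s2 : \sum_(j < n.+2) invsq (n.+1 - j) <= 2.
  rewrite (reindex_inj rev_ord_inj)/= (eq_bigr (fun j : 'I_n.+2 => invsq j)) ?sum_invsq//.
  by move=> j _; rewrite subSS subKn// leq_ord.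
have := ler_wpM2l (invsq_ge0 n.+1) s2; move: (\sum_(_ < _) _) => S; lra.
Qed.

End Weights.

Section InvSeries.
Context {V : normedModType R}.
Variables (a : seq V -> V).
Hypotheses (al : multilin a).

Definition coef_id (s : seq V) : V := if s is [:: h] then h else 0.

Lemma multilin_coef_id : multilin coef_id.
Proof. by move=> [|w [|w' s]] [|w2 p] c u v /=; rewrite ?scaler0 ?addr0. Qed.

(** Iterates for the fixed point equation [b = id - sum_(k >= 2) a_k (b, .., b)],
    which inverts a series [a] with linear part [id]; they are stationary in each
    degree. *)
Fixpoint inv_approx m (s : seq V) : V :=
  if m is m'.+1 then
    coef_id s - \sum_(2 <= k < (size s).+1) comp (inv_approx m') k a s
  else 0.

Lemma inv_approx_nil m : inv_approx m [::] = 0.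
Proof. by case: m => [//|m] /=; rewrite big_geq// subr0. Qed.

Lemma multilin_inv_approx m : multilin (inv_approx m).
Proof.
elim: m => [|m IH]; first by move=> s p c u v; rewrite /= scaler0 addr0.
apply: multilinD; first exact: multilin_coef_id.
apply: multilinN.
apply: (@multilin_sum _ _ _ 2 (fun k => comp (inv_approx m) k a) (fun s => (size s).+1)).
  by move=> k; apply: multilin_comp.
by move=> s p ->.
Qed.

Lemma inv_approx_stable n m1 m2 s : (size s <= n)%N -> (n <= m1)%N -> (n <= m2)%N ->
  inv_approx m1 s = inv_approx m2 s.
Proof.
elim: n m1 m2 s => [|n IH] m1 m2 s sn.
  by case: s sn => // _ _ _; rewrite !inv_approx_nil.
case: m1 => // m1; case: m2 => // m2 nm1 nm2 /=; congr (_ - _).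
rewrite !big_nat; apply: eq_bigr => -[|[|k]]// _.
apply: eq_comp_lt; rewrite ?inv_approx_nil// => r rs.
by apply: IH => //; lia.
Qed.

(** By [inv_approx_stable], the iterates have reached their stationary value in degree [size s]
    after [size s] steps. *)
Definition inv_series s := inv_approx (size s) s.

Lemma multilin_inv_series : multilin inv_series.
Proof.
move=> s p c u v; rewrite /inv_series; have E w : size (s ++ w :: p) = size (s ++ u :: p).
  by rewrite !size_cat.
by rewrite (E (c *: u + v)) (E v); apply: multilin_inv_approx.
Qed.

Lemma inv_seriesE s :
  inv_series s = coef_id s - \sum_(2 <= k < (size s).+1) comp inv_series k a s.
Proof.
rewrite /inv_series; case sn : (size s) => [|n].
  by move: sn; case: s => // _; rewrite big_geq// subr0.
rewrite /= -sn; congr (_ - _); rewrite !big_nat; apply: eq_bigr => -[|[|k]]// _.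
apply: eq_comp_lt; rewrite ?inv_approx_nil// => r rs.
by apply: (@inv_approx_stable (size r)) => //; lia.
Qed.

(** The weights [1 / n ^ 2] are preserved by convolution up to a constant, so a
    bound [D q ^ n / n ^ 2] with [D] small propagates through the iteration. *)
Lemma inv_series_bound (C p : R) : 0 <= C -> 0 < p ->
  (forall s, `|a s| <= C * p ^+ size s * normprod s) ->
  exists D q : R, [/\ 0 <= D, 0 < q &
    forall s, `|inv_series s| <= D * q ^+ size s * normprod s].
Proof.
move=> C0 p0 aM.
(* Here [q = D^-1] makes the degree one bound [D * q] equal to [1], as the identity requires. The
   terms of degree [k >= 2] in [a] contribute at most [C * th ^ k] with [th = 9 * p * D]; their sum
   [2 * C * th ^ 2 = 18 * C * p * th * D] must not exceed [D], and [th <= 1 / 2] is needed to sum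
   them. *)
pose th := (2 + 18 * C * p)^-1; pose D := th / (9 * p); pose q := D^-1.
have den0 : 0 < 2 + 18 * C * p by rewrite ltr_pwDl// !mulr_ge0// ltW.
have th0 : 0 < th by rewrite invr_gt0.
have D0 : 0 < D by rewrite divr_gt0// mulr_gt0.
have q0 : 0 < q by rewrite invr_gt0.
have thD : 9 * p * D = th by rewrite /D mulrC divfK// gt_eqF// mulr_gt0.
have th1 : th * (2 + 18 * C * p) = 1 by rewrite mulVf// gt_eqF.
have pC0 : 0 <= th * (18 * C * p) by rewrite !mulr_ge0// ltW.
have th2 : th <= 1 / 2 by lra.
have K0 n : 0 <= D * q ^+ n * invsq n.
  by rewrite mulr_ge0 ?invsq_ge0// mulr_ge0 ?exprn_ge0 ?(ltW D0) ?(ltW q0).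
have bound m s : `|inv_approx m s| <= D * q ^+ size s * invsq (size s) * normprod s.
  elim: m s => [|m IH] s.
    by rewrite [inv_approx _ _]/= normr0 mulr_ge0 ?normprod_ge0.
  case: s => [|h [|h' s]].
  - by rewrite inv_approx_nil normr0 mulr_ge0 ?normprod_ge0.
  - rewrite /= big_geq// subr0 expr1 normprod_cons normprod_nil mulr1.
    by rewrite /invsq expr1n invr1 mulr1 /q divff ?gt_eqF// mul1r.
  rewrite [inv_approx _ _]/= sub0r normrN.
  have rn : size (h :: h' :: s) = (size s).+2 by [].
  rewrite -[(size s).+3]/(size (h :: h' :: s)).+1.
  move: (h :: h' :: s) rn => r rn.
  apply: le_trans (ler_norm_sum _ _ _) _.
  apply: (@le_trans _ _ (\sum_(2 <= k < (size r).+1)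
    C * q ^+ size r * invsq (size r) * normprod r * th ^+ k)).
    apply: ler_sum => k _.
    apply: le_trans (@comp_bound _ _ _ _ _ k _ (C * p ^+ k) (9 * D)
      (fun n => D * q ^+ n * invsq n) (fun n => q ^+ n * invsq1 n) _ IH _ _ _ _ _ _ _) _.
    + exact: K0.
    + by move=> n; rewrite mulr_ge0 ?exprn_ge0 ?(ltW q0)// addr_ge0 ?invsq_ge0.
    + by rewrite expr0 mul1r /invsq1 eqxx lerDl invsq_ge0.
    + by rewrite mulr_ge0// ltW.
    + move=> n.
      rewrite (eq_bigr (fun j : 'I_n.+1 => D * q ^+ n * (invsq j * invsq1 (n - j)%N))).
        rewrite -mulr_sumr [leRHS](_ : _ = D * q ^+ n * (9 * invsq1 n)); last by ring.
        apply: ler_wpM2l; last exact: conv_invsq.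
        by rewrite mulr_ge0 ?exprn_ge0 ?(ltW D0) ?(ltW q0).
      move=> j _; have -> : q ^+ n = q ^+ j * q ^+ (n - j).
        by rewrite -exprD subnKC// leq_ord.
      by ring.
    + by rewrite mulr_ge0 ?exprn_ge0 ?(ltW p0).
    + by move=> w <-; exact: aM.
    have -> : invsq1 (size r) = invsq (size r) by rewrite /invsq1 rn add0r.
    by rewrite -thD !exprMn; apply: eq_ler; ring.
  rewrite -mulr_sumr -{1}(add0n 2%N) big_addn.
  under eq_bigr => i _ do rewrite exprD.
  rewrite -mulr_suml big_mkord.
  pose Y := q ^+ size r * invsq (size r) * normprod r.
  have Y0 : 0 <= Y by rewrite !mulr_ge0 ?normprod_ge0 ?invsq_ge0 ?exprn_ge0 ?(ltW q0).
  rewrite [leRHS](_ : _ = Y * D); last by rewrite /Y; ring.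
  rewrite [leLHS](_ : _ = Y * (C * (\sum_(i < (size r).+1 - 2) th ^+ i * th ^+ 2))); last first.
    by rewrite /Y mulr_suml; ring.
  apply: ler_wpM2l => //; rewrite -mulr_suml.
  apply: (@le_trans _ _ (C * (2 * th ^+ 2))).
    apply: ler_wpM2l => //; apply: ler_wpM2r; first by rewrite exprn_ge0// ltW.
    by apply: sum_geometric_le => //; exact: ltW.
  rewrite expr2 -{2}thD [leLHS](_ : _ = th * (18 * C * p) * D); last by ring.
  rewrite ler_piMl ?(ltW D0)//; lra.
exists D, q; split; [exact: ltW|by []|move=> s].
apply: le_trans (bound _ _) _; rewrite ler_wpM2r ?normprod_ge0// ler_piMr//.
  by rewrite mulr_ge0 ?exprn_ge0 ?(ltW D0) ?(ltW q0).
rewrite /invsq; case: (size s) => [|n]; first by rewrite expr0n invr0.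
by rewrite invf_le1 ?exprn_gt0// exprn_ege1// ler1n.
Qed.

End InvSeries.
End InverseSeries.

(** * From the inverse series to a local inverse *)

Section InverseFunction.
Context {R : realType} {V : completeNormedModType R}.

Lemma analytic_right_inverse (f : V -> V) x :
  analytic_at f x -> (forall h, 'd f x h = h) ->
  exists g, [/\ analytic_at g (f x), g (f x) = x, forall h, 'd g (f x) h = h &
    \forall y \near f x, f (g y) = y].
Proof.
move=> [a [C [p fa]]] dfx; have [C0 p0 al aM aR] := fa.
have a1 h : a [:: h] = h by rewrite -(expansion_differentiable fa).2.
have [D [q [D0 q0 bM]]] := inv_series_bound C0 p0 aM.
pose b := inv_series a; pose g y := x + series_sum b (y - f x).
have gb := expansionD (expansion_cst x (f x))
  (series_sum_expansion (f x) D0 q0 (multilin_inv_series al) bM).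
have gfx : g (f x) = x by have := expansion_nil gb; rewrite /= addr0.
exists g; split=> //.
- by do 3 eexists; exact: gb.
- move=> h; rewrite (expansion_differentiable gb).2/= add0r.
  by rewrite -[X in X = _]/(inv_series a [:: h]) (inv_seriesE al) big_geq// subr0.
have fa' := fa; rewrite -gfx in fa'.
have [C' [q' [C'0 q'0 _ _ fgR]]] := analytic_at_comp_expansion fa' gb.
pose b2 (r : seq V) := if r is [::] then 0 else
  ((fun s => if s is [::] then x else 0) \+ inv_series a) r.
have b2E : b2 = inv_series a by apply/funext => -[|u s] //=; rewrite add0r.
(* The fixed point equation cancels all terms of degree at least two, so the composite has the
   coefficients of [h |-> f x + h]. Its remainder bounds of every order then force equality. *)
have cE s : \sum_(k < (size s).+1) comp b2 k a s =
    (if s is [::] then f x else 0) + coef_id s.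
  rewrite b2E; case: s => [|u s]; first by rewrite big_ord1/= addr0 (expansion_nil fa).
  rewrite -(big_mkord xpredT (fun k => comp (inv_series a) k a (u :: s))).
  rewrite big_ltn// big_ltn// comp1 a1 [inv_series _ _](inv_seriesE al).
  by rewrite subrK.
apply/near_ball; exists (2 * q'); first by rewrite mulr_gt0.
move=> h hq; have t0 : 0 <= q' * `|h| by rewrite mulr_ge0// ltW.
have t1 : q' * `|h| <= 1 / 2 by rewrite -mulrA in hq; lra.
have h1 : q' * `|h| < 1 by lra.
apply/eqP; rewrite -subr_eq0 -normr_le0; apply: (@le_geometric_limit _ _ _ C' 2) => -[|[|N]]// _.
have := fgR N.+2 h h1; under eq_bigr => n _ do rewrite cE.
rewrite big_ord_recl big_ord_recl big1 => [|i _]; last by rewrite /= addr0.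
rewrite /= !addr0 add0r add0r => /le_trans; apply.
by rewrite ler_wpM2l// lerXn2r ?nnegrE.
Qed.

(** The right inverse [g] has a right inverse too, which must be [f]. *)
Theorem analytic_inverse (f : V -> V) x :
  analytic_at f x -> (forall h, 'd f x h = h) ->
  exists g, [/\ analytic_at g (f x), g (f x) = x,
    \forall y \near f x, f (g y) = y & \forall z \near x, g (f z) = z].
Proof.
move=> fa df; have [g [ga gx dg fg]] := analytic_right_inverse fa df.
have [f' [f'a f'x _ gf']] := analytic_right_inverse ga dg.
rewrite gx in f'a f'x gf'.
have fgf' : \forall z \near x, f (g (f' z)) = f' z.
  by apply: (analytic_at_nbhs (P := fun y => f (g y) = y) f'a); rewrite f'x.
exists g; split=> //; near=> z.
have gf'z : g (f' z) = z by near: z.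
have : f (g (f' z)) = f' z by near: z.
by rewrite gf'z => ->.
Unshelve. all: by end_near. Qed.

End InverseFunction.

(** * Recentering a power series *)

Section Recentering.
Context {R : realType} {V : normedModType R}.

Section Insertions.
Context {W : normedModType R}.
Variable y : V.
Implicit Types (a : seq V -> W) (s : seq V).

(** The sum of [a] over all ways to insert [m] copies of [y] into [s]. *)
Fixpoint ins m a s : W :=
  if m is m'.+1 then
    (fix insm s a := if s is u :: s' then
       insm s' (fun w => a (u :: w)) + ins m' (fun w => a (y :: w)) s
     else ins m' (fun w => a (y :: w)) [::]) s a
  else a s.

Lemma insS_nil m a : ins m.+1 a [::] = ins m (fun w => a (y :: w)) [::].
Proof. by []. Qed.

Lemma insS_cons m a u s : ins m.+1 a (u :: s) =
  ins m.+1 (fun w => a (u :: w)) s + ins m (fun w => a (y :: w)) (u :: s).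
Proof. by []. Qed.

Lemma ins_linear m a1 a2 (c : R) s :
  ins m (fun w => c *: a1 w + a2 w) s = c *: ins m a1 s + ins m a2 s.
Proof.
elim: m a1 a2 s => [//|m IH] a1 a2 s; elim: s a1 a2 => [|u s IHs] a1 a2.
  by rewrite !insS_nil IH.
by rewrite !insS_cons IH IHs scalerDr addrACA.
Qed.

Lemma multilin_ins m a : multilin a -> multilin (ins m a).
Proof.
elim: m a => [//|m IH] a al s p c u v; elim: s a al => [|w s IHs] a al.
  rewrite !cat0s !insS_cons.
  have := IH _ (multilin_cons y al) [::] p c u v; rewrite !cat0s => ->.
  rewrite scalerDr addrACA -ins_linear; congr (ins m.+1 _ p + _).
  by apply/funext => w; exact: multilin_hd.
rewrite !cat_cons !insS_cons IHs; last exact: multilin_cons.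
have := IH _ (multilin_cons y al) (w :: s) p c u v; rewrite !cat_cons => ->.
by rewrite scalerDr addrACA.
Qed.

(** The number of insertions is a binomial coefficient, at most [2 ^ (m + size s)]. *)
Lemma ins_bound m a (A : R) s : 0 <= A ->
  (forall w, size w = (m + size s)%N -> `|a w| <= A * normprod w) ->
  `|ins m a s| <= A * 2 ^+ (m + size s) * `|y| ^+ m * normprod s.
Proof.
elim: m a A s => [|m IH] a A s A0 aM.
  apply: le_trans (aM _ _) _ => //; rewrite expr0 mulr1 ler_wpM2r ?normprod_ge0//.
  by rewrite ler_peMr// exprn_ege1// ler1n.
have ybd r n : size r = n -> (forall w, size w = (m.+1 + n)%N -> `|a w| <= A * normprod w) ->
    `|ins m (fun w => a (y :: w)) r| <= A * 2 ^+ (m + n) * `|y| ^+ m.+1 * normprod r.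
  move=> rn aM'; apply: le_trans (IH _ (A * `|y|) _ _ _) _; first by rewrite mulr_ge0.
    by move=> w wn; apply: le_trans (aM' _ _) _; rewrite /= ?wn ?rn// normprod_cons mulrA.
  by rewrite rn exprS; apply: eq_ler; ring.
elim: s a A A0 aM ybd => [|u s IHs] a A A0 aM ybd.
  rewrite insS_nil; apply: le_trans (ybd [::] _ erefl aM) _.
  rewrite !addn0 normprod_nil !mulr1 ler_wpM2r ?exprn_ge0//.
  by rewrite ler_wpM2l// ler_eXn2l// ltr1n.
rewrite insS_cons; apply: le_trans (ler_normD _ _) _.
rewrite [leRHS](_ : _ = A * `|u| * 2 ^+ (m.+1 + size s) * `|y| ^+ m.+1 * normprod s +
    A * 2 ^+ (m + size (u :: s)) * `|y| ^+ m.+1 * normprod (u :: s)); last first.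
  by rewrite normprod_cons /= addSn addnS exprS; ring.
apply: lerD; last exact: ybd.
apply: IHs; first by rewrite mulr_ge0.
  by move=> w wn; apply: le_trans (aM _ _) _; rewrite /= ?wn ?addnS// normprod_cons mulrA.
move=> r n rn aM'; apply: le_trans (IH _ (A * `|u| * `|y|) _ _ _) _; first by rewrite !mulr_ge0.
  move=> w wn; have := aM' (y :: w); rewrite /= wn rn normprod_cons mulrA; exact.
by rewrite rn exprS; apply: eq_ler; ring.
Qed.

(** A binomial formula without symmetry; the recursion defining [ins] plays the part of Pascal's
    rule. *)
Lemma ins_binomial k a h : multilin a ->
  a (nseq k (y + h)) = \sum_(n < k.+1) ins (k - n) a (nseq n h).
Proof.
elim: k a => [|k IH] a al; first by rewrite big_ord1.
have := multilin_hd (nseq k (y + h)) 1 y h al; rewrite !scale1r /= => ->.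
rewrite (IH _ (multilin_cons y al)) (IH _ (multilin_cons h al)).
rewrite [RHS]big_ord_recl subn0 insS_nil [in LHS]big_ord_recl subn0 -!addrA; congr (_ + _).
rewrite [in RHS](eq_bigr (fun n : 'I_k.+1 => ins (k - n) a (h :: nseq n h))) => [|n _]; last first.
  by rewrite lift0 subSS.
rewrite [in LHS]big_ord_recr [in RHS]big_ord_recr /= subnn addrA; congr (_ + _).
rewrite -big_split; apply: eq_bigr => -[n /= nk] _; rewrite /bump /= add1n.
rewrite -(subnSK nk) insS_cons addrC; congr (_ + _).
Qed.

End Insertions.

Context {W : completeNormedModType R}.

Definition recenter y (a : seq V -> W) s := lim (series (fun m => ins y m a s) @ \oo).

Section Recenter.
Variables (y : V) (a : seq V -> W) (C q : R).
Hypotheses (C0 : 0 <= C) (q0 : 0 < q) (al : multilin a) (qy : q * `|y| <= 1 / 4)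
  (aM : forall s, `|a s| <= C * q ^+ size s * normprod s).

(** The ratio is [2 * (q * |y|)], where [2] counts insertions; this explains the bound [1 / 4] on
    [q * |y|]. *)
Lemma ins_geometric m s :
  `|ins y m a s| <= C * (2 * q) ^+ size s * normprod s * (1 / 2) ^+ m.
Proof.
apply: le_trans (@ins_bound _ _ m a (C * q ^+ (m + size s)) s _ _) _.
- by rewrite mulr_ge0 ?exprn_ge0 ?(ltW q0).
- by move=> w <-; exact: aM.
rewrite [leLHS](_ : _ = C * (2 * q) ^+ size s * normprod s * (2 * (q * `|y|)) ^+ m).
  apply: ler_wpM2l.
    rewrite mulr_ge0 ?normprod_ge0// mulr_ge0// exprn_ge0// mulr_ge0// ltW//.
  have qy0 : 0 <= q * `|y| by rewrite mulr_ge0// ltW.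
  have qy' : q * `|y| <= 1 / 4 := qy.
  apply: lerXn2r; rewrite ?nnegrE; lra.
by rewrite !exprD !exprMn; ring.
Qed.

Lemma recenter_limit s n :
  `|recenter y a s - \sum_(m < n) ins y m a s| <=
    2 * (C * (2 * q) ^+ size s * normprod s) * (1 / 2) ^+ n.
Proof.
apply: geometric_series_limit => //; last by move=> k; exact: ins_geometric.
by rewrite mulr_ge0 ?normprod_ge0// mulr_ge0// exprn_ge0// mulr_ge0// ltW.
Qed.

Lemma multilin_recenter : multilin (recenter y a).
Proof.
move=> s p c u v; apply/eqP; rewrite -subr_eq0 -normr_le0.
pose K w := 2 * (C * (2 * q) ^+ size (s ++ w :: p) * normprod (s ++ w :: p)).
apply: (@le_geometric_limit _ _ _ (K (c *: u + v) + (`|c| * K u + K v)) 0) => n _.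
rewrite add0r.
have -> : recenter y a (s ++ (c *: u + v) :: p) -
  (c *: recenter y a (s ++ u :: p) + recenter y a (s ++ v :: p)) =
  (recenter y a (s ++ (c *: u + v) :: p) - \sum_(m < n) ins y m a (s ++ (c *: u + v) :: p))
  - (c *: (recenter y a (s ++ u :: p) - \sum_(m < n) ins y m a (s ++ u :: p)) +
     (recenter y a (s ++ v :: p) - \sum_(m < n) ins y m a (s ++ v :: p))).
  rewrite (eq_bigr (fun m : 'I_n => c *: ins y m a (s ++ u :: p) + ins y m a (s ++ v :: p))).
    rewrite big_split/= -scaler_sumr scalerBr addrACA -opprD.
    by rewrite [in RHS]opprB [RHS]addrA subrK.
  by move=> m _; rewrite (multilin_ins y m al).
rewrite mulrDl [X in _ <= _ + X]mulrDl -(mulrA `|c|).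
apply: le_trans (ler_normB _ _) (lerD (recenter_limit _ _) _).
apply: le_trans (ler_normD _ _) (lerD _ (recenter_limit _ _)).
by rewrite normrZ ler_wpM2l// recenter_limit.
Qed.

Lemma recenter_expansion (f : V -> W) x :
  (forall n h, q * `|h| < 1 ->
    `|f (x + h) - \sum_(k < n) a (nseq k h)| <= C * (q * `|h|) ^+ n) ->
  has_expansion f (x + y) (recenter y a) (4 * C) (4 * q).
Proof.
move=> aR; split; [by rewrite mulr_ge0|by rewrite mulr_gt0|exact: multilin_recenter| |].
  move=> s; have := recenter_limit s 0%N; rewrite big_ord0 subr0 expr0 mulr1.
  move=> /le_trans; apply; rewrite mulrA ler_wpM2r ?normprod_ge0// mulrA.
  apply: ler_pM; rewrite ?mulr_ge0 ?exprn_ge0 ?mulr_ge0 ?(ltW q0)//.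
    by rewrite ler_wpM2r// ler_nat.
  have q0' : 0 < q := q0.
  by apply: lerXn2r; rewrite ?nnegrE; lra.
move=> N h; rewrite -mulrA => hq.
have t0 : 0 <= q * `|h| by rewrite mulr_ge0// ltW.
have t2 : 2 * (q * `|h|) <= 1 / 2 by lra.
have T0 n : 0 <= (2 * (q * `|h|)) ^+ n by apply: exprn_ge0; rewrite mulr_ge0.
apply: (@le_geometric_limit _ _ _ (C + 2 * C * N%:R) N) => K NK.
have yh : q * `|y + h| <= 1 / 2.
  have qy' : q * `|y| <= 1 / 4 := qy.
  by have := ler_wpM2l (ltW q0) (ler_normD y h); rewrite mulrDr; lra.
have := aR K (y + h); rewrite addrA => /(_ _) fK.
have {}fK : `|f (x + y + h) - \sum_(k < K) a (nseq k (y + h))| <= C * (1 / 2) ^+ K.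
  apply: le_trans (fK _) _; first by lra.
  by apply: ler_wpM2l => //; apply: lerXn2r; rewrite ?nnegrE// ?mulr_ge0// ltW.
have EK : \sum_(k < K) a (nseq k (y + h)) =
    \sum_(n < K) \sum_(m < K - n) ins y m a (nseq n h).
  rewrite -(sum_triangle (fun n m => ins y m a (nseq n h))).
  by apply: eq_bigr => k _; exact: ins_binomial.
rewrite {}EK in fK.
pose S n := \sum_(m < K - n) ins y m a (nseq n h).
have Sn n : `|S n| <= 2 * C * (2 * (q * `|h|)) ^+ n.
  apply: le_trans (ler_norm_sum _ _ _) _.
  apply: (@le_trans _ _ (\sum_(m < K - n) C * (2 * (q * `|h|)) ^+ n * (1 / 2) ^+ m)).
    apply: ler_sum => m _; apply: le_trans (ins_geometric _ _) _.
    by rewrite size_nseq normprod_nseq; apply: eq_ler; rewrite !exprMn; ring.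
  rewrite -mulr_sumr [leRHS](_ : _ = C * (2 * (q * `|h|)) ^+ n * 2); last by ring.
  apply: ler_wpM2l; first by rewrite mulr_ge0// mulr_ge0.
  by apply: sum_geometric_le => //; lra.
have Rn n : (n <= K)%N -> `|S n - recenter y a (nseq n h)| <= 2 * C * (1 / 2) ^+ K.
  move=> nK; rewrite distrC; apply: le_trans (recenter_limit _ _) _.
  rewrite size_nseq normprod_nseq -!mulrA ler_wpM2l// ler_wpM2l// mulrA -exprMn.
  rewrite -(subnKC nK) exprD addKn ler_wpM2r ?exprn_ge0// -mulrA.
  by apply: lerXn2r; rewrite ?nnegrE// mulr_ge0.
(* Three errors: the remainder of order [K] at [x], the truncation of the recentered coefficients of
   degree below [N], and the degrees from [N] to [K]. The first two vanish as [K] grows, and the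
   last is geometric of order [N]. *)
have -> : f (x + y + h) - \sum_(k < N) recenter y a (nseq k h) =
  (f (x + y + h) - \sum_(n < K) S n) + (\sum_(n < N) (S n - recenter y a (nseq n h))
    + \sum_(N <= n < K) S n).
  rewrite sumrB -(big_mkord xpredT S) (@big_cat_nat _ _ _ N 0 K)//= big_mkord.
  by rewrite (addrAC (\sum_(i < N) S i)) [RHS]addrA subrK.
have -> : 4 * C * (4 * (q * `|h|)) ^+ N + (C + 2 * C * N%:R) * (1 / 2) ^+ K =
  C * (1 / 2) ^+ K + (2 * C * (1 / 2) ^+ K * N%:R + 4 * C * (4 * (q * `|h|)) ^+ N) by ring.
apply: le_trans (ler_normD _ _) (lerD fK _).
apply: le_trans (ler_normD _ _) (lerD _ _).
  apply: le_trans (ler_norm_sum _ _ _) _.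
  rewrite mulr_natr -[X in _ *+ X](card_ord N) -sumr_const; apply: ler_sum => n _.
  by apply: Rn; rewrite ltnW// (leq_trans _ NK).
apply: (@le_trans _ _ (4 * C * (2 * (q * `|h|)) ^+ N)); last first.
  apply: ler_wpM2l; first by rewrite mulr_ge0.
  by apply: lerXn2r; rewrite ?nnegrE; lra.
rewrite -{1}(add0n N) big_addn; apply: le_trans (ler_norm_sum _ _ _) _.
apply: (@le_trans _ _ (\sum_(0 <= i < K - N) 2 * C * (2 * (q * `|h|)) ^+ N * (2 * (q * `|h|)) ^+ i)).
  by apply: ler_sum => i _; apply: le_trans (Sn _) _; rewrite exprD; apply: eq_ler; ring.
rewrite -mulr_sumr big_mkord [leRHS](_ : _ = 2 * C * (2 * (q * `|h|)) ^+ N * 2); last by ring.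
apply: ler_wpM2l; first by rewrite mulr_ge0 // mulr_ge0.
by apply: sum_geometric_le => //; rewrite mulr_ge0.
Qed.

End Recenter.

Theorem analytic_at_open (f : V -> W) x :
  analytic_at f x -> \forall y \near x, analytic_at f y.
Proof.
move=> [a [C [q [C0 q0 al aM aR]]]]; apply/near_ball.
exists (4 * q); first by rewrite mulr_gt0.
move=> y yq; do 3 eexists; apply: recenter_expansion aR => //.
by rewrite -mulrA in yq; lra.
Qed.

End Recentering.

(** * Comparison with power series on families indexed by ordinals *)

Section PowerSeries.
Context {R : realType} {V W : normedModType R}.

Lemma map_dfwith k (v : 'I_k -> V) i : exists s p, forall u,
  [seq @dfwith _ (fun=> V) v i u j | j <- enum 'I_k] = s ++ u :: p.
Proof.
have := mem_enum 'I_k i; case/splitPr E : _ / => [s p].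
have := enum_uniq 'I_k; rewrite E cat_uniq => /and3P[_ sp /= /andP[ip _]].
exists (map v s), (map v p) => u; rewrite map_cat /= dfwithin.
congr (_ ++ _ :: _); apply/eq_in_map => j jx; apply: dfwithout; apply: contraTneq jx => <-//.
by apply: contra sp => js; apply/hasP; exists i => //; rewrite mem_head.
Qed.

Lemma analytic_at_has_power_series (D : set V) (f : V -> W) x :
  analytic_at f x -> has_power_series D f x.
Proof.
move=> [a [C [q [C0 q0 al aM aR]]]].
exists q^-1, C, (fun k v => a [seq v j | j <- enum 'I_k]); split.
- by rewrite invr_gt0.
- move=> k v i c u w; have [s [p E]] := map_dfwith v i.
  by rewrite !E al.
- move=> k v; have := aM [seq v j | j <- enum 'I_k].
  rewrite size_map size_enum_ord /normprod big_map big_enum/= => av.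
  rewrite exprVn ler_pdivrMr ?exprn_gt0//; apply: le_trans av _.
  by rewrite mulrAC.
move=> h hq _.
have {}hq : q * `|h| < 1 by rewrite -ltr_pdivlMl// mulr1.
have t0 : 0 <= q * `|h| by rewrite mulr_ge0// ltW.
have -> : (fun k => a [seq h | _ <- enum 'I_k]) = (fun k => a (nseq k h)).
  apply/funext => k; congr a; rewrite -[in RHS](size_enum_ord k).
  by elim: (enum 'I_k) => [//|i s IH] /=; rewrite IH.
apply/cvgrPdist_le => e e0.
have t1 : `|q * `|h| | < 1 by rewrite ger0_norm.
have H := @cvgr0_norm_le _ _ _ _ _ _ (cvg_geometric C t1) _ e0.
near=> n; have : `|geometric C (q * `|h|) n| <= e by near: n; exact: H.
rewrite /geometric /= ger0_norm ?mulr_ge0 ?exprn_ge0//.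
by apply: le_trans; rewrite /series/= big_mkord; exact: aR.
Unshelve. all: by end_near. Qed.

End PowerSeries.

(** * Differentials and velocities of curves *)

Section Differentials.
Context {R : realType}.

Lemma near_eq_differential (V W : normedModType R) (f g : V -> W) x h :
  (\forall y \near x, f y = g y) -> analytic_at f x -> 'd f x h = 'd g x h.
Proof.
move=> fg fa; have ga := analytic_at_near fg fa.
have [df dg] := (analytic_at_differentiable fa, analytic_at_differentiable ga).
by rewrite -!deriveE//; exact: near_eq_derive.
Qed.

Lemma is_derive_comp (V W : normedModType R) (f : V -> W) (g : R^o -> V) u :
  is_derive (0 : R^o) (1 : R^o) g u -> differentiable f (g 0) ->
  is_derive (0 : R^o) (1 : R^o) (f \o g) ('d f (g 0) u).
Proof.
move=> [/derivable1_diffP dg gu] df.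
have dfg : differentiable (f \o g) (0 : R^o) by apply: differentiable_comp.
split; first exact: diff_derivable.
by rewrite deriveE// diff_comp//= -(deriveE _ dg) gu.
Qed.

Lemma analytic_at_line (V : normedModType R) (x u : V) (t : R^o) :
  analytic_at (fun s : R^o => x + s *: u) t.
Proof.
apply: analytic_atD; first exact: analytic_at_cst.
apply: (@analytic_at_bilinear _ R^o R^o V V (fun s v => s *: v) 1 id (fun=> u)).
- by move=> v c s s'; rewrite scalerDl scalerA.
- by move=> s c v v'; rewrite scalerDr !scalerA mulrC.
- by move=> s v; rewrite normrZ mul1r.
- exact: analytic_at_id.
- exact: analytic_at_cst.
Qed.

Lemma is_derive_line (V : normedModType R) (x u : V) :
  is_derive (0 : R^o) (1 : R^o) (fun s : R^o => x + s *: u) u.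
Proof.
have sd := is_diff_scalel (0 : R^o) u.
have [dd du] : is_derive (0 : R^o) (1 : R^o) (fun s : R^o => s *: u) u.
  split; first exact/diff_derivable/ex_diff.
  by rewrite deriveE; [rewrite diff_val scale1r|exact: ex_diff].
have h := is_deriveD (is_derive_cst x (0 : R^o) (1 : R^o)) (DeriveDef dd du).
by rewrite add0r in h.
Qed.

End Differentials.

(** * Submanifolds from analytic retractions *)

Section Retractions.
Context {R : realType} {V : completeNormedModType R}.
Implicit Types (S : set V) (r : V -> V) (x : V).

Definition local_retraction S r x := [/\ S x, analytic_at r x,
  \forall y \near x, S (r y) & \forall y \near x, S y -> r y = y].

Lemma closed_kernel (W : completeNormedModType R) (f : V -> W) :
  continuous f -> closed [set u | f u = 0].
Proof.
move=> fc; apply: (@preimage_closed _ _ f [set 0]) => [u _|]; first exact: fc.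
exact: accessible_closed_set1 (hausdorff_accessible (@norm_hausdorff _ W)) 0.
Qed.

Lemma closed_subspace_kernel (L : {linear V -> V}) :
  continuous L -> closed_subspace [set u | L u = 0].
Proof.
move=> Lc; split; [exact: linear0| |exact: closed_kernel].
by move=> c u v /= Lu Lv; rewrite linearP Lu Lv scaler0 addr0.
Qed.

Section At.
Variables (S : set V) (r : V -> V) (x : V).
Hypothesis rx : local_retraction S r x.
Let P := 'd r x.

Lemma retraction_base : r x = x.
Proof. by have [Sx _ _ rS] := rx; apply: (nbhs_singleton rS). Qed.

Lemma retraction_near (Q : set V) : nbhs x Q -> \forall y \near x, Q (r y).
Proof.
by have [_ ra _ _] := rx => xQ; apply: (analytic_at_nbhs ra); rewrite retraction_base.
Qed.

(** Differentiate [r (r y) = r y], which holds near [x], at the fixed point [x]. *)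
Lemma retraction_differential_idem u : P (P u) = P u.
Proof.
have [_ ra Sr rS] := rx.
have dr := analytic_at_differentiable ra.
have rr : \forall y \near x, (r \o r) y = r y.
  near=> y; have Sry : S (r y) by near: y.
  have : S (r y) -> r (r y) = r y by near: y; exact: retraction_near rS.
  exact.
have rra : analytic_at (r \o r) x by apply: analytic_at_comp => //; rewrite retraction_base.
have dr' : differentiable r (r x) by rewrite retraction_base.
have E : 'd (r \o r) x u = 'd r (r x) ('d r x u) by rewrite (diff_comp dr dr').
have E' : 'd r (r x) ('d r x u) = 'd r x u.
  exact: etrans (esym E) (near_eq_differential (f := r \o r) (g := r) u rr rra).
by move: E'; rewrite retraction_base.
Unshelve. all: by end_near. Qed.

Lemma retraction_differential_continuous : continuous P.
Proof. by have [_ /analytic_at_differentiable/diff_continuous] := rx. Qed.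

Lemma closed_subspace_fixed : closed_subspace [set u | P u = u].
Proof.
split; first exact: linear0.
  by move=> c u v /= Pu Pv; rewrite linearP Pu Pv.
rewrite (_ : [set u | P u = u] = [set u | (P u - u) = 0]).
  apply: (@closed_kernel _ (fun u => P u - u)) => u.
  by apply: cvgB; [exact: retraction_differential_continuous|exact: cvg_id].
by apply/seteqP; split=> u /= h; apply/eqP; move/eqP: h; rewrite subr_eq0.
Qed.

Lemma complemented_fixed : complemented_in setT [set u | P u = u].
Proof.
split=> //; first exact: closed_subspace_fixed.
exists [set u | P u = 0]; split=> //.
- exact/closed_subspace_kernel/retraction_differential_continuous.
- by move=> u [/= Pu Pu0]; rewrite /= -Pu Pu0.
move=> u _; exists (P u), (u - P u); split; first exact: retraction_differential_idem.
  by rewrite /= linearB /= retraction_differential_idem subrr.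
by rewrite addrC subrK.
Qed.

(** [r] is the identity on [S], so in the coordinate [straighten] the part of
    [S] near [x] lies in the range of [P]; its differential at [x] is
    [P P + (1 - P) (1 - P) = 1]. *)
Definition straighten y := P (r y - x) + (y - r y - P (y - r y)).

Lemma straighten_analytic : analytic_at straighten x.
Proof.
have [_ ra _ _] := rx.
have aN (f : V -> V) : analytic_at f x -> analytic_at (fun y => - f y) x.
  move=> fa; apply: (@analytic_at_comp _ _ _ _ (-%R) f) => //.
  by apply: (@analytic_at_linear _ _ _ (-%R)) => y; exact: opp_continuous.
have aP (f : V -> V) : analytic_at f x -> analytic_at (fun y => P (f y)) x.
  move=> fa; apply: (@analytic_at_comp _ _ _ _ P f) => //.
  exact/analytic_at_linear/retraction_differential_continuous.
have yr : analytic_at (fun y => y - r y) x.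
  by apply: analytic_atD; [exact: analytic_at_id|exact: aN].
apply: analytic_atD.
  by apply: aP; apply: analytic_atD => //; exact: analytic_at_cst.
by apply: analytic_atD => //; apply: aN; exact: aP.
Qed.

Lemma straighten_base : straighten x = 0.
Proof. by rewrite /straighten retraction_base !subrr linear0 subrr addr0. Qed.

Lemma straighten_differential h : 'd straighten x h = h.
Proof.
have [_ /analytic_at_differentiable dr _ _] := rx.
have PD y : is_diff y P P.
  split; first exact/linear_differentiable/retraction_differential_continuous.
  by rewrite diff_lin//; exact: retraction_differential_continuous.
have rD : is_diff x r P by split.
have D1 := is_diffB (is_diff_id x) rD.
have D2 := is_diffB rD (is_diff_cst x x).
have D3 := is_diffD (is_diff_comp D2 (PD _)) (is_diffB D1 (is_diff_comp D1 (PD _))).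
have E : 'd straighten x = _ :> (V -> V) := @diff_val _ _ _ _ _ _ _ D3.
rewrite E /= !fctE /= subr0 linearB /= retraction_differential_idem subrr subr0.
by rewrite addrC subrK.
Qed.

(** The neighbourhood [U] allows charts to be shrunk until a map sends one into another. The
    pointwise [analytic_at] clauses are the form of analyticity that composes. *)
Lemma retraction_chart (U : set V) : nbhs x U ->
  exists c, [/\ submanifold_chart S c x, chart_dom c `<=` U,
    forall y, chart_dom c y -> analytic_at (chart_map c) y &
    forall y, chart_codom c y ->
      chart_dom c (chart_inv c y) /\ analytic_at (chart_inv c) y].
Proof.
move=> xU; have [Sx ra Sr rS] := rx.
have [g [ga g0 fg gf]] := analytic_inverse straighten_analytic straighten_differential.
rewrite straighten_base in ga g0 fg.
have fa := straighten_analytic; move: straighten_base => f0.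
pose F := straighten; rewrite -/F in fa gf fg f0.
(* The conditions on [r z] serve to identify [z] with [r z] when [F z] lies in the model space. *)
pose G := [set z | [/\ analytic_at F z, g (F z) = z, U z, S (r z) & S z -> r z = z] /\
  g (F (r z)) = r z /\ (S (r z) -> r (r z) = r z)].
have xG : nbhs x G.
  have h1 := analytic_at_open fa; have h2 := retraction_near gf; have h3 := retraction_near rS.
  near=> z; split; [split|split]; near: z => //.
pose B := [set y | analytic_at g y /\ F (g y) = y].
have B0 : nbhs 0 B by have h1 := analytic_at_open ga; near=> y; split; near: y.
(* Restricting on both sides makes the image equal to the intersection of the interior of [B] with
   the preimage by [g] of the interior of [G], which is open because [g] is continuous there. *)
pose c := Chart (G° `&` F @^-1` B°) F g [set u | P u = u].
have domG z : chart_dom c z -> G z by move=> [/interior_subset].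
have codomE : chart_codom c = B° `&` g @^-1` G°.
  apply/seteqP; split=> [_ [z [Gz Bz] <-]|y [By Gy]].
    split=> //=; have [[_ -> _ _ _] _] := interior_subset Gz; exact: Gz.
  have [_ Fg] := interior_subset By.
  by exists (g y) => //=; split=> //=; rewrite Fg.
exists c; split.
- split.
  + split; last by split => //=; rewrite /= f0.
    rewrite openE => z [Gz Bz]; have [[Fz _ _ _ _] _] := interior_subset Gz.
    apply: filterI; first by apply: open_nbhs_nbhs; split=> //; exact: open_interior.
    by apply: (analytic_at_nbhs Fz); apply: open_nbhs_nbhs; split=> //; exact: open_interior.
  + rewrite codomE openE => y [By Gy]; have [gy _] := interior_subset By.
    apply: filterI; first by apply: open_nbhs_nbhs; split=> //; exact: open_interior.
    by apply: (analytic_at_nbhs gy); apply: open_nbhs_nbhs; split=> //; exact: open_interior.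
  + by move=> z /set_mem/domG[[]].
  + split=> y.
      by move=> /domG[[Fy _ _ _ _] _]; exact: analytic_at_has_power_series.
    by rewrite codomE => -[/interior_subset[gy _] _]; exact: analytic_at_has_power_series.
  split; first exact: complemented_fixed.
  apply/seteqP; split=> [_ [z [zD Sz] <-]|y [[z zD <-] /= Py]].
    split; first by exists z.
    have [[_ _ _ _ /(_ Sz) rz] _] := domG _ zD.
    by rewrite /= /F /straighten rz subrr linear0 subrr addr0 retraction_differential_idem.
  exists z => //; split=> //.
  have [[_ gFz _ Srz _] [gFr /(_ Srz) rrz]] := domG _ zD.
  (* Since [g] inverts [F] at both [z] and [r z], equal values give [z = r z], which is a point of
     [S]. *)
  suff : F (r z) = F z by move=> e; rewrite -gFz -e gFr.
  have z0 : z - r z - P (z - r z) = 0.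
    have e : P (F z) = P (r z - x).
      rewrite /F /straighten linearD [P (_ - P _)]linearB /=.
      by rewrite !retraction_differential_idem subrr addr0.
    by apply: (addrI (P (r z - x))); rewrite addr0 -[RHS]e Py.
  by rewrite /F /straighten rrz subrr linear0 subrr addr0 z0 addr0.
- by move=> z /domG[[]].
- by move=> z /domG[[]].
move=> y; rewrite codomE => -[By Gy]; have [gy Fg] := interior_subset By.
by split=> //; split=> //=; rewrite Fg.
Unshelve. all: by end_near. Qed.

(** Differentiate [r (g t) = g t] at [0]. *)
Lemma retraction_velocity (g : R^o -> V) u : g 0 = x ->
  (\forall t \near (0 : R^o), S (g t)) -> is_derive (0 : R^o) (1 : R^o) g u -> P u = u.
Proof.
have [Sx ra Sr rS] := rx; have dr := analytic_at_differentiable ra.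
move=> g0 Sg gu.
have rg : \forall t \near (0 : R^o), (r \o g) t = g t.
  have cg : nbhs (0 : R^o) (g @^-1` [set y | S y -> r y = y]).
    have /derivable1_diffP/differentiable_continuous := @ex_derive _ _ _ _ _ _ _ gu.
    by apply; rewrite g0.
  near=> t; have Sgt : S (g t) by near: t.
  have : S (g t) -> r (g t) = g t by near: t.
  exact.
have drg : is_derive (0 : R^o) (1 : R^o) (r \o g) (P u).
  by rewrite /P -g0; apply: is_derive_comp; rewrite ?g0.
have [_ <-] := near_eq_is_derive rg drg.
by case: gu.
Unshelve. all: by end_near. Qed.

(** For the converse inclusion, [r] pushes the line [x + t *: u] onto a curve in [S] with velocity
    [P u = u]. *)
Lemma tangent_space_retraction : tangent_space S x = [set u | P u = u].
Proof.
have [Sx ra Sr rS] := rx; have dr := analytic_at_differentiable ra.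
apply/seteqP; split=> u.
  move=> [g [[g0 [e e0 [_ Sg]]] gu]] /=; apply: retraction_velocity gu => //.
  apply/near_ball; exists e^-1; rewrite ?invr_gt0// => t.
  by rewrite add0r ltr_pdivrMl// mulr1 => /Sg.
move=> /= Pu; exists (fun t : R^o => r (x + t *: u)).
have ga : analytic_at (fun t : R^o => r (x + t *: u)) 0.
  apply: (@analytic_at_comp _ R^o V V r (fun t => x + t *: u)).
    by rewrite scale0r addr0.
  exact: analytic_at_line.
split; last first.
  have := is_derive_comp (f := r) (is_derive_line x u).
  by rewrite scale0r addr0 -/P Pu; apply.
split; first by rewrite scale0r addr0 retraction_base.
have Sl : \forall t \near (0 : R^o), S (r (x + t *: u)).
  apply: (analytic_at_nbhs (P := fun y => S (r y)) (analytic_at_line x u 0)).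
  by rewrite scale0r addr0.
have /near_ball[q q0 qP] : \forall t \near (0 : R^o),
    analytic_at (fun t : R^o => r (x + t *: u)) t /\ S (r (x + t *: u)).
  by have h := analytic_at_open ga; near=> t; split; near: t.
exists q^-1; first by rewrite invr_gt0.
split=> [t /= tq|t tq].
  apply: analytic_at_has_power_series.
  by have [] := qP t; rewrite ?add0r// -ltr_pdivlMl// mulr1.
by have [] := qP t; rewrite ?add0r// -ltr_pdivlMl// mulr1.
Unshelve. all: by end_near. Qed.

End At.
End Retractions.

(** * Submersions between retracts *)

Section Submersion.
Context {R : realType} {V W : completeNormedModType R}.
Variables (S : set V) (T : set W) (f : V -> W).
Hypotheses (Sr : forall x, S x -> exists r, local_retraction S r x)
  (Tr : forall y, T y -> exists r, local_retraction T r y)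
  (fST : forall x, S x -> T (f x)) (fa : forall x, S x -> analytic_at f x).

Lemma retraction_analytic_map : analytic_map S T f.
Proof.
split=> // x Sx; have [r rx] := Sr Sx; have [p py] := Tr (fST Sx).
have [d [dT _ da _]] := retraction_chart py (@filterT _ (nbhs (f x)) _).
have [[dopen dfx] _ _ _ _] := dT.
have xU : nbhs x [set y | chart_dom d (f y) /\ analytic_at f y].
  have h1 := analytic_at_open (fa Sx).
  have h2 : \forall y \near x, chart_dom d (f y).
    by apply: (analytic_at_nbhs (fa Sx)); exact: open_nbhs_nbhs.
  by near=> y; split; near: y.
have [c [cS cU ca ci]] := retraction_chart rx xU.
exists c, d; split=> //.
  by move=> y /cU[].
move=> y [cy _]; apply: analytic_at_has_power_series.
have [cD ciy] := ci _ cy; have [dD fy] := cU _ cD.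
apply: analytic_at_comp => //; apply: analytic_at_comp; first exact: da.
exact: fy.
Unshelve. all: by end_near. Qed.

(** As [f] is analytic in the ambient space at points of [S], the relation defined by curves is a
    restriction of its Frechet differential. *)
Lemma differentialP x u w : S x ->
  differential S f x u w <-> tangent_space S x u /\ 'd f x u = w.
Proof.
move=> Sx; split=> [[g [gx gu fgw]]|[[g [gx gu]] dfu]].
  split; first by exists g.
  have := is_derive_comp (f := f) gu; have [g0 _] := gx; rewrite g0.
  move=> /(_ (analytic_at_differentiable (fa Sx)))[_ <-].
  by case: fgw.
exists g; split=> //; rewrite -dfu.
have := is_derive_comp (f := f) gu; have [-> _] := gx; apply.
exact: analytic_at_differentiable (fa Sx).
Qed.

(** A bounded right inverse [s] of the differential splits its kernel off. *)
Lemma retraction_submersion :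
  (forall x, S x -> exists s : {linear W -> V}, continuous s /\
    forall w, tangent_space T (f x) w -> tangent_space S x (s w) /\ 'd f x (s w) = w) ->
  analytic_submersion S T f.
Proof.
move=> split; split; first exact: retraction_analytic_map.
move=> x Sx; have [s [sc sP]] := split _ Sx; split.
  by move=> w /sP[su dfs]; exists (s w); exact/differentialP.
have [r rx] := Sr Sx; have [p py] := Tr (fST Sx).
have dfc := diff_continuous (analytic_at_differentiable (fa Sx)).
have dfT u : tangent_space S x u -> tangent_space T (f x) ('d f x u).
  move=> [g [[g0 [e e0 [_ Sg]]] gu]]; rewrite (tangent_space_retraction py) /=.
  apply: (retraction_velocity py (g := f \o g)); first by rewrite /= g0.
    apply/near_ball; exists e^-1; rewrite ?invr_gt0// => t.
    by rewrite add0r ltr_pdivrMl// mulr1 => /Sg/fST.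
  by rewrite -g0; apply: is_derive_comp => //; rewrite g0; exact: analytic_at_differentiable (fa Sx).
have [T0 TD Tc] := closed_subspace_fixed rx; rewrite -(tangent_space_retraction rx) in T0 TD Tc.
have ker : [set u | differential S f x u 0] = tangent_space S x `&` [set u | 'd f x u = 0].
  by apply/seteqP; split=> u /= /(differentialP _ _ Sx).
have sub_and (M : set V) : closed_subspace M -> closed_subspace (tangent_space S x `&` M).
  move=> [M0 MD Mc]; split=> //; last exact: closedI.
  by move=> c u v [Tu Mu] [Tv Mv]; split; [exact: TD|exact: MD].
rewrite ker; split; [|exact: subIsetl|].
  apply: sub_and; split; [exact: linear0| |exact: closed_kernel].
  by move=> c u v /= du dv; rewrite linearP du dv scaler0 addr0.
(* On the tangent space [s \o 'd f x] is idempotent with the same kernel as ['d f x]; its fixed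
   vectors form the complement. *)
exists (tangent_space S x `&` [set u | s ('d f x u) = u]); split.
- apply: sub_and; split; first by rewrite /= !linear0.
    by move=> c u v /= du dv; rewrite !linearP du dv.
  rewrite (_ : [set u | _] = [set u | s ('d f x u) - u = 0]).
    apply: (@closed_kernel _ _ _ (fun u => s ('d f x u) - u)) => u.
    apply: cvgB; last exact: cvg_id.
    by apply: (@continuous_comp _ _ _ ('d f x) s); [exact: dfc|exact: sc].
  by apply/seteqP; split=> u /= h; apply/eqP; move/eqP: h; rewrite subr_eq0.
- exact: subIsetl.
- by move=> u [[_ /= df0] [_ /= <-]]; rewrite df0 linear0.
move=> u Tu; have [Ts dfs] := sP _ (dfT _ Tu).
exists (u - s ('d f x u)), (s ('d f x u)); split; last by rewrite subrK.
  split; last by rewrite /= linearB /= dfs subrr.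
  by rewrite addrC -scaleN1r; apply: TD.
by split=> //=; rewrite dfs.
Qed.

End Submersion.

(** * Adjoints *)

Section Adjoint.
Context {R : realType} {H : completeNormedModType R[i]}.
Variable ip : {dot H for @Num.conj R[i]}.
Hypothesis ip_norm : induces_norm ip.
Implicit Types (x y h z : H) (T S : bounded_op H).

Definition rip x y : R := complex.Re (ip x y).

Lemma ripDl x y z : rip (x + y) z = rip x z + rip y z.
Proof. by rewrite /rip linearDl raddfD. Qed.

Lemma ripNl x z : rip (- x) z = - rip x z.
Proof. by rewrite /rip linearNl raddfN. Qed.

Lemma ipC x y : ip x y = conjc (ip y x).
Proof. by rewrite (hermC ip) expr0 mul1r. Qed.

Lemma ripC x y : rip x y = rip y x.
Proof.
by rewrite /rip ipC; case: (ip y x).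
Qed.

Lemma ripDr x y z : rip x (y + z) = rip x y + rip x z.
Proof. by rewrite !(ripC x) ripDl. Qed.

Lemma ripNr x z : rip x (- z) = - rip x z.
Proof. by rewrite !(ripC x) ripNl. Qed.

Lemma ipDl x y z : ip (x + y) z = ip x z + ip y z.
Proof. exact: linearDl. Qed.

Lemma ipDr x y z : ip x (y + z) = ip x y + ip x z.
Proof. exact: linearDr. Qed.

Lemma ipZl (c : R[i]) x y : ip (c *: x) y = c * ip x y.
Proof. exact: linearZl_LR. Qed.

Lemma ipZr (c : R[i]) x y : ip x (c *: y) = conjc c * ip x y.
Proof. exact: linearZr_LR. Qed.

Lemma ripZl (t : R) x y : rip (t%:C%C *: x) y = t * rip x y.
Proof.
rewrite /rip ipZl; case: (ip x y) => a b /=.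
by rewrite mul0r subr0.
Qed.

Lemma ripZr (t : R) x y : rip x (t%:C%C *: y) = t * rip x y.
Proof. by rewrite !(ripC x) ripZl. Qed.

Lemma rip_norm x : rip x x = rnorm x ^+ 2.
Proof. by rewrite /rip ip_norm -rnormE -rmorphXn. Qed.

Lemma rip_CauchySchwarz x y : `|rip x y| <= rnorm x * rnorm y.
Proof.
wlog xy : x / 0 <= rip x y.
  move=> wl; have [xy|/ltW xy] := leP 0 (rip x y); first exact: wl.
  by rewrite -normrN -ripNl -[rnorm x](_ : rnorm (- x) = _) ?wl ?ripNl ?oppr_ge0// /rnorm normrN.
rewrite ger0_norm//.
have q t : 0 <= rnorm x ^+ 2 - 2 * t * rip x y + t ^+ 2 * rnorm y ^+ 2.
  rewrite -!rip_norm (_ : _ + _ = rip (x - t%:C%C *: y) (x - t%:C%C *: y)).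
    by rewrite rip_norm exprn_ge0// rnorm_ge0.
  by rewrite !ripDl !ripDr !ripNl !ripNr !ripZl !ripZr (ripC y x); ring.
have := rnorm_ge0 x; have := rnorm_ge0 y.
have [y0|y0] := eqVneq (rnorm y) 0.
  (* For [y = 0] the quadratic is affine in [t]; this [t] would make it negative unless
     [rip x y = 0]. *)
  have := q ((rnorm x ^+ 2 + 1) / (rip x y)).
  rewrite y0 expr0n/= mulr0 mulr0 addr0.
  have [->//|xy0] := eqVneq (rip x y) 0.
  rewrite -mulrA divfK// => h _ _; have := exprn_ge0 2 (rnorm_ge0 x); lra.
have := q (rip x y / rnorm y ^+ 2); move: (rnorm x) (rnorm y) y0 (rip x y) xy => a b b0 c c0.
rewrite (_ : _ + _ = ((a * b) ^+ 2 - c ^+ 2) / b ^+ 2); last by field.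
move=> h b0' a0; have : 0 <= (a * b) ^+ 2 - c ^+ 2.
  by move: h; rewrite pmulr_lge0// invr_gt0 exprn_gt0// lt_def b0.
by rewrite subr_ge0 ler_pXn2r// nnegrE mulr_ge0.
Qed.

Lemma rip_inj y z : (forall x, rip x y = rip x z) -> y = z.
Proof.
move=> yz; apply/eqP; rewrite -subr_eq0; apply/eqP/rnorm_eq0/eqP.
by rewrite -sqrf_eq0 -rip_norm ripDr ripNr yz subrr.
Qed.

(** [z] minimizes [F x = |x| ^ 2 - 2 phi x]; by the parallelogram law the sets
    [F < inf F + d] form a Cauchy filter. *)
Lemma real_riesz (phi : H -> R) (M : R) :
  (forall x y, phi (x + y) = phi x + phi y) ->
  (forall (t : R) x, phi (t%:C%C *: x) = t * phi x) ->
  (forall x, `|phi x| <= M * rnorm x) -> exists z, forall x, phi x = rip x z.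
Proof.
move=> phiD phiZ phiM.
pose F x := rnorm x ^+ 2 - 2 * phi x.
have Flb x : - M ^+ 2 <= F x.
  rewrite /F; have := phiM x; rewrite ler_norml => /andP[_].
  have := sqr_ge0 (rnorm x - M); rewrite sqrrB -mulr_natr; lra.
pose A := [set F x | x in [set: H]].
have Ainf : has_inf A by split; [exists (F 0), 0|exists (- M ^+ 2) => _ [x _ <-]].
pose m := inf A.
have mF x : m <= F x by apply: ge_inf; [exact: Ainf.2|exists x].
pose L (d : R) := [set x | F x < m + d].
pose G := filter_from [set d : R | 0 < d] L.
have Ln0 d : 0 < d -> L d !=set0.
  by move=> d0; have [_ [x _ <-] xd] := inf_adherent d0 Ainf; exists x.
have GP : ProperFilter G.
  apply: filter_from_proper => [|d d0]; last exact: Ln0.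
  apply: filter_from_filter; first by exists 1 => /=.
  move=> d e d0 e0; exists (Num.min d e); rewrite /= ?lt_min ?d0 ?e0//.
  by move=> x xl; split; apply: (lt_le_trans xl); rewrite lerD2l ge_min lexx ?orbT.
have GF : Filter G by exact: filter_filter.
have par x y d : L d x -> L d y -> rnorm (x - y) ^+ 2 <= 4 * d.
  rewrite /L /= => Fx Fy; have := mF ((1 / 2 : R)%:C%C *: (x + y)).
  move: Fx Fy; rewrite /F phiZ phiD -!rip_norm ripZl ripZr.
  by rewrite !(ripDl, ripDr, ripNl, ripNr) (ripC y x); lra.
have Gc : cvg G.
  apply: cauchy_cvg; apply/cauchyP => e e0.
  have eE : e = (complex.Re e)%:C%C by rewrite RRe_real// gtr0_real.
  have re0 : 0 < complex.Re e by rewrite -ltcR -eE.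
  pose d := (complex.Re e) ^+ 2 / 8.
  have d0 : 0 < d by rewrite divr_gt0// exprn_gt0.
  have [x Lx] := Ln0 d d0; exists x, d => // y Ly.
  rewrite -ball_normE /ball_/= -rnormE eE ltcR -(ltr_pXn2r (n := 2))// ?nnegrE ?rnorm_ge0 ?ltW//.
  by apply: le_lt_trans (par _ _ _ Lx Ly) _; move: d0; rewrite /d; lra.
pose z := lim G; exists z => h; apply/eqP.
(* First variation at [z] in the direction [h]. The slack [e] accounts for working with an almost
   minimizer [x] close to [z]. *)
have main t (e : R) : 0 < e ->
    0 <= 2 * t * (rip h z - phi h) + t ^+ 2 * rnorm h ^+ 2 + e * (1 + 2 * `|t| * rnorm h).
  move=> e0; have eC : 0 < e%:C%C :> R[i] by rewrite ltcR.
  have zG : G [set x | rnorm (z - x) < e].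
    have hz : G [set x | `|z - x| < e%:C%C] := @cvgr_dist_lt _ H _ G GF id z Gc _ eC.
    apply: filterS hz => x /=.
    by rewrite -rnormE ltcR.
  have Le : G (L e) by exists e.
  have [x [/= xz Lx]] := filter_ex (filterI zG Le).
  have := mF (x + t%:C%C *: h); move: Lx; rewrite /L /F /= phiD phiZ -!rip_norm.
  rewrite !(ripDl, ripDr, ripZl, ripZr) (ripC x h).
  have := rip_CauchySchwarz h (z - x); rewrite ripDr ripNr.
  have /(ler_wpM2l (rnorm_ge0 h)) := ltW xz.
  have : t * (rip h z - rip h x) >= - (`|t| * `|rip h z - rip h x|).
    by rewrite -normrM lerNl -normrN ler_norm.
  have : 0 <= `|t| by [].
  move: (`|t|) (`|rip h z - rip h x|) => u v u0 h1 h2 h3.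
  have := ler_wpM2l u0 (le_trans h3 h2); lra.
have main0 t : 0 <= 2 * t * (rip h z - phi h) + t ^+ 2 * rnorm h ^+ 2.
  rewrite leNgt; apply/negP => lt0.
  have c0 : 0 < 1 + 2 * `|t| * rnorm h by rewrite ltr_pwDl// !mulr_ge0// rnorm_ge0.
  pose X := 2 * t * (rip h z - phi h) + t ^+ 2 * rnorm h ^+ 2.
  (* This [e] makes the error term exactly half of [- X], contradicting [X < 0]. *)
  have := main t (- X / 2 / (1 + 2 * `|t| * rnorm h)).
  rewrite divfK ?gt_eqF// -/X => /(_ _) hX.
  by have : 0 < - X / 2 / (1 + 2 * `|t| * rnorm h); [rewrite !divr_gt0// oppr_gt0|move=> /hX; rewrite /X; lra].
rewrite eq_sym -subr_eq0 -sqrf_eq0 eq_le sqr_ge0 andbT.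
(* Taking [b + 1] instead of [b = |h| ^ 2] in the denominator covers [h = 0] and still gives a
   negative multiple of [a ^ 2]. *)
have b0 := sqr_ge0 (rnorm h); have := main0 (- (rip h z - phi h) / (rnorm h ^+ 2 + 1)).
move: (rip h z - phi h) (rnorm h ^+ 2) b0 => a b b0.
rewrite (_ : _ + _ = a ^+ 2 * - ((b + 2) / (b + 1) ^+ 2)); last by field; lra.
rewrite mulrN oppr_ge0 pmulr_lle0// divr_gt0 ?exprn_gt0//; lra.
Qed.

(** The scalars [1] and [i] recover the real and imaginary parts. *)
Lemma ip_rip x y x' y' : (forall c : R[i], rip (c *: x) y = rip (c *: x') y') ->
  ip x y = ip x' y'.
Proof.
move=> h; have := h 1; have := h 'i%C; rewrite !scale1r /rip !ipZl.
case: (ip x y) (ip x' y') => [a b] [c d] /=.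
by rewrite !mul0r !mul1r !sub0r => /oppr_inj-> ->.
Qed.

(** Riesz representation is applied to real parts only; [ip_rip] restores the complex identity.
    Boundedness follows from [|S y| ^ 2 = rip (T (S y)) y]. *)
Lemma adjoint_exists T : exists S, forall x y, ip (T x) y = ip x (S y).
Proof.
have [M M0 TM] := op_bounded T.
have ex y : exists z, forall x, rip (T x) y = rip x z.
  apply: (@real_riesz (fun x => rip (T x) y) (M * rnorm y)).
  - by move=> u v; rewrite op_D ripDl.
  - by move=> t u; rewrite op_Z ripZl.
  move=> x; apply: le_trans (rip_CauchySchwarz _ _) _.
  by rewrite mulrAC ler_wpM2r ?rnorm_ge0.
pose S y := sval (cid (ex y)).
have SP x y : ip (T x) y = ip x (S y).
  by apply: ip_rip => c; rewrite -op_Z /S; case: cid.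
have SPr x y : rip (T x) y = rip x (S y) by rewrite /rip SP.
have Sb : `[< bounded_linear S >].
  apply: (@bounded_linearP _ _ _ M) => [a y z|y].
    apply: rip_inj => x; rewrite /rip -SP; congr complex.Re.
    by rewrite !ipDr !ipZr !SP.
  have := SPr (S y) y; rewrite rip_norm => e.
  have := rip_CauchySchwarz (T (S y)) y; rewrite e ger0_norm ?sqr_ge0// expr2 => h.
  have := le_trans h (ler_wpM2r (rnorm_ge0 y) (TM _)).
  rewrite mulrAC; have [->|Sy] := eqVneq (rnorm (S y)) 0.
    by rewrite mulr_ge0// rnorm_ge0.
  by rewrite ler_pM2r// lt_def Sy rnorm_ge0.
by exists (BoundedOp Sb) => x y; rewrite SP.
Qed.

Lemma adjointP T x y : ip (T x) y = ip x (adjoint ip T y).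
Proof.
have [S TS] := adjoint_exists T.
by rewrite /adjoint; case: xgetP => [S' -> /= h|/(_ S)]; [exact: h|case].
Qed.

Lemma adjoint_unique T S : (forall x y, ip (T x) y = ip x (S y)) -> adjoint ip T = S.
Proof.
by move=> TS; apply: op_ext => y; apply: rip_inj => x; rewrite /rip -adjointP TS.
Qed.

Lemma adjointD T S : adjoint ip (T + S) = adjoint ip T + adjoint ip S.
Proof. by apply: adjoint_unique => x y; rewrite -[(T + S) x]/(T x + S x) ipDl (adjointP T) (adjointP S) -ipDr. Qed.

Lemma adjointZ (c : R) T : adjoint ip (c *: T) = c *: adjoint ip T.
Proof.
by apply: adjoint_unique => x y; rewrite -[(c *: T) x]/(c%:C%C *: T x) ipZl adjointP -[c%:C%C]conjc_real -ipZr.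
Qed.

Lemma adjointM T S : adjoint ip (T * S) = adjoint ip S * adjoint ip T.
Proof. apply: adjoint_unique => x y.
by rewrite -[(T * S) x]/(T (S x)) (adjointP T) (adjointP S). Qed.

Lemma adjointK T : adjoint ip (adjoint ip T) = T.
Proof.
by apply: adjoint_unique => x y; rewrite ipC -adjointP -ipC.
Qed.

Lemma opnorm_adjoint T : `|adjoint ip T| <= `|T|.
Proof.
apply: opnorm_le => y y1; have := rip_CauchySchwarz (T (adjoint ip T y)) y.
rewrite {1}/rip adjointP -/(rip _ _) rip_norm ger0_norm ?sqr_ge0// expr2 => h.
have := le_trans h (ler_wpM2r (rnorm_ge0 y) (ler_opnorm _ _)).
rewrite mulrAC; set a := rnorm (adjoint _ _ _); have [->|a0] := eqVneq a 0.
  by rewrite opnorm_ge0.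
rewrite ler_pM2r ?lt_def ?a0 ?rnorm_ge0// => /le_trans; apply.
by rewrite ler_piMr ?opnorm_ge0.
Qed.

End Adjoint.

(** * Square roots and spectral projections in the operator algebra *)

Section OperatorAlgebra.
Context {R : realType} {H : completeNormedModType R[i]}.
Local Notation A := (bounded_op H).
Implicit Types (a b c x : A).

Lemma opnormM a b : `|a * b| <= `|a| * `|b|.
Proof.
apply: opnorm_le => u u1; apply: le_trans (ler_opnorm a (b u)) _.
rewrite ler_wpM2l ?opnorm_ge0//; apply: le_trans (ler_opnorm b u) _.
by rewrite ler_piMr ?opnorm_ge0.
Qed.

Lemma opnorm1 : `|1 : A| <= 1.
Proof. by apply: opnorm_le => u. Qed.

Lemma op_scalerAl (t : R) a b : t *: (a * b) = (t *: a) * b.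
Proof. exact: op_ext. Qed.

Lemma op_scalerAr (t : R) a b : t *: (a * b) = a * (t *: b).
Proof. by apply: op_ext => u /=; rewrite op_Z. Qed.

Lemma op_mul_linearl b : linear (fun a : A => a * b).
Proof. by move=> t x y; rewrite mulrDl op_scalerAl. Qed.

Lemma op_mul_linearr a : linear (fun b : A => a * b).
Proof. by move=> t x y; rewrite mulrDr op_scalerAr. Qed.

Section Calculus.
Context {V : normedModType R}.
Implicit Types (f g : V -> A).

Lemma analytic_atM f g z :
  analytic_at f z -> analytic_at g z -> analytic_at (fun y => f y * g y) z.
Proof.
apply: (@analytic_at_bilinear _ _ _ _ _ (fun a b : A => a * b) 1).
- exact: op_mul_linearl.
- exact: op_mul_linearr.
- by move=> u v; rewrite mul1r opnormM.
Qed.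

Lemma differentialM f g z h : analytic_at f z -> analytic_at g z ->
  'd (fun y => f y * g y) z h = f z * 'd g z h + 'd f z h * g z.
Proof.
apply: (@differential_bilinear _ _ _ _ _ (fun a b : A => a * b) 1).
- exact: op_mul_linearl.
- exact: op_mul_linearr.
- by move=> u v; rewrite mul1r opnormM.
Qed.

Let mul1D (a b c d : A) : a = 1 -> b = 1 -> a * c + d * b = c + d.
Proof. by move=> -> ->; rewrite mul1r mulr1. Qed.

Lemma differentialM1 f g z h : analytic_at f z -> analytic_at g z ->
  f z = 1 -> g z = 1 -> 'd (fun y => f y * g y) z h = 'd g z h + 'd f z h.
Proof. by move=> fa ga f1 g1; exact: etrans (differentialM h fa ga) (mul1D _ _ f1 g1). Qed.

Let conjD (a b c d d0 d1 d2 x : A) : a = 1 -> b = 1 -> d0 = 0 ->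
  d1 = a * d0 + d * x -> d2 = a * x * c + d1 * b -> d2 = d * x + x * c.
Proof. by move=> -> -> -> -> ->; rewrite mulr0 add0r mulr1 mul1r addrC. Qed.

Lemma differential_conj f g z h x : analytic_at f z -> analytic_at g z ->
  f z = 1 -> g z = 1 -> 'd (fun y => f y * x * g y) z h = 'd f z h * x + x * 'd g z h.
Proof.
move=> fa ga f1 g1; have xa : analytic_at (cst x) z := analytic_at_cst x z.
have fxa := analytic_atM fa xa.
have x0 : 'd (cst x) z h = 0 by rewrite diff_cst.
exact: conjD f1 g1 x0 (differentialM h fa xa) (differentialM h fxa ga).
Qed.

(** Differentiate [f y * g y = 1]. *)
Lemma differential_inverse f g z h : analytic_at f z -> analytic_at g z ->
  f z = 1 -> g z = 1 -> (\forall y \near z, f y * g y = 1) -> 'd g z h = - 'd f z h.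
Proof.
move=> fa ga f1 g1 fg.
have E1 := differentialM1 h fa ga f1 g1.
have E2 := near_eq_differential (g := cst (1 : A)) h fg (analytic_atM fa ga).
have E3 : 'd (cst (1 : A)) z h = 0 by rewrite diff_cst.
have /eqP := etrans (esym E1) (etrans E2 E3).
by rewrite addr_eq0 => /eqP.
Qed.

Lemma analytic_at_bounded_linear (W : normedModType R) (L : A -> W) (K : R) f z :
  linear L -> (forall a, `|L a| <= K * `|a|) ->
  analytic_at f z -> analytic_at (fun y => L (f y)) z.
Proof.
move=> Ll LK fa.
pose L' : {linear A -> W} := HB.pack L (GRing.isLinear.Build R A W _ _ Ll).
apply: (@analytic_at_comp _ _ _ _ L' f) => //; apply: analytic_at_linear.
exact: (@linear_le_continuous R A W L' K LK).
Qed.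

Lemma analytic_atZ (t : R) f z : analytic_at f z -> analytic_at (fun y => t *: f y) z.
Proof.
apply: (@analytic_at_bounded_linear _ (fun a => t *: a) `|t|).
  by move=> u x y; rewrite scalerDr !scalerA mulrC.
by move=> a; rewrite normrZ.
Qed.

Lemma analytic_atN f z : analytic_at f z -> analytic_at (fun y => - f y) z.
Proof.
move=> fa; have := analytic_atZ (-1) fa.
by apply: analytic_at_near; near=> y; rewrite scaleN1r.
Unshelve. all: by end_near. Qed.

Lemma analytic_atB f g z :
  analytic_at f z -> analytic_at g z -> analytic_at (fun y => f y - g y) z.
Proof. by move=> fa ga; apply: analytic_atD => //; exact: analytic_atN. Qed.

End Calculus.

Lemma differential_square x h : 'd (fun y : A => y * y) x h = x * h + h * x.
Proof.
have ida := @analytic_at_id R A x.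
have idd : 'd (@id A) x h = h by have := @is_diff_id R A x => -[_ ->].
exact: etrans (differentialM h ida ida) (congr2 (fun a b => x * a + b * x) idd idd).
Qed.

Section Neumann.

(** The coefficients of the Neumann series: on [k] copies of [h] the value is the [k]-th power of
    [h]. *)
Definition seqprod (s : seq A) : A := foldr (fun u v => u * v) 1 s.

Lemma multilin_seqprod : multilin seqprod.
Proof.
move=> s p t u v; elim: s => [|w s IH] /=; first by rewrite mulrDl op_scalerAl.
by rewrite IH mulrDr op_scalerAr.
Qed.

Lemma seqprod_bound s : `|seqprod s| <= 1 * 1 ^+ size s * normprod s.
Proof.
rewrite expr1n !mul1r; elim: s => [|u s IH]; first by rewrite normprod_nil opnorm1.
by apply: le_trans (opnormM _ _) _; rewrite normprod_cons ler_wpM2l.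
Qed.

(** Junk away from [1], where the Neumann series diverges; the same restriction
    applies to [osqrt] and [isq] below. *)
Definition oinv a : A := series_sum seqprod (1 - a).

Lemma neumann_expansion x : has_expansion (fun y => series_sum seqprod (y - x)) x
  seqprod (2 * 1) (2 * 1).
Proof.
by apply: series_sum_expansion => //; [exact: multilin_seqprod|exact: seqprod_bound].
Qed.

Lemma oinv1 : oinv 1 = 1.
Proof. by rewrite /oinv; have := expansion_nil (neumann_expansion 1). Qed.

Lemma oinv_analytic : analytic_at oinv 1.
Proof.
have n0 : analytic_at (series_sum seqprod) (1 - 1 : A).
  rewrite subrr; have h : analytic_at (fun y => series_sum seqprod (y - 0)) (0 : A).
    by do 3 eexists; exact: neumann_expansion.
  by apply: analytic_at_near h; near=> y; rewrite subr0.
apply: (@analytic_at_comp _ _ _ _ (series_sum seqprod) (fun a => 1 - a)) => //.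
by apply: analytic_atB; [exact: analytic_at_cst|exact: analytic_at_id].
Unshelve. all: by end_near. Qed.

Lemma seqprod_nseqSr k h : seqprod (nseq k h) * h = seqprod (nseq k.+1 h).
Proof. by elim: k => [|k IH] /=; [rewrite mul1r mulr1|rewrite -mulrA IH]. Qed.

Lemma near_oinv : \forall a \near (1 : A), a * oinv a = 1 /\ oinv a * a = 1.
Proof.
apply/near_ball; exists 4 => // h h4.
rewrite /oinv opprD addrA subrr add0r.
pose k := - h; have k4 : 4 * `|k| < 1 by rewrite normrN.
have k0 : 0 <= `|k| by [].
have -> : 1 + h = 1 - k by rewrite opprK.
rewrite -/k; pose S n := \sum_(j < n) seqprod (nseq j k).
have Sl n : (1 - k) * S n = 1 - seqprod (nseq n k).
  rewrite /S; elim: n => [|n IH]; first by rewrite big_ord0 mulr0 subrr.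
  by rewrite big_ord_recr/= mulrDr IH mulrBl mul1r addrA subrK.
have Sr n : S n * (1 - k) = 1 - seqprod (nseq n k).
  rewrite /S; elim: n => [|n IH]; first by rewrite big_ord0 mul0r subrr.
  by rewrite big_ord_recr/= mulrDl IH mulrBr mulr1 addrA subrK seqprod_nseqSr.
have [_ _ _ _ tail] := neumann_expansion 0.
have {}tail n : `|series_sum seqprod k - S n| <= 2 * (1 / 2) ^+ n.
  have := tail n k; rewrite add0r subr0 mulr1 => /(_ _)/le_trans; apply; first by lra.
  by rewrite ler_wpM2l//; apply: lerXn2r; rewrite ?nnegrE; lra.
have kn n : `|seqprod (nseq n k)| <= (1 / 2) ^+ n.
  apply: le_trans (seqprod_bound _) _; rewrite normprod_nseq expr1n !mul1r.
  by apply: lerXn2r; rewrite ?nnegrE; lra.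
have N1 : `|1 - k| <= 2.
  by apply: le_trans (ler_normB _ _) _; have := opnorm1; lra.
split; apply/eqP; rewrite -subr_eq0 -normr_le0;
    apply: (@le_geometric_limit _ _ _ (2 * 2 + 1) 0) => n _; rewrite add0r.
  rewrite [X in `|X|](_ : _ = (1 - k) * (series_sum seqprod k - S n) - seqprod (nseq n k)).
    rewrite [leRHS]mulrDl [X in _ <= _ + X]mul1r; apply: le_trans (ler_normB _ _) (lerD _ (kn n)).
    apply: le_trans (opnormM _ _) _; rewrite -mulrA.
    by apply: ler_pM.
  by rewrite mulrBr Sl opprB addrA addrAC addrK.
rewrite [X in `|X|](_ : _ = (series_sum seqprod k - S n) * (1 - k) - seqprod (nseq n k)).
  rewrite [leRHS]mulrDl [X in _ <= _ + X]mul1r; apply: le_trans (ler_normB _ _) (lerD _ (kn n)).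
  apply: le_trans (opnormM _ _) _; rewrite [leLHS]mulrC -mulrA.
  by apply: ler_pM.
by rewrite mulrBl Sr opprB addrA addrAC addrK.
Qed.

End Neumann.

Section SquareRoot.

(** Chosen so that [(1 + e) ^ 2 = 1 + 2 * sq e] and the differential at [0] is the identity, as
    [analytic_inverse] requires. *)
Let sq (e : A) : A := e + (2^-1 : R) *: (e * e).

Let sq_analytic : analytic_at sq 0.
Proof.
apply: analytic_atD; first exact: analytic_at_id.
by apply/analytic_atZ/analytic_atM; exact: analytic_at_id.
Qed.

Let sq_differential h : 'd sq 0 h = h.
Proof.
have ida := @analytic_at_id R A 0.
have E : sq = (fun e => (1 + (2^-1 : R) *: e) * e).
  by apply/funext => e; rewrite /sq mulrDl mul1r op_scalerAl.
have fa : analytic_at (fun e : A => 1 + (2^-1 : R) *: e) 0.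
  by apply: analytic_atD; [exact: analytic_at_cst|exact: analytic_atZ].
rewrite E (differentialM h fa ida) scaler0 addr0 mul1r mulr0 addr0.
by have := @is_diff_id R A 0 => -[_ ->].
Qed.

Lemma osqrt_exists : exists s : A -> A, [/\ analytic_at s 1, s 1 = 1 &
  \forall a \near (1 : A), s a * s a = a].
Proof.
have [g [ga g0 sg _]] := analytic_inverse sq_analytic sq_differential.
have sq0 : sq 0 = 0 by rewrite /sq mulr0 scaler0 addr0.
rewrite sq0 in ga g0 sg.
pose m a := (2^-1 : R) *: (a - 1).
have ma : analytic_at m 1.
  by apply/analytic_atZ/analytic_atB; [exact: analytic_at_id|exact: analytic_at_cst].
have m1 : m 1 = 0 by rewrite /m subrr scaler0.
exists (fun a => 1 + g (m a)); split.
- apply: analytic_atD; first exact: analytic_at_cst.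
  by apply: (@analytic_at_comp _ _ _ _ g m) => //; rewrite m1.
- by rewrite m1 g0 addr0.
have : \forall a \near (1 : A), sq (g (m a)) = m a.
  by apply: (analytic_at_nbhs (P := fun y => sq (g y) = y) ma); rewrite m1.
apply: filterS => a; set e := g _; rewrite /sq /m => h.
have {}h : e + e + e * e = a - 1.
  have := congr1 (fun z => z + z) h; rewrite /= -scalerDl.
  rewrite (_ : 2^-1 + 2^-1 = 1 :> R) ?scale1r; last by lra.
  rewrite addrACA -scalerDl (_ : 2^-1 + 2^-1 = 1 :> R) ?scale1r//; last by lra.
rewrite mulrDl mul1r mulrDr mulr1 -[RHS](subrK 1) -h.
by rewrite -!addrA addrC -!addrA.
Qed.

Definition osqrt : A -> A := sval (cid osqrt_exists).

Definition isq a := oinv (osqrt a).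

Lemma isq1 : isq 1 = 1.
Proof. by rewrite /isq /osqrt; case: cid => s [/= _ -> _]; exact: oinv1. Qed.

Lemma isq_analytic : analytic_at isq 1.
Proof.
rewrite /isq /osqrt; case: cid => s [/= sa s1 _].
by apply: (@analytic_at_comp _ _ _ _ oinv s) => //; rewrite s1; exact: oinv_analytic.
Qed.

Lemma near_isq : \forall a \near (1 : A), isq a * isq a * a = 1 /\ a * (isq a * isq a) = 1.
Proof.
rewrite /isq /osqrt; case: cid => s [/= sa s1 ss].
have inv : \forall a \near (1 : A), s a * oinv (s a) = 1 /\ oinv (s a) * s a = 1.
  apply: (analytic_at_nbhs (P := fun b => b * oinv b = 1 /\ oinv b * b = 1) sa).
  by rewrite s1; exact: near_oinv.
near=> a; have sa2 : s a * s a = a by near: a.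
have [sg gs] : s a * oinv (s a) = 1 /\ oinv (s a) * s a = 1 by near: a.
move: sa2 sg gs; move: (s a) (oinv (s a)) => t g <- tg gt; split.
  by rewrite -mulrA (mulrA g t t) gt mul1r.
by rewrite -mulrA (mulrA t g g) tg mul1r.
Unshelve. all: by end_near. Qed.

End SquareRoot.

Definition half x : A := 2^-1 *: x.

Lemma halfD x : half x + half x = x.
Proof. by rewrite /half -scalerDl (_ : 2^-1 + 2^-1 = 1 :> R) ?scale1r//; lra. Qed.

Lemma halfMl a b : half a * b = half (a * b).
Proof. by rewrite /half op_scalerAl. Qed.

Lemma halfMr a b : a * half b = half (a * b).
Proof. by rewrite /half op_scalerAr. Qed.

Lemma halfDr a b : half (a + b) = half a + half b.
Proof. by rewrite /half scalerDr. Qed.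

Lemma halfN a : half (- a) = - half a.
Proof. by rewrite /half scalerN. Qed.

Section Involution.
Variables (sh : A -> A) (K : R).
Hypotheses (shD : forall a b, sh (a + b) = sh a + sh b)
  (shZ : forall (t : R) a, sh (t *: a) = t *: sh a)
  (shM : forall a b, sh (a * b) = sh b * sh a)
  (shK : forall a, sh (sh a) = a)
  (sh_bounded : forall a, `|sh a| <= K * `|a|).

Lemma shN a : sh (- a) = - sh a.
Proof. by rewrite -scaleN1r shZ scaleN1r. Qed.

Lemma shB a b : sh (a - b) = sh a - sh b.
Proof. by rewrite shD shN. Qed.

Lemma sh1 : sh 1 = 1.
Proof. by rewrite -[LHS]mul1r -{1}(shK 1) -shM mul1r shK. Qed.

Lemma sh_linear : linear sh.
Proof. by move=> t a b; rewrite shD shZ. Qed.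

Lemma differential_sh x h : 'd sh x h = sh h.
Proof.
pose L : {linear A -> A} := HB.pack sh (GRing.isLinear.Build R A A _ _ sh_linear).
have Lc : continuous L := linear_le_continuous (L := L) sh_bounded.
have E : 'd L x = L :> (A -> A) by exact: diff_lin.
have E2 := congr1 (fun f : A -> A => f h) E.
exact: E2.
Qed.

Lemma analytic_at_sh (V : normedModType R) (f : V -> A) z :
  analytic_at f z -> analytic_at (fun y => sh (f y)) z.
Proof. exact: analytic_at_bounded_linear sh_linear sh_bounded. Qed.

(** Near [1] left and right multiplications are close to the identity, so the
    Sylvester operator [y |-> g y + y k] is injective. *)
Lemma sylvester_inj (g k y : A) : `|1 - g| <= 1 / 2 -> `|1 - k| <= 1 / 2 ->
  g * y + y * k = 0 -> y = 0.
Proof.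
move=> g2 k2 gk; apply/eqP; rewrite -normr_le0.
have : y + y = (1 - g) * y + y * (1 - k).
  by rewrite mulrBl mulrBr mul1r mulr1 addrACA -opprD gk subr0.
move=> yy; have e := congr1 Num.norm yy.
have : `|y + y| = 2 * `|y|.
  by rewrite -[y in LHS]scale1r -scalerDl normrZ ger0_norm//; lra.
rewrite e => h; have := ler_normD ((1 - g) * y) (y * (1 - k)); rewrite h.
have := opnormM (1 - g) y; have := opnormM y (1 - k).
have := ler_wpM2r (normr_ge0 y) g2; have := ler_wpM2l (normr_ge0 y) k2; lra.
Qed.

(** Both norm bounds feed [sylvester_inj]. The one on [sh (isq a)] is separate because [sh] is only
    assumed bounded by [K]. *)
Definition isq_good a := [/\ isq a * isq a * a = 1, a * (isq a * isq a) = 1,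
  `|1 - isq a| <= 1 / 2 & `|1 - sh (isq a)| <= 1 / 2].

Lemma near_isq_good : \forall a \near (1 : A), isq_good a.
Proof.
have small (f : A -> A) : analytic_at f 1 -> f 1 = 1 ->
    \forall a \near (1 : A), `|1 - f a| <= 1 / 2.
  move=> fa f1; apply: (analytic_at_nbhs (P := fun b => `|1 - b| <= 1 / 2) fa).
  rewrite f1; apply/near_ball; exists 2 => // h h2.
  by rewrite opprD addrA subrr add0r normrN; lra.
have h1 := small _ isq_analytic isq1.
have h2 := small _ (analytic_at_sh isq_analytic).
rewrite isq1 sh1 in h2; have {}h2 := h2 erefl.
have h3 := near_isq.
near=> a.
have [l r] : isq a * isq a * a = 1 /\ a * (isq a * isq a) = 1 by near: a.
by split=> //; near: a.
Unshelve. all: by end_near. Qed.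

(** With [g = isq a], the square [g * g] inverts [a] and so commutes with [c]. The commutator [y] of
    [c] and [g] then satisfies [g * y + y * g = 0]. *)
Lemma isq_comm a c : isq_good a -> GRing.comm c a -> GRing.comm c (isq a).
Proof.
move=> [l r s _] ca; set g := isq a in l r s *.
have cgg : c * (g * g) = g * g * c.
  by rewrite -[LHS]mul1r -[X in X * _ = _]l -!mulrA (mulrA a c) -ca -!mulrA [a * _]r mulr1.
apply/eqP; rewrite -subr_eq0; apply/eqP; apply: (sylvester_inj s s).
by rewrite mulrBr mulrBl -!mulrA cgg -mulrA addrA subrK subrr.
Qed.

(** Here [g] and [sh g] are both square roots of the inverse of [a], and [y = sh g - g] satisfies
    [g * y + y * sh g = 0]. *)
Lemma isq_sh a : isq_good a -> sh a = a -> sh (isq a) = isq a.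
Proof.
move=> [l r s s'] sa; set g := isq a in l r s s' *.
have gg : sh g * sh g = g * g.
  have := congr1 sh l; rewrite shM shM sa sh1 => h.
  by rewrite -[LHS]mul1r -l -!mulrA [a * _]h mulr1.
apply/eqP; rewrite -subr_eq0; apply/eqP; apply: (sylvester_inj s s').
by rewrite mulrBr mulrBl gg addrA subrK subrr.
Qed.

(** [refl x = 2 x - 1] squares to [1] exactly when [x] is idempotent, and
    [proj x] is the spectral projection of [x] for the part of its spectrum near
    [1], obtained by normalizing [refl x] to square [1]. *)
Definition refl x := x + x - 1.
Definition proj x := half (1 + refl x * isq (refl x * refl x)).
Definition proj_good x := isq_good (refl x * refl x).

Lemma refl_idem x : x * x = x -> refl x * refl x = 1.
Proof.
move=> xx; rewrite /refl mulrBr mulr1 mulrBl mul1r mulrDl !mulrDr xx.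
by rewrite [x + x + (x + x)]addrC addrK opprB addrC subrK.
Qed.

Lemma half_reflK x : half (1 + refl x) = x.
Proof. by rewrite /refl addrC subrK halfDr halfD. Qed.

Lemma proj_fix x : x * x = x -> proj x = x.
Proof. by move=> xx; rewrite /proj refl_idem// isq1 mulr1 half_reflK. Qed.

Lemma analytic_at_refl (V : normedModType R) (f : V -> A) z :
  analytic_at f z -> analytic_at (fun y => refl (f y)) z.
Proof.
by move=> fa; apply: analytic_atB; [exact: analytic_atD|exact: analytic_at_cst].
Qed.

Lemma analytic_at_isq (V : normedModType R) (f : V -> A) z :
  analytic_at f z -> f z = 1 -> analytic_at (fun y => isq (f y)) z.
Proof.
move=> fa f1; apply: (@analytic_at_comp _ _ _ _ isq f) => //.
by rewrite f1; exact: isq_analytic.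
Qed.

Lemma near_isq_good_comp (V : normedModType R) (f : V -> A) z :
  analytic_at f z -> f z = 1 -> \forall y \near z, isq_good (f y).
Proof.
by move=> fa f1; apply: (analytic_at_nbhs fa); rewrite f1; exact: near_isq_good.
Qed.

Section ProjAt.
Variables (V : normedModType R) (f : V -> A) (z : V).
Hypotheses (fa : analytic_at f z) (ff : f z * f z = f z).

Let refl2 : analytic_at (fun y => refl (f y) * refl (f y)) z.
Proof. by apply: analytic_atM; exact: analytic_at_refl. Qed.

Lemma analytic_at_proj : analytic_at (fun y => proj (f y)) z.
Proof.
apply/analytic_atZ/analytic_atD; first exact: analytic_at_cst.
apply: analytic_atM; first exact: analytic_at_refl.
by apply: (analytic_at_isq refl2); exact: refl_idem.
Qed.

Lemma near_proj_good : \forall y \near z, proj_good (f y).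
Proof. by apply: (near_isq_good_comp refl2); exact: refl_idem. Qed.

End ProjAt.

Lemma comm_refl x c : GRing.comm c x -> GRing.comm c (refl x).
Proof.
by move=> cx; apply: GRing.commrB; [exact: GRing.commrD|exact: GRing.commr1].
Qed.

Lemma proj_comm x c : proj_good x -> GRing.comm c x -> GRing.comm c (proj x).
Proof.
move=> gx cx; have cr := comm_refl cx.
rewrite /GRing.comm /proj halfMr halfMl; congr half.
apply: GRing.commrD; first exact: GRing.commr1.
by apply: GRing.commrM => //; apply: isq_comm => //; exact: GRing.commrM.
Qed.

Lemma proj_idem x : proj_good x -> proj x * proj x = proj x.
Proof.
move=> gx; have [l _ _ _] := gx.
have cg : GRing.comm (refl x) (isq (refl x * refl x)).
  by apply: isq_comm => //; exact: GRing.commrM.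
rewrite /proj; set g := isq _ in l cg *; set w := refl x in l cg *.
have cgw : GRing.comm g (w * w) by apply: GRing.commrM; exact: GRing.commr_sym.
have ww : (w * g) * (w * g) = 1 by rewrite {1}cg -mulrA (mulrA w w) -cgw mulrA.
rewrite halfMl halfMr; congr half; rewrite mulrDl mul1r mulrDr mulr1 ww.
by rewrite [w * g + 1]addrC halfDr halfD.
Qed.

Lemma proj_sh x : proj_good x -> sh x = x -> sh (proj x) = proj x.
Proof.
move=> gx sx; have sr : sh (refl x) = refl x by rewrite /refl shB shD sx sh1.
rewrite /proj /half shZ shD shM sh1 isq_sh ?shM ?sr//; congr (_ *: (_ + _)).
by apply/esym; apply: isq_comm => //; exact: GRing.commrM.
Qed.

End Involution.
End OperatorAlgebra.

(** * Normal and selfadjoint projections *)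

Section KreinRetractions.
Context {R : realType} {H : completeNormedModType R[i]}.
Local Notation A := (bounded_op H).
Implicit Types (a b c x d e p q : A).

Variables (sh : A -> A) (K : R).
Hypotheses (shD : forall a b, sh (a + b) = sh a + sh b)
  (shZ : forall (t : R) a, sh (t *: a) = t *: sh a)
  (shM : forall a b, sh (a * b) = sh b * sh a)
  (shK : forall a, sh (sh a) = a)
  (sh_bounded : forall a, `|sh a| <= K * `|a|).

Definition normal_idem : set A := [set q | q * q = q /\ q * sh q = sh q * q].
Definition selfadjoint_idem : set A := [set e | e * e = e /\ sh e = e].

Lemma sh_half x : sh (half x) = half (sh x).
Proof. exact: shZ. Qed.

Lemma analytic_at_half (V : normedModType R) (f : V -> A) z :
  analytic_at f z -> analytic_at (fun y => half (f y)) z.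
Proof. exact: analytic_atZ. Qed.

Definition hermitian_part x := half (x + sh x).

Lemma sh_hermitian_part x : sh (hermitian_part x) = hermitian_part x.
Proof. by rewrite /hermitian_part sh_half shD shK addrC. Qed.

Lemma analytic_at_hermitian_part (V : normedModType R) (f : V -> A) z :
  analytic_at f z -> analytic_at (fun y => hermitian_part (f y)) z.
Proof.
move=> fa; apply/analytic_at_half/analytic_atD => //.
exact: (analytic_at_sh shD shZ sh_bounded fa).
Qed.

Lemma selfadjoint_retraction e : selfadjoint_idem e ->
  local_retraction selfadjoint_idem (fun x => proj (hermitian_part x)) e.
Proof.
move=> [ee se]; have ida := @analytic_at_id R A e.
have ha := analytic_at_hermitian_part ida.
have h_fix x : sh x = x -> hermitian_part x = x.
  by move=> sx; rewrite /hermitian_part sx halfDr halfD.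
have hee : hermitian_part e * hermitian_part e = hermitian_part e by rewrite h_fix.
split=> //.
- exact: analytic_at_proj ha hee.
- have := near_proj_good shD shZ shM shK sh_bounded ha hee.
  apply: filterS => x gx; split; first exact: (proj_idem gx).
  exact: (proj_sh shD shZ shM shK gx (sh_hermitian_part x)).
near=> x => -[xx sx].
by rewrite h_fix// proj_fix.
Unshelve. all: by end_near. Qed.

(** For skew-adjoint [d], [sgn d] is the skew-adjoint solution of [D^3 = D] that
    [d] determines by functional calculus; [supp d] is its square. *)
Definition supp d := proj (d * d).
(** The part [1 - supp d] fills the complement of the support, so that the result is close to [1]
    and [isq] applies. *)
Definition modulus2 d := d * d * supp d + (1 - supp d).
Definition sgn d := d * supp d * isq (modulus2 d).

(** All factors of [sgn d] commute with one another, so its square is [modulus2 d * supp d] times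
    the inverse of [modulus2 d]. *)
Lemma sgn_skew d : sh d = - d -> proj_good sh (d * d) -> isq_good sh (modulus2 d) ->
  [/\ supp d * supp d = supp d, sh (supp d) = supp d, sgn d * sgn d = supp d,
      supp d * sgn d = sgn d /\ sgn d * supp d = sgn d & sh (sgn d) = - sgn d].
Proof.
move=> sd gp gv; have pp := proj_idem gp; rewrite -/(supp d) in pp.
have sdd : sh (d * d) = d * d by rewrite shM sd mulrNN.
have sp := proj_sh shD shZ shM shK gp sdd; rewrite -/(supp d) in sp.
have dp : GRing.comm d (supp d) by apply: (proj_comm gp); exact: GRing.commrM.
have ddp : GRing.comm (d * d) (supp d) by apply/GRing.commr_sym/GRing.commrM; exact: GRing.commr_sym.
have cw c : GRing.comm c d -> GRing.comm c (supp d) -> GRing.comm c (modulus2 d).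
  move=> cd cp; apply: GRing.commrD.
    by apply: GRing.commrM => //; exact: GRing.commrM.
  by apply: GRing.commrB => //; exact: GRing.commr1.
have dv : GRing.comm d (isq (modulus2 d)) by apply: (isq_comm gv); exact: cw.
have pv : GRing.comm (supp d) (isq (modulus2 d)).
  by apply: (isq_comm gv); apply: cw => //; exact: GRing.commr_sym.
have sv : sh (isq (modulus2 d)) = isq (modulus2 d).
  apply: (isq_sh shM shK gv).
  by rewrite /modulus2 shD shM sdd sp -ddp (shB shD shZ) sp (sh1 shM shK).
have [vvw _ _ _] := gv.
have wp : modulus2 d * supp d = d * d * supp d.
  by rewrite /modulus2 mulrDl mulrBl mul1r pp subrr addr0 -mulrA pp.
have pD : supp d * sgn d = sgn d by rewrite /sgn !mulrA -dp -[d * _ * _]mulrA pp.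
have Dp : sgn d * supp d = sgn d by rewrite /sgn -mulrA -pv mulrA -[d * _ * _]mulrA pp.
split=> //.
  rewrite /sgn; set v := isq _ in dv pv sv vvw *; set u := d * supp d.
  have uv : GRing.comm u v by apply/GRing.commr_sym/GRing.commrM; exact: GRing.commr_sym.
  have uu : u * u = modulus2 d * supp d.
    by rewrite wp /u mulrA -(mulrA d) -dp mulrA -mulrA pp.
  have uuv : GRing.comm (u * u) (v * v).
    by apply: GRing.commrM; apply/GRing.commr_sym/GRing.commrM; exact: GRing.commr_sym.
  by rewrite mulrA -(mulrA u v u) -uv mulrA -mulrA uuv uu mulrA vvw mul1r.
rewrite /sgn !shM sv sp sd !mulrN; congr (- _).
by rewrite -[RHS]mulrA pv [RHS]mulrA dv -[RHS]mulrA dp.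
Qed.

Lemma sgn_fix d : d * d * d = d -> d * d * (d * d) = d * d -> sgn d = d /\ supp d = d * d.
Proof.
move=> ddd dd4; have sd : supp d = d * d by rewrite /supp proj_fix.
have w1 : modulus2 d = 1 by rewrite /modulus2 sd dd4 addrC subrK.
by rewrite /sgn w1 isq1 mulr1 sd mulrA.
Qed.

(** The elements [half (p + d)] and [half (p - d)] are orthogonal idempotents exchanged by [sh], and
    both annihilate [e] on either side. *)
Lemma normal_idem_of e p d : e * e = e -> sh e = e -> p * p = p -> sh p = p ->
  d * d = p -> p * d = d -> d * p = d -> sh d = - d -> e * p = 0 -> p * e = 0 ->
  normal_idem (e + half (p + d)) /\
  (e + half (p + d)) * sh (e + half (p + d)) = e.
Proof.
move=> ee se pp sp dd pd dp sd ep pe.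
have ed : e * d = 0 by rewrite -pd mulrA ep mul0r.
have de : d * e = 0 by rewrite -dp -mulrA pe mulr0.
have eh : e * half (p + d) = 0 by rewrite halfMr mulrDr ep ed addr0 /half scaler0.
have he : half (p + d) * e = 0 by rewrite halfMl mulrDl pe de addr0 /half scaler0.
have eh' : e * half (p - d) = 0 by rewrite halfMr mulrBr ep ed subr0 /half scaler0.
have he' : half (p - d) * e = 0 by rewrite halfMl mulrBl pe de subr0 /half scaler0.
have hh : half (p + d) * half (p + d) = half (p + d).
  by rewrite halfMl halfMr mulrDl !mulrDr pp dd pd dp [d + p]addrC (halfDr (p + d)) halfD.
have hh' : half (p + d) * half (p - d) = 0.
  by rewrite halfMl halfMr mulrDl !mulrBr pp dd pd dp addrA subrK subrr /half !scaler0.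
have h'h : half (p - d) * half (p + d) = 0.
  by rewrite halfMl halfMr mulrBl !mulrDr pp dd pd dp [d + p]addrC subrr /half !scaler0.
have sr : sh (e + half (p + d)) = e + half (p - d) by rewrite shD sh_half shD se sp sd.
have rr' : (e + half (p + d)) * (e + half (p - d)) = e.
  by rewrite mulrDl !mulrDr ee eh' he hh' !addr0.
rewrite /normal_idem /= sr; split=> //; split.
  by rewrite mulrDl !mulrDr ee eh he hh addr0 add0r.
by rewrite rr' mulrDl !mulrDr ee eh he' h'h !addr0.
Qed.

Lemma orthogonal_pair (n m : A) : n * n = n -> m * m = m -> n * m = 0 -> m * n = 0 ->
  [/\ (n - m) * (n - m) = n + m, (n + m) * (n - m) = n - m &
      (n + m) * (n + m) = n + m].
Proof.
move=> nn mm nm mn; split.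
- by rewrite mulrBl !mulrBr nn nm mn mm subr0 sub0r opprK.
- by rewrite mulrDl !mulrBr nn nm mn mm subr0 sub0r.
- by rewrite mulrDl !mulrDr nn nm mn mm addr0 add0r.
Qed.

Section NormalData.
Variable q : A.
Hypothesis qn : normal_idem q.
Let e := q * sh q.
Let n := q - e.
Let n' := sh q - e.

(** [q = e + n] and [sh q = e + n'] with three pairwise orthogonal idempotents. *)
Lemma normal_data : [/\ sh q * sh q = sh q, e * e = e, sh e = e & n * n = n /\ n' * n' = n'] /\
  [/\ n * n' = 0, n' * n = 0, e * n = 0 /\ n * e = 0 & e * n' = 0 /\ n' * e = 0].
Proof.
have [qq qs] := qn.
have ss : sh q * sh q = sh q by rewrite -shM qq.
have eq : e * q = e by rewrite /e -mulrA -qs mulrA qq.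
have qe : q * e = e by rewrite /e mulrA qq.
have es : e * sh q = e by rewrite /e -mulrA ss.
have se' : sh q * e = e by rewrite /e mulrA -qs -mulrA ss.
have ee : e * e = e by rewrite {2}/e mulrA eq es.
have se : sh e = e by rewrite /e shM shK.
split; split=> //.
- by rewrite /n /n' !mulrBl !mulrBr qq qe eq ee ss es se' subrr !subr0.
- by rewrite /n /n' mulrBl !mulrBr -/e qe es ee !subrr.
- by rewrite /n /n' mulrBl !mulrBr -qs -/e eq se' ee !subrr.
- by rewrite /n mulrBl mulrBr eq qe ee subrr.
- by rewrite /n' mulrBl mulrBr es se' ee subrr.
Qed.

Let d := q - sh q.
Let p := n + n'.

Lemma normal_skew : [/\ d * d = p, d * d * d = d, p * p = p & sh d = - d].
Proof.
have [[ss ee se [nn nn']] [nm mn _ _]] := normal_data.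
have dE : d = n - n' by rewrite /d /n /n' opprB addrA subrK.
have [dd pd pp] := orthogonal_pair nn nn' nm mn.
rewrite -dE -/p in dd pd pp.
split=> //; first by rewrite dd.
by rewrite /d (shB shD shZ) shK opprB.
Qed.

Lemma normal_supp : supp d = p /\ sgn d = d.
Proof.
have [dd ddd pp _] := normal_skew.
have [sg su] := sgn_fix ddd (etrans (mulrA _ _ _) (congr1 (fun a => a * d) ddd)).
by rewrite su dd.
Qed.

(** The hermitian part is [e + half p], and compressing to [1 - p] removes [half p] and keeps
    [e]. *)
Lemma normal_compression : (1 - p) * hermitian_part q * (1 - p) = e.
Proof.
have [[ss ee se [nn nn']] [nm mn [en ne] [em me]]] := normal_data.
have -> : hermitian_part q = e + half p.
  rewrite /hermitian_part /p -[X in X + half _](halfD e) -!halfDr; congr half.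
  by rewrite /n /n' (addrACA q) -opprD [RHS]addrC subrK.
have pp : p * p = p by have [] := normal_skew.
have pe : p * e = 0 by rewrite /p mulrDl ne me addr0.
have ep : e * p = 0 by rewrite /p mulrDr en em addr0.
rewrite mulrBl mul1r (mulrDr p) halfMr pe pp add0r addrK.
by rewrite mulrBr mulr1 ep subr0.
Qed.

Lemma normal_decomp : e * (1 - p) + half (p + d) = q.
Proof.
have [_ [_ _ [en ne] [em me]]] := normal_data.
have ep : e * p = 0 by rewrite /p mulrDr en em addr0.
have dE : d = n - n' by rewrite /d /n /n' opprB addrA subrK.
have -> : p + d = n + n by rewrite dE /p addrACA subrr addr0.
rewrite mulrBr mulr1 ep subr0 halfDr halfD /n.
by rewrite addrC subrK.
Qed.

End NormalData.

(** A normal projection is [q = e + (p + d) / 2] with [d = q - sh q],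
    [p = d ^ 2] and [e = q * sh q]; here [d] is replaced by its [sgn], and [e] by a
    spectral projection of the compression of the hermitian part to [1 - p]. *)
Definition normal_retract x :=
  let d := x - sh x in
  proj ((1 - supp d) * hermitian_part x * (1 - supp d)) * (1 - supp d)
  + half (supp d + sgn d).

Lemma normal_retract_fix q : normal_idem q -> normal_retract q = q.
Proof.
move=> qn; rewrite /normal_retract.
have [-> ->] := normal_supp qn; rewrite (normal_compression qn).
have [[_ ee _ _] _] := normal_data qn.
by rewrite proj_fix// (normal_decomp qn).
Qed.

(** [k] and [p] annihilate each other, so [proj k] commutes with [p]; the factor [1 - p] then gives
    a selfadjoint idempotent orthogonal to [p], as [normal_idem_of] needs. *)
Lemma normal_retract_normal x : let d := x - sh x in
  let k := (1 - supp d) * hermitian_part x * (1 - supp d) in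
  proj_good sh (d * d) -> isq_good sh (modulus2 d) -> proj_good sh k ->
  normal_idem (normal_retract x).
Proof.
move=> d k gd gm gk.
have sd : sh d = - d by rewrite /d (shB shD shZ) shK opprB.
have [pp sp DD [pD Dp] sD] := sgn_skew sd gd gm.
rewrite /normal_retract -/d -/k.
move: (supp d) (sgn d) @k gk pp sp DD pD Dp sD => p D k gk pp sp DD pD Dp sD.
have p1 : p * (1 - p) = 0 by rewrite mulrBr mulr1 pp subrr.
have p1' : (1 - p) * p = 0 by rewrite mulrBl mul1r pp subrr.
have p11 : (1 - p) * (1 - p) = 1 - p by rewrite mulrBr mulr1 p1' subr0.
have s1p : sh (1 - p) = 1 - p by rewrite (shB shD shZ) sp (sh1 shM shK).
have sk : sh k = k by rewrite /k !shM s1p sh_hermitian_part mulrA.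
have pk : GRing.comm p k.
  by rewrite /GRing.comm /k !mulrA p1 !mul0r -!mulrA p1' !mulr0.
have epr := proj_idem gk; have esh := proj_sh shD shZ shM shK gk sk.
have pe : GRing.comm p (proj k) by exact: proj_comm gk pk.
have e1 : GRing.comm (1 - p) (proj k).
  by apply/GRing.commr_sym/GRing.commrB; [exact: GRing.commr1|exact: GRing.commr_sym].
have [] // := @normal_idem_of (proj k * (1 - p)) p D.
- by rewrite mulrA -(mulrA _ (1 - p)) e1 mulrA epr -mulrA p11.
- by rewrite shM s1p esh.
- by rewrite -mulrA p1' mulr0.
- by rewrite mulrA pe -mulrA p1 mulr0.
Qed.

Lemma normal_retraction q : normal_idem q -> local_retraction normal_idem normal_retract q.
Proof.
move=> qn; have ida := @analytic_at_id R A q.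
have da : analytic_at (fun x => x - sh x) q.
  by apply: analytic_atB => //; exact: (analytic_at_sh shD shZ sh_bounded ida).
have dda : analytic_at (fun x => (x - sh x) * (x - sh x)) q by exact: analytic_atM.
have [dd ddd pp sd] := normal_skew qn.
have dd_idem : (q - sh q) * (q - sh q) * ((q - sh q) * (q - sh q)) =
  (q - sh q) * (q - sh q) by rewrite mulrA ddd.
have pa : analytic_at (fun x => supp (x - sh x)) q by exact: analytic_at_proj dda dd_idem.
have gd := near_proj_good shD shZ shM shK sh_bounded dda dd_idem.
have p1a : analytic_at (fun x => 1 - supp (x - sh x)) q.
  exact: (analytic_atB (analytic_at_cst _ _) pa).
have ma : analytic_at (fun x => modulus2 (x - sh x)) q.
  exact: (analytic_atD (analytic_atM dda pa) p1a).
have [sp sg] := normal_supp qn.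
have m1 : modulus2 (q - sh q) = 1 by rewrite /modulus2 sp dd pp addrC subrK.
have gm := near_isq_good_comp shD shZ shM shK sh_bounded ma m1.
have ka : analytic_at (fun x => (1 - supp (x - sh x)) * hermitian_part x *
    (1 - supp (x - sh x))) q.
  exact: (analytic_atM (analytic_atM p1a (analytic_at_hermitian_part ida)) p1a).
have kk : (1 - supp (q - sh q)) * hermitian_part q * (1 - supp (q - sh q)) = q * sh q.
  by rewrite sp; exact: normal_compression.
have k_idem : (1 - supp (q - sh q)) * hermitian_part q * (1 - supp (q - sh q)) *
   ((1 - supp (q - sh q)) * hermitian_part q * (1 - supp (q - sh q))) =
   (1 - supp (q - sh q)) * hermitian_part q * (1 - supp (q - sh q)).
  by rewrite kk; have [[_ ee _ _] _] := normal_data qn.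
have gk := near_proj_good shD shZ shM shK sh_bounded ka k_idem.
have sa : analytic_at (fun x => sgn (x - sh x)) q.
  exact: (analytic_atM (analytic_atM da pa) (analytic_at_isq ma m1)).
split; first exact: qn.
- exact: (analytic_atD (analytic_atM (analytic_at_proj ka k_idem) p1a)
    (analytic_at_half (analytic_atD pa sa))).
- near=> x; apply: normal_retract_normal; first by near: x.
  + by near: x.
  + by near: x.
- by near=> x; exact: normal_retract_fix.
Unshelve. all: by end_near. Qed.

Let conjM (c c' x y : A) : c' * c = 1 -> c * x * c' * (c * y * c') = c * (x * y) * c'.
Proof. by move=> cc; rewrite -!mulrA (mulrA c') cc mul1r. Qed.

Let sh_conj (c c' x : A) : sh c = c' -> sh (c * x * c') = c * sh x * c'.
Proof. by move=> <-; rewrite !shM shK mulrA. Qed.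

(** * Conjugation by Cayley transforms *)

Section Cayley.
Variable z : A.
Hypothesis sz : sh z = - z.

Let lin (t : R^o) : A := 1 + t *: z.
Let lin' (t : R^o) : A := 1 + t *: - z.
Let inv (t : R^o) : A := oinv (lin t).
Let inv' (t : R^o) : A := oinv (lin' t).
(** The Cayley transform of [t z] and its adjoint, which is its inverse. *)
Let cay (t : R^o) : A := lin t * inv' t.
Let cay' (t : R^o) : A := inv t * lin' t.

Let lin_analytic (y : A) : analytic_at (fun t : R^o => 1 + t *: y : A) 0 := analytic_at_line (1 : A) y 0.

Let lin_diff (y : A) : 'd (fun t : R^o => 1 + t *: y : A) (0 : R^o) (1 : R^o) = y.
Proof.
have [_] := is_derive_line (1 : A) y.
by rewrite deriveE//; exact/analytic_at_differentiable/lin_analytic.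
Qed.

Let inv_facts (y : A) (l := fun t : R^o => 1 + t *: y : A) :
  [/\ analytic_at (fun t => oinv (l t)) 0, oinv (l 0) = 1,
      'd (fun t => oinv (l t)) (0 : R^o) (1 : R^o) = - y &
      \forall t \near (0 : R^o), l t * oinv (l t) = 1 /\ oinv (l t) * l t = 1].
Proof.
have la : analytic_at l 0 := analytic_at_line (1 : A) y 0.
have l0 : l 0 = 1 by rewrite /l scale0r addr0.
have ia : analytic_at (fun t => oinv (l t)) 0.
  by apply: (@analytic_at_comp _ _ _ _ oinv l) => //; rewrite l0; exact: oinv_analytic.
have near1 : \forall t \near (0 : R^o), l t * oinv (l t) = 1 /\ oinv (l t) * l t = 1.
  apply: (analytic_at_nbhs (P := fun b => b * oinv b = 1 /\ oinv b * b = 1) la).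
  by rewrite l0; exact: near_oinv.
have i0 : oinv (l 0) = 1 by rewrite l0 oinv1.
split=> //; rewrite -[in RHS](lin_diff y).
apply: (differential_inverse _ la ia l0 i0).
by apply: filterS near1 => t [].
Qed.

Let cay_facts : [/\ analytic_at cay 0, cay 0 = 1 & 'd cay (0 : R^o) (1 : R^o) = z + z].
Proof.
have [ia i0 di _] := inv_facts (- z); have la := lin_analytic z.
have l0 : lin 0 = 1 by rewrite /lin scale0r addr0.
split; first exact: analytic_atM.
  by rewrite /cay l0 mul1r.
by have := etrans (differentialM1 (1 : R^o) la ia l0 i0) (congr2 +%R di (lin_diff z)); rewrite opprK.
Qed.

Let cay'_facts : [/\ analytic_at cay' 0, cay' 0 = 1 & 'd cay' (0 : R^o) (1 : R^o) = - (z + z)].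
Proof.
have [ia i0 di _] := inv_facts z; have la := lin_analytic (- z).
have l0 : lin' 0 = 1 by rewrite /lin' scale0r addr0.
split; first exact: analytic_atM.
  by rewrite /cay' l0 mulr1.
have := etrans (differentialM1 (1 : R^o) ia la i0 l0) (congr2 +%R (lin_diff (- z)) di).
by rewrite -opprD.
Qed.

Let cay_unitary : \forall t \near (0 : R^o), cay' t * cay t = 1 /\ sh (cay t) = cay' t.
Proof.
have [_ _ _ n] := inv_facts z; have [_ _ _ n'] := inv_facts (- z).
near=> t.
have [li il] : lin t * inv t = 1 /\ inv t * lin t = 1 by near: t.
have [li' il'] : lin' t * inv' t = 1 /\ inv' t * lin' t = 1 by near: t.
have sl : sh (lin t) = lin' t by rewrite /lin shD (sh1 shM shK) shZ sz.
have sl' : sh (lin' t) = lin t by rewrite -sl shK.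
have si' : sh (inv' t) = inv t.
  have := congr1 sh il'; rewrite shM sl' (sh1 shM shK) => h.
  by rewrite -[LHS]mul1r -il -mulrA h mulr1.
have ll' : lin' t * lin t = lin t * lin' t.
  rewrite /lin /lin' !mulrDl !mulrDr !mul1r !mulr1 scalerN mulNr mulrN.
  by rewrite !addrA; congr (_ + _); rewrite addrAC.
split; last by rewrite /cay shM sl si'.
by rewrite /cay /cay' -mulrA (mulrA (lin' t)) ll' -(mulrA (lin t)) li' mulr1.
Unshelve. all: by end_near. Qed.

(** As [sh (cay t)] inverts [cay t], conjugation respects products and [sh]. It therefore preserves
    normal idempotents and carries [q * sh q] along. *)
Lemma normal_conjugation_curve q : normal_idem q -> exists g : R^o -> A,
  [/\ g 0 = q, \forall t \near (0 : R^o), normal_idem (g t),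
      is_derive (0 : R^o) (1 : R^o) g ((z + z) * q - q * (z + z)) &
      is_derive (0 : R^o) (1 : R^o) (fun t => g t * sh (g t))
        ((z + z) * (q * sh q) - q * sh q * (z + z))].
Proof.
move=> [qq qs].
have [ca c0 dc] := cay_facts; have [ca' c0' dc'] := cay'_facts.
have der x : is_derive (0 : R^o) (1 : R^o) (fun t => cay t * x * cay' t)
    ((z + z) * x - x * (z + z)).
  have ga : analytic_at (fun t => cay t * x * cay' t) 0.
    by apply: analytic_atM => //; apply: analytic_atM => //; exact: analytic_at_cst.
  have gd := analytic_at_differentiable ga.
  split; first exact: diff_derivable.
  have E := differential_conj (1 : R^o) x ca ca' c0 c0'.
  have E' := congr2 (fun a b => a * x + x * b) dc dc'.
  by rewrite -mulrN; exact: etrans (deriveE _ gd) (etrans E E').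
exists (fun t => cay t * q * cay' t).
split.
- by rewrite c0 c0' mul1r mulr1.
- near=> t; have [cc sc] : cay' t * cay t = 1 /\ sh (cay t) = cay' t by near: t; exact: cay_unitary.
  by split; rewrite ?(sh_conj _ sc)// !(conjM _ _ cc)// ?qq ?qs.
- exact: der.
apply: near_eq_is_derive (der (q * sh q)); near=> t.
have [cc sc] : cay' t * cay t = 1 /\ sh (cay t) = cay' t by near: t; exact: cay_unitary.
by rewrite (sh_conj _ sc) (conjM _ _ cc).
Unshelve. all: by end_near. Qed.

End Cayley.

(** Differentiating [g g = g] and [sh g = g] along a curve [g]. *)
Lemma selfadjoint_tangent e w : selfadjoint_idem e -> tangent_space selfadjoint_idem e w ->
  [/\ w = w * e + e * w, e * w * e = 0 & sh w = w].
Proof.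
move=> [ee se] [g [[g0 [r r0 [_ Sg]]] gw]].
have near_idem : \forall t \near (0 : R^o), selfadjoint_idem (g t).
  apply/near_ball; exists r^-1; rewrite ?invr_gt0// => t.
  by rewrite add0r ltr_pdivrMl// mulr1 => /Sg.
have ida := @analytic_at_id R A e.
have vel (f : A -> A) : analytic_at f e -> (forall x, selfadjoint_idem x -> f x = x) ->
    'd f e w = w.
  move=> fa fx; rewrite -g0.
  have fg : is_derive (0 : R^o) (1 : R^o) (f \o g) ('d f (g 0) w).
    by apply: is_derive_comp => //; rewrite g0; exact: analytic_at_differentiable.
  have gf : \forall t \near (0 : R^o), (f \o g) t = g t.
    by apply: filterS near_idem => t /fx.
  by have [_ <-] := near_eq_is_derive gf fg; case: gw.
have we : w = w * e + e * w.
  have wd := vel _ (analytic_atM ida ida) (fun x xS => xS.1).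
  by rewrite addrC; exact: etrans (esym wd) (differential_square e w).
have sw : sh w = w.
  have wd := vel sh (analytic_at_sh shD shZ sh_bounded ida) (fun x xS => xS.2).
  exact: etrans (esym (differential_sh shD shZ sh_bounded e w)) wd.
split=> //.
(* Compressing [w = w * e + e * w] by [e] gives [e * w * e] on the left and twice that on the
   right. *)
have := congr1 (fun x => e * x * e) we.
rewrite /= mulrDr mulrDl !mulrA ee -!mulrA ee !mulrA => /esym/eqP.
by rewrite -subr_eq0 addrK => /eqP.
Qed.

(** The hypotheses say that [w] is off-diagonal with respect to [e]; on such elements the double
    commutator with [e] is the identity. *)
Let double_comm (e w : A) : e * e = e -> e * w * e = 0 -> w = w * e + e * w ->
  (w * e - e * w) * e - e * (w * e - e * w) = w.
Proof.
move=> ee ewe we; rewrite mulrBl mulrBr -(mulrA w e e) ee (mulrA e w e) ewe (mulrA e e w) ee.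
by rewrite subr0 sub0r opprK -we.
Qed.

(** With [z = [w, e]], conjugating [q] moves it with velocity [[z, q]] and moves
    [e = q * sh q] with velocity [[z, e] = w]. *)
Lemma normal_square_section q : normal_idem q ->
  exists s : {linear A -> A}, continuous s /\
    forall w, tangent_space selfadjoint_idem (q * sh q) w ->
      tangent_space normal_idem q (s w) /\ 'd (fun x => x * sh x) q (s w) = w.
Proof.
move=> qn; pose e := q * sh q.
have [[_ ee se _] _] := normal_data qn; rewrite -/e in ee se.
pose comm w x := w * x - x * w.
pose sf w := comm (comm w e) q.
have comm_lin x : linear (comm^~ x).
  move=> t a b; rewrite /comm mulrDl mulrDr -op_scalerAl -op_scalerAr opprD addrACA.
  by rewrite scalerBr.
have sl : linear sf by move=> t a b; rewrite /sf comm_lin comm_lin.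
pose s : {linear A -> A} := HB.pack sf (GRing.isLinear.Build R A A _ _ sl).
have comm_le x w : `|comm w x| <= 2 * `|x| * `|w|.
  apply: le_trans (ler_normB _ _) _; have := opnormM w x; have := opnormM x w; lra.
exists s; split.
  apply: (linear_le_continuous (L := s) (K := 2 * `|q| * (2 * `|e|))) => w.
  apply: le_trans (comm_le q _) _; rewrite -[leRHS]mulrA.
  by apply: ler_wpM2l; [rewrite mulr_ge0|exact: comm_le].
move=> w wT; have [we ewe sw] := selfadjoint_tangent (conj ee se) wT.
pose z := comm w e.
have sz : sh z = - z by rewrite /z /comm (shB shD shZ) (shM w e) (shM e w) sw se opprB.
(* The Cayley transform of [t *: z] has velocity [z + z] at [0], hence the half. *)
have shz : sh (half z) = - half z by rewrite sh_half sz halfN.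
have [g [g0 Sg gd fgd]] := normal_conjugation_curve shz qn.
rewrite halfD in gd fgd; have rq := normal_retraction qn.
split.
  by rewrite (tangent_space_retraction rq); exact: (retraction_velocity rq g0 Sg gd).
have fa : analytic_at (fun x => x * sh x) q.
  by apply: analytic_atM; [|apply: (analytic_at_sh shD shZ sh_bounded)]; exact: analytic_at_id.
have := is_derive_comp (f := fun x => x * sh x) gd.
rewrite g0 => /(_ (analytic_at_differentiable fa)) [_ h].
rewrite -[s w]/(z * q - q * z) -h; have [_ ->] := fgd.
exact: double_comm ee ewe we.
Qed.

Theorem krein_submersion :
  [/\ analytic_submanifold normal_idem, analytic_submanifold selfadjoint_idem &
      analytic_submersion normal_idem selfadjoint_idem (fun x => x * sh x)].
Proof.
have sub (S : set A) : (forall x, S x -> exists r, local_retraction S r x) ->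
    analytic_submanifold S.
  move=> Sr x /Sr[r rx].
  by have [c [cS _ _ _]] := retraction_chart rx (@filterT _ (nbhs x) _); exists c.
have nr q : normal_idem q -> exists r, local_retraction normal_idem r q.
  by move=> qn; exists normal_retract; exact: normal_retraction.
have sr e : selfadjoint_idem e -> exists r, local_retraction selfadjoint_idem r e.
  by move=> en; eexists; exact: selfadjoint_retraction.
split; [exact: sub|exact: sub|].
apply: retraction_submersion => //.
- by move=> q qn; have [[_ ? ? _] _] := normal_data qn.
- move=> q _; apply: analytic_atM; first exact: analytic_at_id.
  by apply: (analytic_at_sh shD shZ sh_bounded); exact: analytic_at_id.
- exact: normal_square_section.
Qed.

End KreinRetractions.

Unset Implicit Arguments.

Theorem theorem4p4 (R : realType) (H : completeNormedModType R[i])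
  (ip : {dot H for @Num.conj R[i]}) (J : bounded_op H)
  (ip_norm : induces_norm ip) (H_separable : separable_space H)
  (J_symmetry : is_symmetry ip J) :
  [/\ analytic_submanifold (J_normal_projections ip J),
      analytic_submanifold (J_selfadjoint_projections ip J) &
      analytic_submersion (J_normal_projections ip J)
        (J_selfadjoint_projections ip J)
        (fun Q : bounded_op H => Q * J_adjoint ip J Q)].
Proof.
have [Jadj JJ] := J_symmetry.
apply: (@krein_submersion R H (J_adjoint ip J) (`|J| * `|J|)).
- by move=> S T; rewrite /J_adjoint adjointD// mulrDr mulrDl.
- by move=> c T; rewrite /J_adjoint adjointZ// -op_scalerAr -op_scalerAl.
- move=> S T; rewrite /J_adjoint adjointM// !mulrA.
  by rewrite -[J * _ * J * J]mulrA JJ mulr1.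
- move=> T; rewrite /J_adjoint !adjointM// adjointK// Jadj !mulrA JJ mul1r.
  by rewrite -mulrA JJ mulr1.
move=> T; rewrite /J_adjoint; apply: le_trans (opnormM _ _) _.
rewrite mulrAC ler_wpM2r//; apply: le_trans (opnormM _ _) _.
by rewrite ler_wpM2l// opnorm_adjoint.
Qed.
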